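(* Let $N\ge2$ and let $u$ be the solution of $\partial_tu=\Delta u+f(u)$ in $(0,+\infty)\times\mathbb R^N$ with $f(s)=s(1-s)$ for $s\in[0,1]$ and initial datum $u_0=\mathbf 1_U$, where $U=U_1\cup U_2$ and $$U_1=\big\{x\in\mathbb R^N:x_1\ge0\text{ and }x_2^2+\cdots+x_N^2\le1\big\},$$ $$U_2=\big\{x\in\mathbb R^N:x_1\ge0\text{ and }(x_2-\sqrt{x_1})^2+x_3^2+\cdots+x_N^2\le e^{-x_1^2}\big\}.$$ The set $U$ has a non-empty interior; it does not fulfill $(D_\rho)$ for any $\rho>0$, but it fulfills $(G_\rho)$ for every $0<\rho\le1$ (hence properties (i), (ii), (iii), (iv) of the context hold). Moreover, property (v) of the context fails; the limit $\lim_{t\to+\infty}\frac1tE_\lambda(t)$ exists and is equal to $\mathcal W$, in the sense that $d_{\mathcal H}(\frac1tE_\lambda(t),\mathcal W)\to0$ as $t\to+\infty$ for any $\lambda\in(0,1)$; whereas the limit $\lim_{t\to+\infty}\big(\frac1tU+B_{c^*}\big)$ does not exist, in the sense that there is no set $\mathcal W'\subset\mathbb R^N$ such that $d_{\mathcal H}(\frac1tU+B_{c^*},\mathcal W')\to0$ as $t\to+\infty$.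
   Context: $B_r(x)$ is the open Euclidean ball in $\mathbb R^N$, $B_r=B_r(0)$; $\mathbb S^{N-1}$ is the unit sphere; $\mathrm{dist}(x,A)=\inf\{|y-x|:y\in A\}$ with $\mathrm{dist}(x,\emptyset)=+\infty$. The function $f$ is extended by $0$ outside $[0,1]$. The solution with initial datum $u_0$ is the unique bounded classical solution with $u(t,\cdot)\to u_0$ in $L^1_{loc}(\mathbb R^N)$ as $t\to0^+$. $c^*=2$ is the minimal speed of planar traveling fronts connecting $1$ to $0$ for this $f$. $E_\lambda(t)=\{x\in\mathbb R^N:u(t,x)>\lambda\}$. The Hausdorff distance of $A,B\subset\mathbb R^N$ is $d_{\mathcal H}(A,B)=\max\big(\sup_{x\in A}\mathrm{dist}(x,B),\sup_{y\in B}\mathrm{dist}(y,A)\big)$, with $d_{\mathcal H}(A,\emptyset)=d_{\mathcal H}(\emptyset,A)=+\infty$ if $A\ne\emptyset$ and $d_{\mathcal H}(\emptyset,\emptyset)=0$. For $A\subset\mathbb R^N$: $\mathcal B(A)=\{\xi\in\mathbb S^{N-1}:\liminf_{\tau\to+\infty}\mathrm{dist}(\tau\xi,A)/\tau>0\}$, $\mathcal U(A)=\{\xi\in\mathbb S^{N-1}:\lim_{\tau\to+\infty}\mathrm{dist}(\tau\xi,A)/\tau=0\}$; $U_\rho=\{x\in U:\mathrm{dist}(x,\partial U)\ge\rho\}$. $w(e)=\sup_{\xi\in\mathcal U(U),\,\xi\cdot e\ge0}c^*/\sqrt{1-(\xi\cdot e)^2}$ for $e\in\mathbb S^{N-1}$,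 with $w(e)=c^*$ if there is no $\xi\in\mathcal U(U)$ with $\xi\cdot e\ge0$, and $w(e)=+\infty$ if $e\in\mathcal U(U)$. $\mathcal W=\{re:e\in\mathbb S^{N-1},\ 0\le r<w(e)\}$. Conditions: $(G_\rho)$: $\mathcal B(U)\cup\mathcal U(U_\rho)=\mathbb S^{N-1}$. $(D_\rho)$: $d_{\mathcal H}(U,U_\rho)<+\infty$. Properties: (i) for every $e\in\mathbb S^{N-1}$: $u(t,cte)\to1$ as $t\to+\infty$ for every $0\le c<w(e)$, and $u(t,cte)\to0$ as $t\to+\infty$ for every $c>w(e)$. (ii) for every $e\in\mathbb S^{N-1}$: $\lim_{t\to+\infty}\min_{0\le s\le c}u(t,ste)=1$ for every $0\le c<w(e)$, and $\lim_{t\to+\infty}\sup_{s\ge c}u(t,ste)=0$ for every $c>w(e)$. (iii) for every compact set $C\subset\mathbb R^N$: $\lim_{t\to+\infty}\min_{x\in C}u(t,tx)=1$ if $C\subset\mathcal W$, and $\lim_{t\to+\infty}\max_{x\in C}u(t,tx)=0$ if $C\subset\mathbb R^N\setminus\overline{\mathcal W}$. (iv) for every $R>0$ and $\lambda\in(0,1)$: $d_{\mathcal H}\big(\overline{B_R}\cap\frac1tE_\lambda(t),\overline{B_R}\cap\mathcal W\big)\to0$ as $t\to+\infty$. (v) for every $\lambda\in(0,1)$: $d_{\mathcal H}(E_\lambda(t),U+B_{c^*t})=o(t)$ as $t\to+\infty$. *)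

(* Defs.v *)
From HB Require Import structures.
From mathcomp Require Import all_boot all_order all_algebra.
From mathcomp Require Import all_classical all_reals all_analysis.

Set Implicit Arguments.
Unset Strict Implicit.
Unset Printing Implicit Defensive.

Import Order.TTheory GRing.Theory Num.Theory.
Import numFieldNormedType.Exports.

Local Open Scope classical_set_scope.
Local Open Scope ring_scope.

(* R^N is 'rV[R]_N. The library equips it with the sup norm, whose topology is
   the Euclidean one, so closure, interior, compact and continuous are taken
   from the library; the Euclidean metric notions are defined here. *)
Section euclidean.
Context {R : realType} {N : nat}.
Implicit Types (x y e : 'rV[R]_N) (A B : set 'rV[R]_N) (r : R).

Definition dot x y : R := \sum_(i < N) x ord0 i * y ord0 i.
Definition enorm x : R := Num.sqrt (dot x x).
Definition eball r : set 'rV[R]_N := [set x | enorm x < r].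
Definition usphere : set 'rV[R]_N := [set x | enorm x = 1].

Definition frontier A : set 'rV[R]_N := closure A `\` A°.

(* The (k+1)-st coordinate of x for k < N (and 0 for k >= N). *)
Definition xcoord x (k : nat) : R :=
  if insub k is Some i then x ord0 i else 0.

(* dist x set0 = +oo. *)
Definition dist x A : \bar R := ereal_inf [set (enorm (y - x))%:E | y in A].

(* The value 0 is adjoined because ereal_sup set0 = -oo: suprema of distances
   are taken in [0, +oo], so that hausdorff set0 set0 = 0. *)
Definition hausdorff A B : \bar R :=
  maxe 0%E (maxe (ereal_sup [set dist x B | x in A])
                 (ereal_sup [set dist y A | y in B])).

Definition scale r A : set 'rV[R]_N := [set r *: x | x in A].
Definition sumset A B : set 'rV[R]_N :=
  [set z | exists x y, [/\ A x, B y & z = x + y]].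

End euclidean.

(* Lebesgue integral over R^n of a nonnegative Borel function, as an iterated
   one-dimensional Lebesgue integral (Tonelli). *)
Fixpoint nintegral {R : realType} (n : nat) : ('rV[R]_n -> \bar R) -> \bar R :=
  match n with
  | 0%N => fun g => g 0
  | m.+1 => fun g =>
      (\int[@lebesgue_measure R]_s
         nintegral (fun y : 'rV[R]_m => g (row_mx (const_mx s : 'rV_1) y)))%E
  end.

Section solutions.
Context {R : realType} {N : nat}.
Implicit Types (u : R -> 'rV[R]_N -> R) (uinit : 'rV[R]_N -> R) (f : R -> R).

Definition ebasis (i : 'I_N) : 'rV[R]_N := delta_mx ord0 i.

Definition dt u (t : R) (x : 'rV[R]_N) : R := derive1 (fun s => u s x) t.
Definition dx u (i : 'I_N) (t : R) (x : 'rV[R]_N) : R := 'D_(ebasis i) (u t) x.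
Definition laplacian u (t : R) (x : 'rV[R]_N) : R :=
  \sum_(i < N) dx (dx u i) i t x.

Definition continuous_pos u :=
  forall p : R * 'rV[R]_N, 0 < p.1 ->
    {for p, continuous (fun q : R * 'rV[R]_N => u q.1 q.2)}.

(* u is C^1 in t and C^2 in x on (0,+oo) x R^N. *)
Definition C12 u :=
  [/\ forall t x, 0 < t -> derivable (fun s => u s x) t 1,
      forall i t x, 0 < t -> derivable (u t) x (ebasis i),
      forall i j t x, 0 < t -> derivable (dx u i t) x (ebasis j)
    & [/\ continuous_pos u, continuous_pos (dt u),
          forall i, continuous_pos (dx u i)
        & forall i j, continuous_pos (dx (dx u i) j)]].

Definition L1loc_initial u uinit :=
  forall K : set 'rV[R]_N, compact K ->
    nintegral (fun x => (\1_K x * `|u t x - uinit x|)%:E) @[t --> 0^'+] --> 0%E.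

(* Bounded classical solution of u_t = Laplacian u + f(u) in (0,+oo) x R^N with
   initial datum uinit; the values of u at t <= 0 are irrelevant. *)
Definition bounded_classical_solution f uinit u :=
  [/\ exists M : R, forall t x, 0 < t -> `|u t x| <= M,
      C12 u,
      forall t x, 0 < t -> dt u t x = laplacian u t x + f (u t x)
    & L1loc_initial u uinit].

Definition superlevel u (lam t : R) : set 'rV[R]_N := [set x | lam < u t x].

End solutions.

Definition logistic {R : realType} (s : R) : R :=
  if 0 <= s <= 1 then s * (1 - s) else 0.

(* Minimal speed of planar fronts for the logistic nonlinearity: 2 sqrt(f'(0)) *)
Definition cstar {R : realType} : R := 2.

Section directions.
Context {R : realType} {N : nat}.
Implicit Types (A U : set 'rV[R]_N) (e xi : 'rV[R]_N).

Definition bounded_dirs A : set 'rV[R]_N :=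
  [set xi | usphere xi /\
    (0 < limf_einf (fun tau : R => dist (tau *: xi) A * (tau^-1)%:E)
                   (pinfty_nbhs R))%E].

Definition unbounded_dirs A : set 'rV[R]_N :=
  [set xi | usphere xi /\
    (dist (tau *: xi) A * (tau^-1)%:E)%E @[tau --> +oo] --> 0%E].

Definition erosion (rho : R) U : set 'rV[R]_N :=
  [set x | U x /\ (rho%:E <= dist x (frontier U))%E].

Definition condG rho U :=
  bounded_dirs U `|` unbounded_dirs (erosion rho U) = usphere.

Definition condD rho U := (hausdorff U (erosion rho U) < +oo)%E.

Definition facing_dirs U e : set 'rV[R]_N :=
  [set xi | unbounded_dirs U xi /\ 0 <= dot xi e].

Definition speed U e : \bar R :=
  if `[< unbounded_dirs U e >] then +oo%E
  else if `[< facing_dirs U e = set0 >] then cstar%:E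
  else ereal_sup [set (cstar / Num.sqrt (1 - dot xi e ^+ 2))%:E
                 | xi in facing_dirs U e].

Definition wulff U : set 'rV[R]_N :=
  [set x | exists e r, [/\ usphere e, 0 <= r, (r%:E < speed U e)%E
                         & x = r *: e]].

End directions.

Section properties.
Context {R : realType} {N : nat}.
Implicit Types (U : set 'rV[R]_N) (u : R -> 'rV[R]_N -> R).

(* The minima and maxima are ereal_inf and ereal_sup: u is continuous for t > 0
   and the sets are compact, so they are attained. *)

Definition prop_i U u :=
  forall e, usphere e ->
    (forall c : R, 0 <= c -> (c%:E < speed U e)%E ->
       u t ((c * t) *: e) @[t --> +oo] --> (1 : R)) /\
    (forall c : R, (speed U e < c%:E)%E ->
       u t ((c * t) *: e) @[t --> +oo] --> (0 : R)).

Definition prop_ii U u :=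
  forall e, usphere e ->
    (forall c : R, 0 <= c -> (c%:E < speed U e)%E ->
       ereal_inf [set (u t ((s * t) *: e))%:E | s in `[0, c]]
         @[t --> +oo] --> 1%E) /\
    (forall c : R, (speed U e < c%:E)%E ->
       ereal_sup [set (u t ((s * t) *: e))%:E | s in `[c, +oo[]
         @[t --> +oo] --> 0%E).

(* Minima and maxima over C only make sense for C nonempty. *)
Definition prop_iii U u :=
  forall C : set 'rV[R]_N, compact C -> C !=set0 ->
    (C `<=` wulff U ->
       ereal_inf [set (u t (t *: x))%:E | x in C] @[t --> +oo] --> 1%E) /\
    (C `<=` ~` closure (wulff U) ->
       ereal_sup [set (u t (t *: x))%:E | x in C] @[t --> +oo] --> 0%E).

Definition prop_iv U u :=
  forall Rad lam : R, 0 < Rad -> 0 < lam < 1 ->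
    hausdorff (closure (eball Rad) `&` scale t^-1 (superlevel u lam t))
              (closure (eball Rad) `&` wulff U) @[t --> +oo] --> 0%E.

Definition prop_v U u :=
  forall lam : R, 0 < lam < 1 ->
    (hausdorff (superlevel u lam t) (sumset U (eball (cstar * t)))
       * (t^-1)%:E)%E @[t --> +oo] --> 0%E.

End properties.

Section example.
Context {R : realType} {N : nat}.

Definition U1 : set 'rV[R]_N :=
  [set x | 0 <= xcoord x 0 /\ \sum_(i < N | (1 <= i)%N) x ord0 i ^+ 2 <= 1].

Definition U2 : set 'rV[R]_N :=
  [set x | 0 <= xcoord x 0 /\
    (xcoord x 1 - Num.sqrt (xcoord x 0)) ^+ 2
      + \sum_(i < N | (2 <= i)%N) x ord0 i ^+ 2 <= expR (- xcoord x 0 ^+ 2)].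

Definition U12 : set 'rV[R]_N := U1 `|` U2.

End example.

(* Main.v *)
Require Import Defs.
From HB Require Import structures.
From mathcomp Require Import all_boot all_order all_algebra.
From mathcomp Require Import all_classical all_reals all_analysis.
From mathcomp Require Import measurable_realfun ring lra.

(* Only the maximum principle is used. The initial datum is reached in L^1_loc only, so
   u is first averaged over the points of a fine grid of a small box: the average of
   finitely many translates of a subsolution of a linear equation is again a subsolution,
   and for small times it is close to the box average of the indicator function of U.
   Comparing averages gives 0 <= u <= 1, then u >= an explicit expanding bump around each
   unit ball contained in U, and u <= exp(2t - e.x + a) + (a small term) for unit e with
   e.e_1 <= 0; the small term comes from the part of U_2 far from the half-line
   L = {s e_1 : s >= 0}, which is so thin that its box averages are superexponentially
   small. A reflection argument bounds the Lipschitz constant of u(t, .), which turns bounds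
   on averages into pointwise ones. For the lower bound, compactly supported bumps moving
   with any velocity of norm < 2 are subsolutions, and once u is bounded below, 1 - u decays
   exponentially. Hence u -> 1 uniformly where dist(x, L) <= ct for c < 2 and u -> 0 uniformly
   where dist(x, L) >= ct for c > 2, and the set W is {dist(., L) < 2}. The parabola in U_2
   leaves every neighborhood of L, so U is not asymptotically within bounded distance of L,
   and its dilations by 1/t do not converge either. *)

Import Order.TTheory GRing.Theory Num.Theory.
Import numFieldNormedType.Exports.
Local Open Scope classical_set_scope.
Local Open Scope ring_scope.
Set Implicit Arguments.
Unset Strict Implicit.
Unset Printing Implicit Defensive.

(** Two obstacles shape the argument. No pointwise inequality is available at t = 0, and a plane
    wave alone cannot dominate the datum, since the parabola makes e.x unbounded on U for e = e_2.
    Averaging over boxes answers both. The box side [delta] and the number [n] of grid points per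
    side are independent: [n] may depend on the small time at which a comparison starts, [delta] may
    not. For the lower bounds [delta] tends to 0 at the end. For the upper bound it must stay
    positive, because the far part of U_2 has box averages of order h / delta with h = exp(-M^4 /
    2); this is what the Lipschitz bound, uniform in time, is for. With M a small multiple of t,
    exp(-M^4 / 2) still beats exp t, while letting the wave start at e.x = M only costs a small
    change of speed. The speed 2 enters twice: exp(2t - e.x) with |e| = 1 solves w_t = Delta w + w,
    and a bump moving with velocity c loses |c|^2 / 4 of a growth rate that can be taken arbitrarily
    close to 1. *)

Section one_variable.
Context {R : realType}.
Implicit Types (k g : R -> R) (t a h : R).

(** Left difference quotients are nonnegative, hence so is their limit. One-sided, because a
    space-time maximum may lie at the final time. *)
Lemma is_derive_left_max k t a :
  is_derive t 1 k a -> (\forall r \near (0:R)^'+, k (t - r) <= k t) -> 0 <= a.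
Proof.
move=> dk kmax; rewrite leNgt; apply/negP => a0.
have [/cvg_ex[/= l kl] dka] := dk.
have la : l = a by rewrite -dka; apply/esym/cvg_lim.
rewrite la in kl.
have : \forall r \near (0:R)^', r^-1 *: (k (r *: 1 + t) - k t) < 0.
  exact: (cvgr_lt _ kl).
rewrite near_withinE => /nbhs_ballP[e /= e0 He].
have [r] : exists r : R, 0 < r < e /\ k (t - r) <= k t.
  near (0:R)^'+ => r; exists r; split; last by near: r.
  by apply/andP; split; near: r; [exact: nbhs_right_gt|exact: nbhs_right_lt].
move=> [/andP[r0 re] kr].
have := He (- r); rewrite /ball /= sub0r opprK gtr0_norm// => /(_ re).
rewrite oppr_eq0 gt_eqF// => /(_ isT).
rewrite [_ *: 1]mulr1 [- r + t]addrC => H.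
have : (- r)^-1 * (k (t - r) - k t) < 0 by exact: H.
by rewrite invrN mulNr oppr_lt0 pmulr_rgt0 ?invr_gt0// subr_gt0 ltNge kr.
Unshelve. all: by end_near. Qed.

(** The first derivative [g] vanishes at 0 by the previous lemma applied to [k] and to its
    reflection. A positive [h] would make [g] positive just to the right of 0, and the mean value
    theorem would give k r > k 0. *)
Lemma is_derive_local_max2 k g h :
  (forall r : R, is_derive r 1 k (g r)) -> is_derive (0:R) 1 g h ->
  (\forall r \near (0:R), k r <= k 0) -> h <= 0.
Proof.
move=> dk dg kmax; rewrite leNgt; apply/negP => h0.
have g0 : g 0 = 0.
  apply/eqP; rewrite eq_le; apply/andP; split.
    rewrite -oppr_ge0.
    have dk' : is_derive (0:R) 1 (k \o -%R) (- g 0).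
      have := @is_derive1_comp R k -%R 0 _ (-1).
      rewrite oppr0 => /(_ (g 0) (dk 0)).
      by rewrite mulrN1; apply; exact: is_deriveNid.
    apply: (is_derive_left_max dk').
    near=> r; rewrite /= opprB subr0 oppr0; near: r.
    by apply: cvg_within; exact: kmax.
  apply: (is_derive_left_max (dk 0)).
  have : \forall r \near (0:R), k (- r) <= k 0.
    have oc : -%R x @[x --> (0:R)] --> (0:R).
      by rewrite -[X in _ --> X]oppr0; apply: cvgN; exact: cvg_id.
    exact: (oc _ kmax).
  move=> H; near=> r; rewrite sub0r; near: r; by apply: cvg_within; exact: H.
have [/cvg_ex[/= l gl] dga] := dg.
have lh : l = h by rewrite -dga; apply/esym/cvg_lim.
rewrite lh in gl.
have : \forall r \near (0:R)^', 0 < r^-1 *: (g (r *: 1 + 0) - g 0).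
  exact: (cvgr_gt _ gl).
rewrite near_withinE => /nbhs_ballP[e /= e0 He].
have [r] : exists r : R, 0 < r < e /\ k r <= k 0.
  near (0:R)^'+ => r; exists r; split; last first.
    by near: r; apply: cvg_within; exact: kmax.
  by apply/andP; split; near: r; [exact: nbhs_right_gt|exact: nbhs_right_lt].
move=> [/andP[r0 re] kr].
have ck : {within `[0, r], continuous k}.
  by apply: derivable_within_continuous => x _; have [] := dk x.
have [c + E] := MVT r0 (fun x _ => dk x) ck.
rewrite in_itv /= => /andP[c0 cr].
have := He c; rewrite /ball /= sub0r normrN gtr0_norm// => /(_ (lt_trans cr re)).
rewrite gt_eqF// => /(_ isT).
rewrite [_ *: 1]mulr1 addr0 g0 subr0 => H.
have : 0 < c^-1 * g c by exact: H.
rewrite pmulr_rgt0 ?invr_gt0// => gc.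
by move: kr; rewrite -subr_le0 E leNgt mulr_gt0// subr0.
Unshelve. all: by end_near. Qed.

End one_variable.

(** * Euclidean geometry and continuity of expressions *)

Section euclidean_norm.
Context {R : realType} {N : nat}.
Implicit Types (x y z : 'rV[R]_N) (a r : R).

Lemma dotC x y : dot x y = dot y x.
Proof. by apply: eq_bigr => i _; rewrite mulrC. Qed.

Lemma dotDl x y z : dot (x + y) z = dot x z + dot y z.
Proof. by rewrite -big_split; apply: eq_bigr => i _; rewrite mxE mulrDl. Qed.

Lemma dotZl a x y : dot (a *: x) y = a * dot x y.
Proof. by rewrite mulr_sumr; apply: eq_bigr => i _; rewrite mxE mulrA. Qed.

Lemma dotNl x y : dot (- x) y = - dot x y.
Proof. by rewrite -scaleN1r dotZl mulN1r. Qed.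

Lemma dotDr x y z : dot z (x + y) = dot z x + dot z y.
Proof. by rewrite dotC dotDl !(dotC z). Qed.

Lemma dotZr a x y : dot y (a *: x) = a * dot y x.
Proof. by rewrite dotC dotZl dotC. Qed.

Lemma dotNr x y : dot x (- y) = - dot x y.
Proof. by rewrite dotC dotNl dotC. Qed.

Lemma dot0l x : dot 0 x = 0.
Proof. by rewrite -(scale0r 0) dotZl mul0r. Qed.

Lemma dot_delta x (i : 'I_N) : dot x (delta_mx ord0 i) = x ord0 i.
Proof.
rewrite /dot (bigD1 i)//= mxE !eqxx mulr1 big1 ?addr0// => j ji.
by rewrite mxE eqxx /= (negbTE ji) mulr0.
Qed.

Lemma dot_ge0 x : 0 <= dot x x.
Proof. by apply: sumr_ge0 => i _; rewrite -expr2 sqr_ge0. Qed.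

Lemma coord_sqr_le_dot x (i : 'I_N) : x ord0 i ^+ 2 <= dot x x.
Proof.
rewrite /dot (bigD1 i)//= -expr2 lerDl.
by apply: sumr_ge0 => j _; rewrite -expr2 sqr_ge0.
Qed.

Lemma dot_eq0 x : dot x x = 0 -> x = 0.
Proof.
move=> x0; apply/rowP => i; rewrite mxE; apply/eqP.
by rewrite -sqrf_eq0 eq_le sqr_ge0 andbT -x0 coord_sqr_le_dot.
Qed.

Lemma enorm_ge0 x : 0 <= enorm x.
Proof. exact: sqrtr_ge0. Qed.

Lemma sqr_enorm x : enorm x ^+ 2 = dot x x.
Proof. by rewrite sqr_sqrtr// dot_ge0. Qed.

Lemma enorm_le x a : 0 <= a -> dot x x <= a ^+ 2 -> enorm x <= a.
Proof. by move=> a0 xa; rewrite -ler_sqr ?nnegrE ?enorm_ge0// sqr_enorm. Qed.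

Lemma enorm0 : enorm (0 : 'rV[R]_N) = 0.
Proof. by rewrite /enorm dot0l sqrtr0. Qed.

Lemma enorm_eq0 x : enorm x = 0 -> x = 0.
Proof. by move=> x0; apply: dot_eq0; rewrite -sqr_enorm x0 expr0n. Qed.

Lemma enormZ a x : enorm (a *: x) = `|a| * enorm x.
Proof. by rewrite /enorm dotZl dotZr mulrA -expr2 sqrtrM ?sqr_ge0// sqrtr_sqr. Qed.

Lemma enormN x : enorm (- x) = enorm x.
Proof. by rewrite /enorm dotNl dotNr opprK. Qed.

Lemma enormBC x y : enorm (x - y) = enorm (y - x).
Proof. by rewrite -enormN opprB. Qed.

Lemma dot_le_enorm x y : dot x y <= enorm x * enorm y.
Proof.
have [x0|x0] := eqVneq (enorm x) 0.
  by rewrite x0 mul0r (enorm_eq0 x0) dot0l.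
have [y0|y0] := eqVneq (enorm y) 0.
  by rewrite y0 mulr0 (enorm_eq0 y0) dotC dot0l.
have := dot_ge0 (enorm y *: x - enorm x *: y).
rewrite !(dotDl, dotDr, dotNl, dotNr, dotZl, dotZr) -!sqr_enorm (dotC y x).
have xp : 0 < enorm x by rewrite lt_neqAle eq_sym x0 enorm_ge0.
have yp : 0 < enorm y by rewrite lt_neqAle eq_sym y0 enorm_ge0.
set X := enorm x in xp *; set Y := enorm y in yp *; set d := dot x y => H.
have : 0 <= X * Y * (X * Y - d) by nra.
by rewrite pmulr_rge0 ?mulr_gt0// subr_ge0.
Qed.

Lemma ler_enormD x y : enorm (x + y) <= enorm x + enorm y.
Proof.
rewrite -ler_sqr ?nnegrE ?addr_ge0 ?enorm_ge0// sqr_enorm !(dotDl, dotDr).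
rewrite (dotC y x) sqrrD !sqr_enorm.
by have := dot_le_enorm x y; rewrite -mulr_natl; lra.
Qed.

Lemma ler_enormB x y z : enorm (x - z) <= enorm (x - y) + enorm (y - z).
Proof. by rewrite -[x - z](subrKA y) ler_enormD. Qed.

Lemma ler_coord_enorm x (i : 'I_N) : `|x ord0 i| <= enorm x.
Proof. by rewrite -sqrtr_sqr ler_wsqrtr// coord_sqr_le_dot. Qed.

Lemma ler_norm_enorm x : `|x| <= enorm x.
Proof.
rewrite /Num.norm/= mx_normrE; apply: bigmax_le; first exact: enorm_ge0.
by move=> [i j] _ /=; rewrite (ord1 i) ler_coord_enorm.
Qed.

Lemma ler_enorm_sum x : enorm x <= \sum_(i < N) `|x ord0 i|.
Proof.
rewrite -ler_sqr ?nnegrE ?enorm_ge0 ?sumr_ge0// sqr_enorm expr2 mulr_suml.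
apply: ler_sum => i _; rewrite -expr2 -real_normK ?num_real// expr2.
rewrite ler_wpM2l// (bigD1 i)//= lerDl sumr_ge0//.
Qed.

Lemma coord_le_norm x (i : 'I_N) : `|x ord0 i| <= `|x|.
Proof.
by rewrite [leRHS]/Num.norm/= mx_normrE; apply/bigmax_geP; right; exists (ord0, i).
Qed.

Lemma ler_enorm_norm x : enorm x <= N%:R * `|x|.
Proof.
apply: (le_trans (ler_enorm_sum x)).
have -> : N%:R * `|x| = \sum_(i < N) `|x| by rewrite sumr_const card_ord mulr_natl.
by apply: ler_sum => i _; exact: coord_le_norm.
Qed.

Lemma dot_line x (i : 'I_N) r :
  dot (x + r *: delta_mx ord0 i) (x + r *: delta_mx ord0 i) =
  dot x x + 2 * r * x ord0 i + r ^+ 2.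
Proof.
rewrite !(dotDl, dotDr, dotZl, dotZr) (dotC (delta_mx _ _) x) !dot_delta.
rewrite mxE !eqxx /=; ring.
Qed.

Context {T : topologicalType}.

Lemma continuous_at_coord (i : 'I_N) (f : T -> 'rV[R]_N) (p : T) :
  continuous_at p f -> continuous_at p (fun q => f q ord0 i).
Proof.
move=> cf; apply: (@continuous_comp _ _ _ f (fun x : 'rV[R]_N => x ord0 i)) => //.
exact: coord_continuous.
Qed.

Lemma continuous_at_add (f g : T -> R) (p : T) : continuous_at p f ->
  continuous_at p g -> continuous_at p (fun q => f q + g q).
Proof. by move=> cf cg; apply: cvgD. Qed.

Lemma continuous_at_opp (f : T -> R) (p : T) : continuous_at p f ->
  continuous_at p (fun q => - f q).
Proof. by move=> cf; apply: cvgN. Qed.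

Lemma continuous_at_mul (f g : T -> R) (p : T) : continuous_at p f ->
  continuous_at p g -> continuous_at p (fun q => f q * g q).
Proof. by move=> cf cg; apply: cvgM. Qed.

Lemma continuous_at_sqr (f : T -> R) (p : T) : continuous_at p f ->
  continuous_at p (fun q => f q ^+ 2).
Proof. by move=> cf; exact: continuous_at_mul. Qed.

Lemma continuous_at_exp (f : T -> R) (p : T) : continuous_at p f ->
  continuous_at p (fun q => expR (f q)).
Proof. by move=> cf; apply: continuous_comp => //; exact: continuous_expR. Qed.

Lemma continuous_at_max (f g : T -> R) (p : T) : continuous_at p f ->
  continuous_at p g -> continuous_at p (fun q => Num.max (f q) (g q)).
Proof. by move=> cf cg; exact: continuous_max. Qed.

Lemma continuous_at_sum (F : 'I_N -> T -> R) (p : T) :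
  (forall i, continuous_at p (F i)) ->
  continuous_at p (fun q => \sum_(i < N) F i q).
Proof.
by move=> cF; apply: cvg_big => [|i _]; [exact: add_continuous|exact: cF].
Qed.

Lemma continuous_at_dot (f g : T -> 'rV[R]_N) (p : T) :
  continuous_at p f -> continuous_at p g ->
  continuous_at p (fun q => dot (f q) (g q)).
Proof.
move=> cf cg; apply: continuous_at_sum => i.
by apply: cvgM; exact: continuous_at_coord.
Qed.

Lemma continuous_at_enorm (f : T -> 'rV[R]_N) (p : T) : continuous_at p f ->
  continuous_at p (fun q => enorm (f q)).
Proof.
move=> cf; apply: (@continuous_comp _ _ _ (fun q => dot (f q) (f q)) Num.sqrt).
  exact: continuous_at_dot.
exact: sqrt_continuous.
Qed.

Lemma continuous_at_pair {U V : topologicalType} (f : T -> U) (g : T -> V) (p : T) :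
  continuous_at p f -> continuous_at p g -> continuous_at p (fun q => (f q, g q)).
Proof. by move=> cf cg; exact: cvg_pair. Qed.

Lemma continuous_at_addv (f g : T -> 'rV[R]_N) (p : T) : continuous_at p f ->
  continuous_at p g -> continuous_at p (fun q => f q + g q).
Proof. by move=> cf cg; apply: cvgD. Qed.

Lemma continuous_at_oppv (f : T -> 'rV[R]_N) (p : T) : continuous_at p f ->
  continuous_at p (fun q => - f q).
Proof. by move=> cf; apply: cvgN. Qed.

Lemma continuous_at_scalev (k : T -> R) (f : T -> 'rV[R]_N) (p : T) :
  continuous_at p k -> continuous_at p f ->
  continuous_at p (fun q => k q *: f q).
Proof. by move=> ck cf; apply: cvgZ. Qed.

End euclidean_norm.

Ltac cont := unfold prop_for; cbv beta; repeat (cbv beta; lazymatch goal with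
  | |- continuous_at _ (fun q => q) => exact: cvg_id
  | |- continuous_at _ (fun q => fst q) => exact: cvg_fst
  | |- continuous_at _ (fun q => snd q) => exact: cvg_snd
  | |- continuous_at _ (fun _ => ?c) => exact: cst_continuous
  | |- continuous_at ?p (fun q => (@?f q, @?g q)) =>
      apply: (@continuous_at_pair _ _ _ f g p)
  | |- continuous_at ?p (fun q => dot (@?f q) (@?g q)) =>
      apply: (@continuous_at_dot _ _ _ f g p)
  | |- continuous_at ?p (fun q => enorm (@?f q)) =>
      apply: (@continuous_at_enorm _ _ _ f p)
  | |- continuous_at ?p (fun q => (@?f q) + (@?g q)) =>
      first [apply: (@continuous_at_add _ _ f g p)
            |apply: (@continuous_at_addv _ _ _ f g p)]
  | |- continuous_at ?p (fun q => - (@?f q)) =>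
      first [apply: (@continuous_at_opp _ _ f p)
            |apply: (@continuous_at_oppv _ _ _ f p)]
  | |- continuous_at ?p (fun q => (@?f q) * (@?g q)) =>
      apply: (@continuous_at_mul _ _ f g p)
  | |- continuous_at ?p (fun q => (@?f q) ^+ 2) =>
      apply: (@continuous_at_sqr _ _ f p)
  | |- continuous_at ?p (fun q => (@?f q) *: (@?g q)) =>
      apply: (@continuous_at_scalev _ _ _ f g p)
  | |- continuous_at ?p (fun q => expR (@?f q)) =>
      apply: (@continuous_at_exp _ _ f p)
  | |- continuous_at ?p (fun q => Num.max (@?f q) (@?g q)) =>
      apply: (@continuous_at_max _ _ f g p)
  | |- continuous_at ?p (fun q => fun_of_matrix (@?f q) ord0 ?i) =>
      apply: (@continuous_at_coord _ _ _ i f p)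
  end).

Section derivation_rules.
Context {R : realType}.
Implicit Types (f g : R -> R) (x a b : R).

Lemma der_cst x a : is_derive x 1 (fun _ : R => a) 0.
Proof. exact: is_derive_cst. Qed.

Lemma der_add x f g a b : is_derive x 1 f a -> is_derive x 1 g b ->
  is_derive x 1 (fun r => f r + g r) (a + b).
Proof. by move=> df dg; exact: is_deriveD. Qed.

Lemma der_opp x f a : is_derive x 1 f a -> is_derive x 1 (fun r => - f r) (- a).
Proof. by move=> df; exact: is_deriveN. Qed.

Lemma der_mul x f g a b : is_derive x 1 f a -> is_derive x 1 g b ->
  is_derive x 1 (fun r => f r * g r) (f x * b + g x * a).
Proof. by move=> df dg; exact: is_deriveM. Qed.

Lemma der_eq x f a b : a = b -> is_derive x 1 f a -> is_derive x 1 f b.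
Proof. by move=> ->. Qed.

End derivation_rules.

(** * Derivatives at a point and subsolutions in the touching sense *)

Section jets.
Context {R : realType} {N : nat}.
Implicit Types (phi psi y : R -> 'rV[R]_N -> R) (t a b c : R) (x v : 'rV[R]_N)
  (h k : 'I_N -> R).

(* a is the time derivative of phi at (t, x) and h i its second derivative along the i-th
   coordinate line. *)
Definition jet phi t x a h :=
  is_derive t 1 (phi ^~ x) a /\
  forall i : 'I_N, exists g : R -> R,
    (forall r : R, is_derive r 1 (fun s => phi t (x + s *: delta_mx ord0 i)) (g r)) /\
    is_derive (0 : R) 1 g (h i).

(* phi touches y from below at (t, x): y need not be differentiable there, as is the case
   for max(u - 1, 0). *)
Definition subsolution_at C y t x :=
  exists phi a h, [/\ jet phi t x a h, forall t' x', phi t' x' <= y t' x',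
    phi t x = y t x & a <= \sum_(i < N) h i + C * y t x].

Lemma jetD phi psi t x a b h k : jet phi t x a h -> jet psi t x b k ->
  jet (fun t x => phi t x + psi t x) t x (a + b) (fun i => h i + k i).
Proof.
move=> [dp hp] [dq hq]; split=> [|i]; first exact: der_add.
have [g [g1 g2]] := hp i; have [l [l1 l2]] := hq i.
by exists (fun r => g r + l r); split=> [r|]; exact: der_add.
Qed.

Lemma jetN phi t x a h : jet phi t x a h ->
  jet (fun t x => - phi t x) t x (- a) (fun i => - h i).
Proof.
move=> [dp hp]; split=> [|i]; first exact: der_opp.
have [g [g1 g2]] := hp i.
by exists (fun r => - g r); split=> [r|]; exact: der_opp.
Qed.

Lemma jetZ c phi t x a h : jet phi t x a h ->
  jet (fun t x => c * phi t x) t x (c * a) (fun i => c * h i).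
Proof.
have dZ (f : R -> R) (r b : R) : is_derive r 1 f b -> is_derive r 1 (fun s => c * f s) (c * b).
  by move=> df; apply: der_eq (der_mul (der_cst r c) df); rewrite mulr0 addr0.
move=> [dp hp]; split=> [|i]; first exact: dZ.
have [g [g1 g2]] := hp i.
by exists (fun r => c * g r); split=> [r|]; exact: dZ.
Qed.

Lemma jet_cst c t x : jet (fun _ _ => c) t x 0 (fun=> 0).
Proof.
split=> [|i]; first exact: der_cst.
by exists (fun=> 0); split=> [r|]; exact: der_cst.
Qed.

Lemma jet_shift v phi t x a h : jet phi t (x + v) a h ->
  jet (fun t x => phi t (x + v)) t x a h.
Proof.
move=> [dp hp]; split=> [//|i].
have [g [g1 g2]] := hp i; exists g; split=> // r.
rewrite [X in is_derive _ _ X _](_ : _ = fun s => phi t (x + v + s *: delta_mx ord0 i)) //.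
by apply/funext => s; rewrite addrAC.
Qed.

End jets.

(** * Parabolic maximum principle on unbounded domains *)

Section maximum_principle.
Context {R : realType} {N : nat}.
Implicit Types (x : 'rV[R]_N) (t r : R).

(* A solution of Q_t = Delta Q + C Q that grows at infinity, to localize maxima. *)
Definition quad_barrier (C eps kap s : R) t x : R :=
  expR (C * (t - s)) * (eps + kap * (dot x x + 2 * N%:R * (t - s))).

Lemma quad_barrier_jet C eps kap s t x :
  jet (quad_barrier C eps kap s) t x
    (C * quad_barrier C eps kap s t x + expR (C * (t - s)) * (kap * 2 * N%:R))
    (fun=> expR (C * (t - s)) * (kap * 2)).
Proof.
split=> [|i].
  rewrite /quad_barrier; apply: der_eq; rewrite /GRing.scale /=; ring.
exists (fun r => expR (C * (t - s)) * (kap * (2 * x ord0 i + 2 * r))); split=> [r|].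
  rewrite [X in is_derive _ _ X _](_ : _ = fun r => expR (C * (t - s)) *
    (eps + kap * (dot x x + 2 * r * x ord0 i + r ^+ 2 + 2 * N%:R * (t - s)))).
    apply: der_eq; rewrite /GRing.scale /=; ring.
  by apply/funext => r'; rewrite /quad_barrier dot_line.
apply: der_eq; rewrite /GRing.scale /=; ring.
Qed.

Lemma continuous_quad_barrier C eps kap s (p : R * 'rV[R]_N) :
  {for p, continuous (fun q : R * 'rV[R]_N => quad_barrier C eps kap s q.1 q.2)}.
Proof.
rewrite /quad_barrier; cont.
Qed.

(* The space-time domain is {d >= 0}, with lateral boundary {d = 0}. *)
Lemma maximum_principle (C B kap eps s T : R) (y d : R -> 'rV[R]_N -> R) :
  0 <= C -> 0 < kap -> 0 <= eps ->
  (forall p : R * 'rV[R]_N, s <= p.1 <= T ->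
     {for p, continuous (fun q : R * 'rV[R]_N => y q.1 q.2)}) ->
  continuous (fun q : R * 'rV[R]_N => d q.1 q.2) ->
  (forall t x, s <= t <= T -> 0 <= d t x -> y t x <= B) ->
  (forall x, 0 <= d s x -> y s x <= eps + kap * dot x x) ->
  (forall t x, s <= t <= T -> d t x = 0 -> y t x <= 0) ->
  (forall t x, s < t <= T -> 0 < d t x -> 0 < y t x -> subsolution_at C y t x) ->
  forall t x, s <= t <= T -> 0 <= d t x -> y t x <= quad_barrier C eps kap s t x.
Proof.
move=> C0 kap0 eps0 cy cd yB ys yd ysub t1 x1 st1 d1; rewrite leNgt; apply/negP => yQ.
set Q := quad_barrier C eps kap s in yQ.
have Q0 t x : s <= t -> 0 <= Q t x.
  move=> st; rewrite mulr_ge0 ?expR_ge0// addr_ge0// mulr_ge0 ?(ltW kap0)//.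
  by rewrite addr_ge0 ?dot_ge0// mulr_ge0// subr_ge0.
(* The second term puts (t1, x1) into [K]; the first makes the barrier exceed [B], hence [y],
   outside [K]. *)
pose M := Num.max B 0 + kap * dot x1 x1.
pose K := [set p : R * 'rV[R]_N | s <= p.1 <= T /\ 0 <= d p.1 p.2 /\
  kap * dot p.2 p.2 <= M].
(* The rate C + 1 instead of C makes the inequality at the maximum strict, so that the weak
   differential inequality for [y] suffices. *)
pose G (p : R * 'rV[R]_N) := expR (- (C + 1) * p.1) * (y p.1 p.2 - Q p.1 p.2).
have B0 : 0 <= Num.max B 0 by rewrite le_max lexx orbT.
have M0 : 0 <= M by rewrite addr_ge0// mulr_ge0 ?dot_ge0 ?ltW.
have K1 : K (t1, x1) by split=> //; split=> //=; rewrite lerDr.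
have cK : compact K.
  have cs : compact (`[s, T]%classic `*` [set x : 'rV[R]_N | kap * dot x x <= M]).
    apply: compact_setX; first exact: segment_compact.
    apply: bounded_closed_compact.
      exists (Num.sqrt (M / kap)); split; first exact: num_real.
      move=> r Hr x /= xM; apply: le_trans (ltW Hr); apply: le_trans (ler_norm_enorm _) _.
      by rewrite ler_wsqrtr// ler_pdivlMr// mulrC.
    apply: (@closed_comp _ _ (fun x : 'rV[R]_N => kap * dot x x) [set r | r <= M]).
      have ck : continuous (fun x : 'rV[R]_N => kap * dot x x).
        by move=> x; cont.
      by move=> x _; exact: ck.
    exact: closed_le.
  have -> : K = (`[s, T]%classic `*` [set x : 'rV[R]_N | kap * dot x x <= M]) `&`
      [set p | 0 <= d p.1 p.2].
    apply/seteqP; split=> [p [p1 [p2 p3]]|p [[/= p1 p3] p2]].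
      by split=> //; split=> //=; rewrite in_itv.
    by move: p1; rewrite in_itv.
  apply: compact_closedI => //.
  apply: (@closed_comp _ _ (fun q : R * 'rV[R]_N => d q.1 q.2) [set r | 0 <= r]).
    by move=> x _; exact: cd.
  exact: closed_ge.
have cG : {within K, continuous G}.
  apply: continuous_in_subspaceT => p; rewrite inE => -[p1 _].
  apply: continuous_at_mul; first by cont.
  apply: continuous_at_add; first exact: cy.
  by apply: continuous_at_opp; exact: continuous_quad_barrier.
have [[t0 x0] + Gmax] := compact_EVT_max (ex_intro _ _ K1) cK cG.
rewrite inE => -[/= st0 [d0 k0]].
have G0 : 0 < G (t0, x0).
  apply: lt_le_trans (Gmax (t1, x1) _); last by rewrite inE.
  by rewrite mulr_gt0 ?expR_gt0// subr_gt0.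
have {}Gmax t x : s <= t <= T -> 0 <= d t x -> G (t, x) <= G (t0, x0).
  move=> stT dtx; have [kM|kM] := lerP (kap * dot x x) M.
    by apply: Gmax; rewrite inE.
  apply: le_trans (ltW G0); rewrite pmulr_rle0 ?expR_gt0// subr_le0 /=.
  apply: (le_trans (yB _ _ stT dtx)); apply: (@le_trans _ _ (kap * dot x x)).
    apply: le_trans (ltW kM); apply: ler_wpDr; last by rewrite le_max lexx.
    by rewrite mulr_ge0 ?dot_ge0 ?ltW.
  have ts : 0 <= t - s by rewrite subr_ge0; case/andP: stT.
  rewrite -[leLHS]mul1r; apply: ler_pM => //.
  - by rewrite mulr_ge0 ?dot_ge0 ?ltW.
  - by rewrite -expR0 ler_expR mulr_ge0.
  - rewrite mulrDr addrCA lerDl addr_ge0//.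
    by apply: mulr_ge0; [exact: ltW|apply: mulr_ge0 => //; apply: mulr_ge0].
have y0 : Q t0 x0 < y t0 x0 by move: G0; rewrite pmulr_rgt0 ?expR_gt0// subr_gt0.
have yp : 0 < y t0 x0 by apply: le_lt_trans y0; apply: Q0; case/andP: st0.
have d0p : 0 < d t0 x0.
  rewrite lt_neqAle d0 andbT; apply/eqP => /esym dE.
  by have := yd _ _ st0 dE; rewrite leNgt yp.
have st0' : s < t0 <= T.
  case/andP: (st0) => st -> ; rewrite andbT lt_neqAle st andbT; apply/eqP => sE.
  have := ys x0; rewrite sE => /(_ d0); rewrite leNgt => /negP; apply.
  apply: le_lt_trans y0; rewrite /Q /quad_barrier sE subrr !mulr0 expR0 mul1r addr0.
  exact: lexx.
have [phi [a [h [jphi phiy phi0 aE]]]] := ysub _ _ st0' d0p yp.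
have [dt dh] := jetD jphi (jetN (quad_barrier_jet C eps kap s t0 x0)).
(* The maximum point has d > 0, so along any continuous path through it the nearby points are still
   in the domain and compete in [Gmax]. *)
have dnear (g : R -> R * 'rV[R]_N) : continuous_at 0 g -> g 0 = (t0, x0) ->
    \forall r \near (0:R), 0 < d (g r).1 (g r).2.
  move=> cg g0.
  have : continuous_at 0 (fun r : R => d (g r).1 (g r).2).
    apply: (@continuous_comp _ _ _ g (fun q : R * 'rV[R]_N => d q.1 q.2)) => //.
    exact: cd.
  by move=> /cvgr_gt; apply; rewrite g0.
have hle (i : 'I_N) : h i <= expR (C * (t0 - s)) * (kap * 2).
  rewrite -subr_le0; have [g [g1 g2]] := dh i.
  apply: (is_derive_local_max2 g1 g2).
  have : \forall r \near (0:R), 0 < d t0 (x0 + r *: delta_mx ord0 i).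
    apply: (dnear (fun r => (t0, x0 + r *: delta_mx ord0 i))); last first.
      by rewrite scale0r addr0.
    by cont.
  apply: filterS => r dr; rewrite scale0r addr0.
  have := Gmax t0 (x0 + r *: delta_mx ord0 i) st0 (ltW dr).
  rewrite /G /= ler_pM2l ?expR_gt0// phi0; apply: le_trans.
  by rewrite lerD2r.
have dte : is_derive t0 1 (fun t => expR (- (C + 1) * t) * (phi t x0 - Q t x0))
    (expR (- (C + 1) * t0) * (a - (C * Q t0 x0 + expR (C * (t0 - s)) * (kap * 2 * N%:R))
       - (C + 1) * (phi t0 x0 - Q t0 x0))).
  by apply: der_eq; rewrite /GRing.scale /= /Q; ring.
have : 0 <= a - (C * Q t0 x0 + expR (C * (t0 - s)) * (kap * 2 * N%:R))
       - (C + 1) * (phi t0 x0 - Q t0 x0).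
  rewrite -(pmulr_rge0 _ (expR_gt0 (- (C + 1) * t0))).
  apply: (is_derive_left_max dte).
  have : \forall r \near (0:R), 0 < d (t0 - r) x0.
    apply: (dnear (fun r => (t0 - r, x0))); last by rewrite subr0.
    by cont.
  move=> dn; near=> r.
  apply: (@le_trans _ _ (G (t0 - r, x0))).
    by rewrite /G /= ler_wpM2l ?expR_ge0// lerD2r.
  rewrite phi0; apply: Gmax; last by apply: ltW; near: r; apply: cvg_within; exact: dn.
  have r0 : 0 < r by near: r; exact: nbhs_right_gt.
  have rts : r < t0 - s.
    by near: r; apply: nbhs_right_lt; rewrite subr_gt0; case/andP: st0'.
  have /andP[_ tT] := st0'; apply/andP; split; lra.
(* By [aE] and the bounds on the [h i], a - Q_t is at most C (y - Q), so the expression is at most -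
   (y - Q) < 0. *)
rewrite phi0 leNgt => /negP; apply.
have hsum : \sum_(i < N) h i <= expR (C * (t0 - s)) * (kap * 2 * N%:R).
  rewrite [leRHS](_ : _ = \sum_(i < N) (expR (C * (t0 - s)) * (kap * 2))).
    exact: ler_sum.
  by rewrite sumr_const card_ord -mulr_natr; ring.
by nra.
Unshelve. all: by end_near. Qed.

End maximum_principle.

(** * Lower Riemann sums for the Lebesgue integral *)

Section lower_sums.
Context {R : realType}.
Local Open Scope ereal_scope.

(* No measurability assumption on g. *)
Lemma le_integralT (f g : R -> \bar R) : (forall s, 0 <= f s) ->
  (forall s, f s <= g s) ->
  \int[@lebesgue_measure R]_s f s <= \int[@lebesgue_measure R]_s g s.
Proof.
move=> f0 fg; rewrite !ge0_integralTE//; last by move=> s; exact: le_trans (fg s).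
apply: le_ereal_sup => _ [h hf <-]; exists h => // s; exact: le_trans (fg s).
Qed.

(** The step function equal to [b j] on the j-th half-open interval lies below [F]; half-openness
    makes the intervals disjoint, so at each point at most one term is nonzero. *)
Lemma integral_ge_steps (c eta : R) (n : nat) (b : nat -> R) (F : R -> \bar R) :
  (0 < eta)%R -> (forall j, 0 <= b j)%R -> (forall s, 0 <= F s) ->
  (forall (j : nat) s, (j < n)%N ->
    (c + eta * j%:R <= s < c + eta * j%:R + eta)%R -> (b j)%:E <= F s) ->
  (eta * \sum_(0 <= j < n) b j)%:E <= \int[@lebesgue_measure R]_s F s.
Proof.
move=> eta0 b0 F0 bF.
pose I (j : nat) : set R := `[(c + eta * j%:R)%R, (c + eta * j%:R + eta)%R[%classic.
pose h (s : R) := \sum_(j < n) ((b j)%:E * (\1_(I j) s)%:E).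
have -> : (eta * \sum_(0 <= j < n) b j)%:E = \int[@lebesgue_measure R]_s h s.
  rewrite ge0_integral_sum//; first last.
  - by move=> j s _; rewrite mule_ge0 ?lee_fin.
  - move=> j; apply: emeasurable_funM => //.
    by apply/measurable_EFinP; apply: measurable_indic; exact: measurable_itv.
  rewrite big_mkord mulr_sumr -sumEFin; apply: eq_bigr => j _.
  rewrite ge0_integralZl_EFin//; last first.
    by apply/measurable_EFinP; apply: measurable_indic; exact: measurable_itv.
  rewrite integral_indic//; last exact: measurable_itv.
  rewrite setIT /I [X in _ * X]lebesgue_measure_itv /= lte_fin ltrDl eta0 -EFinB -EFinM.
  by congr EFin; ring.
apply: le_integralT => s.
  by apply: sume_ge0 => j _; rewrite mule_ge0 ?lee_fin.
rewrite /h; have [[j sj]|nos] := pselect (exists j : 'I_n, I j s).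
  rewrite (bigD1 j)//= big1; first last.
    move=> k kj; rewrite indicE memNset ?mule0// => sk.
    move/eqP: kj; apply; apply/val_inj => /=.
    move: sj sk; rewrite /I /= !in_itv /= => /andP[j1 j2] /andP[k1 k2].
    have aux (a d : nat) : (c + eta * a%:R < c + eta * d%:R + eta)%R -> (a <= d)%N.
      rewrite -addrA ltrD2l -[X in (_ < _ + X)%R]mulr1 -mulrDr ltr_pM2l// natr1 ltr_nat.
      by rewrite ltnS.
    by apply/eqP; rewrite eqn_leq (aux _ _ (le_lt_trans k1 j2)) (aux _ _ (le_lt_trans j1 k2)).
  by rewrite addr0 indicE mem_set// mule1; exact: (bF j).
rewrite big1 ?F0// => j _; rewrite indicE memNset ?mule0// => sj.
by apply: nos; exists j.
Qed.

End lower_sums.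

(** * Grids in boxes and lower bounds for iterated integrals *)

Section grids.
Context {R : realType}.

(** These are the lower corners of the n^m cells of side delta / n that tile the box [0,
    delta)^m. *)
Fixpoint grid (delta : R) (n m : nat) : seq 'rV[R]_m :=
  match m with
  | 0%N => [:: 0]
  | k.+1 => [seq (row_mx (const_mx (delta * j%:R / n%:R) : 'rV[R]_1) y : 'rV[R]_k.+1)
             | j <- index_iota 0 n, y <- grid delta n k]
  end.

(* Average over grid points of the box x + [0, delta)^m. *)
Definition grid_avg (delta : R) (n m : nat) (g : 'rV[R]_m -> R) (x : 'rV[R]_m) : R :=
  (n%:R ^+ m)^-1 * \sum_(p <- grid delta n m) g (x + p).

Lemma size_grid delta n m : size (grid delta n m) = (n ^ m)%N.
Proof.
elim: m => [|m IH] //=.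
by rewrite size_allpairs IH size_iota subn0 expnS.
Qed.

Lemma row_const_mxE m (a : R) (y : 'rV[R]_m) (i : 'I_m.+1) :
  (row_mx (const_mx a : 'rV[R]_1) y : 'rV[R]_m.+1) ord0 i =
  if unlift ord0 i is Some j then y ord0 j else a.
Proof.
case: unliftP => [j ->|->].
  have -> : lift ord0 j = rshift 1 (j : 'I_m) :> 'I_(1 + m) by exact: val_inj.
  exact: row_mxEr.
have -> : (ord0 : 'I_m.+1) = lshift m (ord0 : 'I_1) :> 'I_(1 + m) by exact: val_inj.
by apply: etrans (row_mxEl (const_mx a : 'rV[R]_1) y ord0 ord0) _; rewrite mxE.
Qed.

Lemma mem_grid delta n m p (i : 'I_m) : 0 < delta -> (0 < n)%N ->
  p \in grid delta n m -> 0 <= p ord0 i < delta.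
Proof.
move=> delta0 n0; elim: m => [|m IH] in p i *; first by case: i.
case/allpairsP => -[j y] /= [+ yg ->]; rewrite mem_index_iota => /andP[_ jn].
rewrite row_const_mxE; case: unliftP => [k _|_]; first exact: IH.
apply/andP; split.
  by apply: divr_ge0 => //; apply: mulr_ge0 => //; exact: ltW.
by rewrite ltr_pdivrMr ?ltr0n// ltr_pM2l// ltr_nat.
Qed.

Lemma nintegral_ge0 (m : nat) (g : 'rV[R]_m -> \bar R) :
  (forall q, 0 <= g q)%E -> (0 <= nintegral g)%E.
Proof.
elim: m g => [|m IH] g g0; first exact: g0.
by apply: integral_ge0 => s _; exact: IH.
Qed.

(** A lower Riemann sum: [a p] bounds [g] from below on the cell with lower corner x + p. The
    induction splits off the first coordinate, as both [nintegral] and [grid] do. *)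
Lemma nintegral_ge_grid (delta : R) (n m : nat) (x : 'rV[R]_m) (a : 'rV[R]_m -> R)
    (g : 'rV[R]_m -> \bar R) : 0 < delta -> (0 < n)%N ->
  (forall q, 0 <= g q)%E -> (forall p, 0 <= a p) ->
  (forall p (q : 'rV[R]_m), p \in grid delta n m ->
     (forall i, x ord0 i + p ord0 i <= q ord0 i < x ord0 i + p ord0 i + delta / n%:R) ->
     ((a p)%:E <= g q)%E) ->
  (((delta / n%:R) ^+ m * \sum_(p <- grid delta n m) a p)%:E <= nintegral g)%E.
Proof.
move=> delta0 n0; elim: m => [|m IH] in x a g *; move=> g0 a0 ag.
  rewrite /= big_seq1 expr0 mul1r; apply: ag; first by rewrite inE.
  by case.
have eta0 : 0 < delta / n%:R by rewrite divr_gt0// ltr0n.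
pose b (j : nat) := (delta / n%:R) ^+ m *
  \sum_(y <- grid delta n m) a (row_mx (const_mx (delta * j%:R / n%:R) : 'rV[R]_1) y).
have -> : (delta / n%:R) ^+ m.+1 * \sum_(p <- grid delta n m.+1) a p =
    delta / n%:R * \sum_(0 <= j < n) b j.
  by rewrite /= big_allpairs_dep -mulr_sumr exprS mulrA.
apply: (@integral_ge_steps _ (x ord0 ord0)) => //.
- by move=> j; rewrite mulr_ge0 ?exprn_ge0 ?(ltW eta0)// sumr_ge0.
- by move=> s; exact: nintegral_ge0.
move=> j s jn js; apply: (IH (\row_i x ord0 (lift ord0 i))) => // p q pg Hq.
apply: ag.
  by apply/allpairsP; exists (j, p); split=> //=; rewrite mem_index_iota.
move=> i; rewrite !row_const_mxE; case: unliftP => [k ->|->].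
  by have := Hq k; rewrite mxE.
by move: js; rewrite mulrAC mulrC.
Qed.

End grids.

(** * Grid averages at small times *)

Section initial_averages.
Context {R : realType} {N : nat}.
Implicit Types (x y p q : 'rV[R]_N) (delta eps : R).

Lemma ler_norm_coord x (c : R) : 0 <= c -> (forall i, `|x ord0 i| <= c) -> `|x| <= c.
Proof.
move=> c0 xc; rewrite /Num.norm/= mx_normrE; apply: bigmax_le => //.
by move=> [i j] _ /=; rewrite (ord1 i).
Qed.

Lemma compact_norm_ball (c : R) : compact [set x : 'rV[R]_N | `|x| <= c].
Proof.
apply: bounded_closed_compact.
  exists c; split; first exact: num_real.
  by move=> r cr x /= xc; exact: le_trans (ltW cr).
apply: (@closed_comp _ _ (fun x : 'rV[R]_N => `|x|) [set r | r <= c]).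
  by move=> x _; exact: norm_continuous.
exact: closed_le.
Qed.

(** Heine-Cantor: the modulus is the minimum of |x - y| over the compact set of pairs on which [f]
    varies by at least [eps]; it is positive because x <> y there. *)
Lemma continuous_modulus (K : set 'rV[R]_N) (f : 'rV[R]_N -> R) eps :
  compact K -> continuous f -> 0 < eps ->
  exists2 w : R, 0 < w &
    forall x y, K x -> K y -> `|x - y| < w -> `|f x - f y| < eps.
Proof.
move=> cK cf eps0.
pose A := (K `*` K) `&` [set p : 'rV[R]_N * 'rV[R]_N | eps <= `|f p.1 - f p.2|].
have [[p0 Ap0]|A0] := pselect (exists z, A z); last first.
  exists 1 => // x y Kx Ky _; rewrite ltNge; apply/negP => fxy.
  by apply: A0; exists (x, y).
have cA : compact A.
  apply: compact_closedI; first exact: compact_setX.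
  apply: (@closed_comp _ _ (fun p : 'rV[R]_N * 'rV[R]_N => `|f p.1 - f p.2|)
    [set r | eps <= r]); last exact: closed_ge.
  move=> z _.
  apply: (@continuous_comp _ _ _ (fun p : 'rV[R]_N * 'rV[R]_N => f p.1 - f p.2));
    last exact: norm_continuous.
  apply: continuous_at_add; first by apply: continuous_comp; [exact: cvg_fst|exact: cf].
  apply: continuous_at_opp; by apply: continuous_comp; [exact: cvg_snd|exact: cf].
have cn : {within A, continuous (fun p : 'rV[R]_N * 'rV[R]_N => `|p.1 - p.2|)}.
  apply: continuous_subspaceT => p.
  apply: (@continuous_comp _ _ _ (fun p : 'rV[R]_N * 'rV[R]_N => p.1 - p.2));
    last exact: norm_continuous.
  by cont.
have [m + mmin] := compact_EVT_min (ex_intro _ _ Ap0) cA cn.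
rewrite inE => -[_ /= mA].
exists `|m.1 - m.2| => [|x y Kx Ky xy].
  rewrite normr_gt0 subr_eq0; apply/eqP => E.
  by move: mA; rewrite E subrr normr0 leNgt eps0.
rewrite ltNge; apply/negP => fxy.
have := mmin (x, y); rewrite inE => /(_ _) /=.
by move=> /(_ (conj (conj Kx Ky) fxy)); rewrite leNgt xy.
Qed.

Lemma near_right_ex (P : R -> Prop) : (\forall t \near (0:R)^'+, P t) ->
  exists2 tau : R, 0 < tau & forall t, 0 < t < tau -> P t.
Proof.
rewrite near_withinE => /nbhs_ballP[e /= e0 He]; exists e => // t /andP[t0 te].
by apply: He => //; rewrite /ball /= sub0r normrN gtr0_norm.
Qed.

(** Since the datum is discontinuous, u - uinit cannot be sampled on a grid; a continuous [Z] below
    its absolute value can. The L^1 norm gives [tau]; [n0] depends on [s] through the modulus of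
    continuity of [Z s], but not on [x]. *)
Lemma grid_avg_initial (u : R -> 'rV[R]_N -> R) uinit (Z : R -> 'rV[R]_N -> R)
    (Rad : R) delta eps :
  L1loc_initial u uinit -> 0 < delta -> 0 < eps ->
  (forall t y, 0 < t -> 0 <= Z t y <= `|u t y - uinit y|) ->
  (forall t, 0 < t -> continuous (Z t)) ->
  exists2 tau : R, 0 < tau & forall s, 0 < s < tau -> exists n0 : nat,
    forall n, (n0 <= n)%N -> (0 < n)%N -> forall x, `|x| <= Rad ->
      grid_avg delta n (Z s) x <= eps.
Proof.
move=> L1 delta0 eps0 Zu cZ.
(* One [delta] for the grid point and one for the position inside its cell. *)
pose K := [set x : 'rV[R]_N | `|x| <= `|Rad| + 2 * delta].
have cK : compact K by exact: compact_norm_ball.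
have e2 : 0 < eps / 2 by rewrite divr_gt0.
have c0 : 0 < eps / 2 * delta ^+ N by rewrite mulr_gt0// exprn_gt0.
have : \forall t \near (0:R)^'+,
    (nintegral (fun x => (\1_K x * `|u t x - uinit x|)%:E) < (eps / 2 * delta ^+ N)%:E)%E.
  apply: (L1 K cK [set y | (y < (eps / 2 * delta ^+ N)%:E)%E]).
  by apply: open_nbhs_nbhs; split; [exact: open_ereal_lt_ereal|rewrite /= lte_fin].
move=> /near_right_ex[tau tau0 Htau]; exists tau => // s /[dup] /Htau {Htau} Hs /andP[s0 _].
have [w w0 Hw] := continuous_modulus cK (cZ s s0) e2.
have [n0 Hn0] : exists n0 : nat, delta / w < n0%:R.
  by exists (Num.truncn (delta / w)).+1; exact: truncnS_gt.
exists n0 => n n0n npos x xR.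
have nR : 0 < n%:R :> R by rewrite ltr0n.
have dnw : delta / n%:R < w.
  rewrite ltr_pdivrMr// mulrC -ltr_pdivrMr//.
  by apply: lt_le_trans Hn0 _; rewrite ler_nat.
have dn : delta / n%:R <= delta.
  by rewrite ler_pdivrMr// ler_peMr ?(ltW delta0)// ler1n.
(* By the choice of [n], [Z s] varies by less than eps / 2 on a cell, so this is a lower bound for
   it there. *)
pose a p := Num.max 0 (Z s (x + p) - eps / 2).
have := @nintegral_ge_grid _ delta n N x a
  (fun x => (\1_K x * `|u s x - uinit x|)%:E) delta0 npos.
have a0 p : 0 <= a p by rewrite /a le_max lexx.
have xR' : `|x| <= `|Rad| by apply: le_trans xR _; exact: ler_norm.
move=> /(_ _ a0) H.
have {}H : (((delta / n%:R) ^+ N * \sum_(p <- grid delta n N) a p)%:E <=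
    nintegral (fun x => (\1_K x * `|u s x - uinit x|)%:E))%E.
  apply: H => [q|p q pg Hq]; first by rewrite lee_fin mulr_ge0.
  have Kxp : K (x + p).
    rewrite /K /=; apply: le_trans (ler_normD _ _) _; rewrite lerD//.
    apply: ler_norm_coord => [|i]; first by rewrite mulr_ge0 ?ltW.
    have /andP[p0 pd] := mem_grid i delta0 npos pg.
    by rewrite ger0_norm//; lra.
  have qx : `|q - (x + p)| <= delta / n%:R.
    apply: ler_norm_coord => [|i]; first by rewrite divr_ge0 ?ltW.
    by have /andP[h1 h2] := Hq i; rewrite !mxE ger0_norm; lra.
  have Kq : K q.
    rewrite /K /= -[q](subrK (x + p)); apply: le_trans (ler_normD _ _) _.
    apply: (@le_trans _ _ (delta + (`|Rad| + delta))); last by lra.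
    rewrite lerD ?(le_trans qx)//.
    apply: le_trans (ler_normD _ _) _; rewrite lerD//.
    apply: ler_norm_coord => [|i]; first exact: ltW.
    have /andP[p0 pd] := mem_grid i delta0 npos pg.
    by rewrite ger0_norm//; lra.
  rewrite lee_fin indicE mem_set// mul1r /a ge_max normr_ge0/=.
  have := Hw _ _ Kxp Kq; rewrite distrC => /(_ (le_lt_trans qx dnw)).
  have /andP[_ Zq] := Zu s q s0.
  by rewrite ltr_norml => /andP[_ h]; lra.
have {Hs}H := le_lt_trans H Hs.
rewrite lte_fin expr_div_n in H.
have {}H : (n%:R ^+ N)^-1 * \sum_(p <- grid delta n N) a p < eps / 2.
  rewrite -(ltr_pM2l (exprn_gt0 N delta0)); move: H; set S := \sum_(_ <- _) _.
  by rewrite mulrA [X in _ < X -> _]mulrC.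
rewrite /grid_avg.
apply: (@le_trans _ _ ((n%:R ^+ N)^-1 * \sum_(p <- grid delta n N) (a p + eps / 2))).
  rewrite ler_wpM2l ?invr_ge0 ?exprn_ge0//; apply: ler_sum => p _.
  by rewrite /a -lerBlDr le_max lexx orbT.
rewrite big_split /= mulrDr [X in _ + X](_ : _ = eps / 2); first by lra.
rewrite big_const_seq count_predT size_grid iter_addr_0 -[eps / 2 *+ _]mulr_natr natrX.
by field; rewrite expf_neq0// gt_eqF.
Qed.

End initial_averages.

(** * Comparison of averages with a supersolution *)

Section averaged_comparison.
Context {R : realType} {N : nat}.
Implicit Types (x y p v : 'rV[R]_N) (t C : R) (w z V : R -> 'rV[R]_N -> R)
  (f g : 'rV[R]_N -> R).

Lemma subsolution_atD C w z t x : subsolution_at C w t x ->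
  subsolution_at C z t x -> subsolution_at C (fun t x => w t x + z t x) t x.
Proof.
move=> [p1 [a1 [h1 [j1 l1 e1 i1]]]] [p2 [a2 [h2 [j2 l2 e2 i2]]]].
exists (fun t x => p1 t x + p2 t x), (a1 + a2), (fun i => h1 i + h2 i).
split; [exact: jetD| by move=> *; exact: lerD|by rewrite e1 e2|].
by rewrite big_split /= mulrDr addrACA lerD.
Qed.

Lemma subsolution_atZ C c w t x : 0 <= c -> subsolution_at C w t x ->
  subsolution_at C (fun t x => c * w t x) t x.
Proof.
move=> c0 [p1 [a1 [h1 [j1 l1 e1 i1]]]].
exists (fun t x => c * p1 t x), (c * a1), (fun i => c * h1 i).
split; [exact: jetZ| by move=> *; exact: ler_wpM2l|by rewrite e1|].
by rewrite -mulr_sumr mulrCA -mulrDr ler_wpM2l.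
Qed.

Lemma subsolution_at0 C t x : subsolution_at C (fun _ _ => 0) t x.
Proof.
exists (fun _ _ => 0), 0, (fun=> 0); split=> //; first exact: jet_cst.
by rewrite big1// mulr0 addr0.
Qed.

Lemma subsolution_at_shift C v w t x : subsolution_at C w t (x + v) ->
  subsolution_at C (fun t x => w t (x + v)) t x.
Proof.
move=> [p1 [a1 [h1 [j1 l1 e1 i1]]]].
exists (fun t x => p1 t (x + v)), a1, h1; split=> //; exact: jet_shift.
Qed.

Lemma subsolution_at_opp C V t x a (h : 'I_N -> R) : jet V t x a h ->
  \sum_(i < N) h i + C * V t x <= a -> subsolution_at C (fun t x => - V t x) t x.
Proof.
move=> jV Va; exists (fun t x => - V t x), (- a), (fun i => - h i).
split=> //; first exact: jetN.
by rewrite sumrN mulrN -opprD lerN2.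
Qed.

Lemma grid_avgD delta n f g x :
  grid_avg delta n (fun y => f y + g y) x = grid_avg delta n f x + grid_avg delta n g x.
Proof. by rewrite /grid_avg big_split /= mulrDr. Qed.

Lemma ler_grid_avg delta n f g x :
  (forall p, p \in grid delta n N -> f (x + p) <= g (x + p)) ->
  grid_avg delta n f x <= grid_avg delta n g x.
Proof.
move=> fg; rewrite ler_wpM2l ?invr_ge0 ?exprn_ge0//.
by rewrite big_seq [leRHS]big_seq; apply: ler_sum.
Qed.

Lemma grid_avg_cst delta n (c : R) x : (0 < n)%N -> grid_avg delta n (fun=> c) x = c.
Proof.
move=> n0; rewrite /grid_avg big_const_seq count_predT size_grid iter_addr_0.
rewrite -[c *+ _]mulr_natr natrX; field.
by rewrite expf_neq0// pnatr_eq0 -lt0n.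
Qed.

(** The linear equation has constant coefficients, so translates, sums and nonnegative multiples of
    subsolutions are again subsolutions. *)
Lemma subsolution_at_grid_avg C delta n w t x :
  (forall x, subsolution_at C w t x) ->
  subsolution_at C (fun t x => grid_avg delta n (w t) x) t x.
Proof.
move=> ws; apply: subsolution_atZ; first by rewrite invr_ge0 exprn_ge0.
elim: (grid delta n N) => [|p s IH].
  by under eq_fun do under eq_fun do rewrite big_nil; exact: subsolution_at0.
under eq_fun do under eq_fun do rewrite big_cons.
by apply: subsolution_atD => //; exact: subsolution_at_shift.
Qed.

Lemma continuous_at_grid_avg delta n w (q : R * 'rV[R]_N) :
  (forall x, {for (q.1, x), continuous (fun q : R * 'rV[R]_N => w q.1 q.2)}) ->
  {for q, continuous (fun q : R * 'rV[R]_N => grid_avg delta n (w q.1) q.2)}.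
Proof.
move=> cy; apply: continuous_at_mul; first by cont.
elim: (grid delta n N) => [|p s IH].
  have -> : (fun q0 : R * 'rV[R]_N => \sum_(p <- [::]) w q0.1 (q0.2 + p)) = fun=> 0.
    by apply/funext => r; rewrite big_nil.
  by cont.
have -> : (fun q0 : R * 'rV[R]_N => \sum_(p0 <- p :: s) w q0.1 (q0.2 + p0)) =
    (fun q0 => w q0.1 (q0.2 + p) + \sum_(p0 <- s) w q0.1 (q0.2 + p0)).
  by apply/funext => r; rewrite big_cons.
apply: continuous_at_add => //.
apply: (@continuous_comp _ _ _ (fun q : R * 'rV[R]_N => (q.1, q.2 + p))
  (fun q : R * 'rV[R]_N => w q.1 q.2)); first by cont.
exact: cy.
Qed.

(** The function [g] is a continuous substitute for the initial value of [z]. At a small time [s]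
    the average of [z] exceeds that of [g], hence [V], by at most a small constant on a large ball;
    beyond it the quadratic barrier takes over. As [s] depends on [eps], only some [n] is
    obtained. *)
Lemma grid_avg_comparison (u : R -> 'rV[R]_N -> R) uinit z g V (d : R -> 'rV[R]_N -> R)
    (C B B' delta s0 T : R) (n0 : nat) :
  L1loc_initial u uinit -> 0 <= C -> 0 < delta -> 0 < s0 ->
  (forall p : R * 'rV[R]_N, 0 < p.1 ->
     {for p, continuous (fun q : R * 'rV[R]_N => z q.1 q.2)}) ->
  continuous g ->
  (forall t x, 0 < t -> z t x <= B) ->
  (forall t x, 0 < t -> subsolution_at C z t x) ->
  (forall t x, 0 < t -> z t x - g x <= `|u t x - uinit x|) ->
  continuous (fun q : R * 'rV[R]_N => V q.1 q.2) ->
  continuous (fun q : R * 'rV[R]_N => d q.1 q.2) ->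
  (forall t x, 0 < t <= T -> 0 <= d t x -> - B' <= V t x) ->
  (forall t x, 0 < t -> 0 < d t x -> exists a h,
     jet V t x a h /\ \sum_(i < N) h i + C * V t x <= a) ->
  (forall t x, 0 < t -> d t x = 0 -> B <= V t x) ->
  (forall s x n, 0 < s < s0 -> (n0 <= n)%N -> 0 <= d s x ->
     grid_avg delta n g x <= V s x) ->
  forall t x eps, 0 < t <= T -> 0 <= d t x -> 0 < eps ->
  exists n, [/\ (n0 <= n)%N, (0 < n)%N & grid_avg delta n (z t) x <= V t x + eps].
Proof.
move=> L1 C0 delta0 s00 cz cg zB zsub zu cV cd VB Vsup dV gV t x eps /andP[t0 tT] dtx eps0.
pose E := expR (C * t).
have E0 : 0 < E by exact: expR_gt0.
pose D := dot x x + 2 * N%:R * t + 1.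
have D0 : 0 < D.
  apply: ltr_wpDl => //; apply: addr_ge0; first exact: dot_ge0.
  by rewrite mulr_ge0 ?mulr_ge0// ltW.
(* [eps'] and [kap] are such that the final barrier, at most E (eps' + kap D), is exactly eps / 2 +
   eps / 2. *)
pose eps' := eps / (2 * E).
have eps'0 : 0 < eps' by rewrite divr_gt0// ?mulr_gt0// mulr_gt0.
pose kap := eps / (2 * E * D).
have kap0 : 0 < kap by rewrite divr_gt0// ?mulr_gt0// mulr_gt0.
(* Outside this ball kap |y|^2 >= B + B'; the summand 1 gives |y| <= |y|^2. *)
pose Rad := `|B + B'| / kap + 1.
pose Z s y := Num.max 0 (z s y - g y).
have [||tau tau0 Htau] := @grid_avg_initial _ _ u uinit Z Rad delta eps' L1 delta0 eps'0.
- by move=> s y sp; rewrite /Z le_max lexx /= ge_max normr_ge0 zu.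
- move=> s sp y; rewrite /Z; apply: continuous_at_max; first by cont.
  apply: continuous_at_add; last by apply: continuous_at_opp; exact: cg.
  apply: (@continuous_comp _ _ _ (fun y => (s, y)) (fun q : R * 'rV[R]_N => z q.1 q.2)).
    by cont.
  exact: cz.
pose s := Num.min (Num.min tau s0) t / 2.
have m0 : 0 < Num.min (Num.min tau s0) t by rewrite !lt_min tau0 s00.
have sp : 0 < s by rewrite divr_gt0.
have sm : s < Num.min (Num.min tau s0) t by rewrite /s; lra.
move: sm; rewrite !lt_min -andbA => /and3P[stau ss0 st].
have [n1 Hn1] : exists n1 : nat, forall n, (n1 <= n)%N -> (0 < n)%N ->
    forall x, `|x| <= Rad -> grid_avg delta n (Z s) x <= eps'.
  by apply: Htau; rewrite sp.
pose n := maxn (maxn n0 n1) 1.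
have n0n : (n0 <= n)%N by rewrite /n !leq_max leqnn.
have n1n : (n1 <= n)%N by rewrite /n !leq_max leqnn orbT.
have np : (0 < n)%N by rewrite /n !leq_max orbT.
exists n; split=> //.
rewrite -lerBlDl.
have avgB r y : 0 < r -> grid_avg delta n (z r) y <= B.
  move=> rp; rewrite -[leRHS](grid_avg_cst delta B y np).
  by apply: ler_grid_avg => p _; exact: zB.
have := @maximum_principle _ _ C (B + B') kap eps' s t
  (fun t x => grid_avg delta n (z t) x - V t x) d C0 kap0 (ltW eps'0).
move=> /(_ _ cd _ _ _ _) MP.
have {MP} : grid_avg delta n (z t) x - V t x <= quad_barrier C eps' kap s t x.
  apply: MP => //; last by rewrite (ltW st) lexx.
  - move=> p /andP[sp1 _].
    have p10 : 0 < p.1 by exact: lt_le_trans sp1.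
    apply: continuous_at_add; last by apply: continuous_at_opp; exact: cV.
    by apply: continuous_at_grid_avg => y; exact: cz.
  - move=> r y /andP[sr rt] dry.
    have rp : 0 < r by exact: lt_le_trans sr.
    have rT : 0 < r <= T by rewrite rp (le_trans rt).
    by have := avgB r y rp; have := VB r y rT dry; lra.
  - move=> y dsy; have [yR|yR] := lerP `|y| Rad.
      have h1 := Hn1 n n1n np y yR.
      have h2 := gV s y n (introT andP (conj sp ss0)) n0n dsy.
      have : grid_avg delta n (z s) y <= grid_avg delta n g y + grid_avg delta n (Z s) y.
        rewrite -grid_avgD; apply: ler_grid_avg => p _.
        by rewrite -lerBlDl /Z le_max lexx orbT.
      have : 0 <= kap * dot y y by rewrite mulr_ge0 ?dot_ge0 ?ltW.
      by lra.
    have : B + B' <= kap * dot y y.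
      have R1 : 1 <= `|y|.
        by apply: le_trans (ltW yR); rewrite /Rad lerDr divr_ge0// ltW.
      have : `|B + B'| / kap <= dot y y.
        apply: (@le_trans _ _ `|y|); first by apply: le_trans (ltW yR); rewrite lerDl.
        rewrite -sqr_enorm; apply: (@le_trans _ _ (`|y| ^+ 2)).
          by rewrite expr2 ler_peMr.
        by rewrite ler_sqr ?nnegrE ?enorm_ge0// ler_norm_enorm.
      rewrite ler_pdivrMr// mulrC; apply: le_trans; exact: ler_norm.
    have := avgB s y sp; have := VB s y (introT andP (conj sp (le_trans (ltW st) tT))) dsy.
    by lra.
  - move=> r y /andP[sr _] dry.
    have rp : 0 < r by exact: lt_le_trans sr.
    by have := avgB r y rp; have := dV r y rp dry; lra.
  - move=> r y /andP[sr _] dry _.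
    have rp : 0 < r by exact: lt_trans sr.
    apply: subsolution_atD; first by apply: subsolution_at_grid_avg => v; exact: zsub.
    by have [a [h [jV Va]]] := Vsup r y rp dry; exact: subsolution_at_opp jV Va.
move=> H; apply: le_trans H _.
rewrite /quad_barrier; apply: (@le_trans _ _ (E * (eps' + kap * D))).
  apply: ler_pM.
  - exact: expR_ge0.
  - apply: addr_ge0; first exact: ltW.
    apply: mulr_ge0; first exact: ltW.
    apply: addr_ge0; first exact: dot_ge0.
    by rewrite !mulr_ge0// subr_ge0 ltW.
  - by rewrite ler_expR ler_wpM2l//; lra.
  - rewrite lerD2l ler_pM2l// /D -addrA lerD2l.
    have : 2 * N%:R * (t - s) <= 2 * N%:R * t.
      by apply: ler_wpM2l; [exact: mulr_ge0|lra].
    by lra.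
rewrite /eps' /kap le_eqVlt; apply/orP; left; apply/eqP; field.
by rewrite !gt_eqF.
Qed.

End averaged_comparison.

(** * Comparison without error terms *)

Section comparison_corollaries.
Context {R : realType} {N : nat}.
Implicit Types (x y p v : 'rV[R]_N) (t C : R) (w z V d : R -> 'rV[R]_N -> R)
  (f g : 'rV[R]_N -> R).

Lemma maximum_principle0 (C B s T : R) w d :
  0 <= C ->
  (forall p : R * 'rV[R]_N, s <= p.1 <= T ->
     {for p, continuous (fun q : R * 'rV[R]_N => w q.1 q.2)}) ->
  continuous (fun q : R * 'rV[R]_N => d q.1 q.2) ->
  (forall t x, s <= t <= T -> 0 <= d t x -> w t x <= B) ->
  (forall x, 0 <= d s x -> w s x <= 0) ->
  (forall t x, s <= t <= T -> d t x = 0 -> w t x <= 0) ->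
  (forall t x, s < t <= T -> 0 < d t x -> 0 < w t x -> subsolution_at C w t x) ->
  forall t x, s <= t <= T -> 0 <= d t x -> w t x <= 0.
Proof.
move=> C0 cw cd wB ws wd wsub t x stT dtx; rewrite leNgt; apply/negP => w0.
have st : 0 <= t - s by rewrite subr_ge0; case/andP: stT.
pose D := dot x x + 2 * N%:R * (t - s) + 1.
have D0 : 0 < D.
  apply: ltr_wpDl => //; apply: addr_ge0; first exact: dot_ge0.
  by rewrite mulr_ge0 ?mulr_ge0.
pose E := expR (C * (t - s)); have E0 : 0 < E by exact: expR_gt0.
(* The barrier with [eps] = 0 then equals E kap (D - 1) at (t, x), which is less than w t x = E kap
   D. *)
pose kap := w t x / (E * D).
have kap0 : 0 < kap by rewrite divr_gt0// mulr_gt0.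
have : w t x <= quad_barrier C 0 kap s t x.
  apply: (@maximum_principle _ _ C B kap 0 s T w d) => // y dsy.
  rewrite add0r; apply: le_trans (ws _ dsy) _.
  by rewrite mulr_ge0 ?dot_ge0// ltW.
rewrite leNgt => /negP; apply; rewrite /quad_barrier add0r.
rewrite mulrA -/E.
have -> : w t x = E * kap * D by rewrite /kap; field; rewrite !gt_eqF.
by rewrite ltr_pM2l; [rewrite /D; lra|rewrite mulr_gt0].
Qed.

Lemma near_grid_avg f x (eps : R) : {for x, continuous f} -> 0 < eps ->
  exists2 delta0 : R, 0 < delta0 & forall delta n, 0 < delta < delta0 -> (0 < n)%N ->
    f x - eps <= grid_avg delta n f x.
Proof.
move=> cf eps0.
have : \forall y \near x, f x - eps < f y.
  by apply: (cvgr_gt _ cf); rewrite ltrBlDr ltrDl.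
move=> /nbhs_ballP[e /= e0 He]; exists e => // delta n /andP[d0 de] n0.
rewrite -[leLHS](grid_avg_cst delta _ x n0); apply: ler_grid_avg => p pg.
apply/ltW/He; rewrite -ball_normE /= opprD addNKr normrN.
apply: le_lt_trans de; apply: ler_norm_coord => [|i]; first exact: ltW.
by have /andP[p0 pd] := mem_grid i d0 n0 pg; rewrite ger0_norm// ltW.
Qed.

(** When the initial inequality holds for all small boxes, [delta] can tend to 0, and averages
    become point values by continuity of [z]. *)
Lemma initial_comparison (u : R -> 'rV[R]_N -> R) uinit z g V d
    (C B B' s0 delta0 T : R) :
  L1loc_initial u uinit -> 0 <= C -> 0 < delta0 -> 0 < s0 ->
  (forall p : R * 'rV[R]_N, 0 < p.1 ->
     {for p, continuous (fun q : R * 'rV[R]_N => z q.1 q.2)}) ->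
  continuous g ->
  (forall t x, 0 < t -> z t x <= B) ->
  (forall t x, 0 < t -> subsolution_at C z t x) ->
  (forall t x, 0 < t -> z t x - g x <= `|u t x - uinit x|) ->
  continuous (fun q : R * 'rV[R]_N => V q.1 q.2) ->
  continuous (fun q : R * 'rV[R]_N => d q.1 q.2) ->
  (forall t x, 0 < t <= T -> 0 <= d t x -> - B' <= V t x) ->
  (forall t x, 0 < t -> 0 < d t x -> exists a h,
     jet V t x a h /\ \sum_(i < N) h i + C * V t x <= a) ->
  (forall t x, 0 < t -> d t x = 0 -> B <= V t x) ->
  (forall delta s x n, 0 < delta < delta0 -> 0 < s < s0 -> (0 < n)%N ->
     0 <= d s x -> grid_avg delta n g x <= V s x) ->
  forall t x, 0 < t <= T -> 0 <= d t x -> z t x <= V t x.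
Proof.
move=> L1 C0 delta00 s00 cz cg zB zsub zu cV cd VB Vsup dV gV t x t0T dtx.
have t0 : 0 < t by case/andP: t0T.
apply/ler_addgt0Pr => eps eps0.
have e2 : 0 < eps / 2 by rewrite divr_gt0.
have czt : {for x, continuous (z t)}.
  apply: (@continuous_comp _ _ _ (fun y => (t, y)) (fun q : R * 'rV[R]_N => z q.1 q.2)).
    by cont.
  exact: cz.
have [e e0 He] := near_grid_avg czt e2.
pose delta := Num.min e delta0 / 2.
have m0 : 0 < Num.min e delta0 by rewrite lt_min e0.
have d0 : 0 < delta by rewrite divr_gt0.
have : delta < Num.min e delta0 by rewrite /delta; lra.
rewrite lt_min => /andP[de dd0].
have [|n [_ np H]] := @grid_avg_comparison _ _ u uinit z g V d C B B' delta s0 T 1%N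
  L1 C0 d0 s00 cz cg zB zsub zu cV cd VB Vsup dV _ t x (eps / 2) t0T dtx e2.
  by move=> s y n s0s n1 dsy; apply: gV => //; rewrite d0.
have := He delta n; rewrite d0 de => /(_ isT np).
by lra.
Qed.

End comparison_corollaries.

(** * Bounds 0 <= u <= 1 *)

Section logistic_equation.
Context {R : realType} {N : nat}.
Implicit Types (x p v : 'rV[R]_N) (t r : R).
Variables (u : R -> 'rV[R]_N -> R) (uinit : 'rV[R]_N -> R).
Hypothesis hu : bounded_classical_solution logistic uinit u.
Hypothesis uinit01 : forall x, 0 <= uinit x <= 1.

Lemma is_derive_line (f : 'rV[R]_N -> R) x v r :
  derivable f (x + r *: v) v ->
  is_derive r 1 (fun s => f (x + s *: v)) ('D_v f (x + r *: v)).
Proof.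
move=> df.
have E : (fun h : R => h^-1 *: (((fun s => f (x + s *: v)) \o shift r) (h *: (1 : R)) -
    f (x + r *: v))) =
    (fun h => h^-1 *: ((f \o shift (x + r *: v)) (h *: v) - f (x + r *: v))).
  apply/funext => h /=; congr (_ *: (f _ - _)).
  by rewrite scalerDl addrCA [_ *: 1]mulr1.
by split; [rewrite /derivable E|rewrite /derive E].
Qed.

Lemma solution_continuous (q : R * 'rV[R]_N) : 0 < q.1 ->
  {for q, continuous (fun q : R * 'rV[R]_N => u q.1 q.2)}.
Proof. by case: hu => _ [_ _ _ [+ _ _ _]] _ _; exact. Qed.

Lemma solution_jet t x : 0 < t ->
  exists a h, jet u t x a h /\ a = \sum_(i < N) h i + logistic (u t x).
Proof.
move=> t0; case: hu => _ [ut ux uxx _] ueq _.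
exists (dt u t x), (fun i => dx (dx u i) i t x); split; last exact: ueq.
split.
  by split; [exact: ut|rewrite /dt derive1E].
move=> i; exists (fun r => dx u i t (x + r *: delta_mx ord0 i)); split=> [r|].
  by apply: is_derive_line; exact: ux.
have := @is_derive_line (dx u i t) x (delta_mx ord0 i) 0.
by rewrite scale0r addr0; apply; exact: uxx.
Qed.

Lemma logistic_ge0 (s : R) : 0 <= logistic s.
Proof.
rewrite /logistic; case: ifP => // /andP[s0 s1].
by rewrite mulr_ge0// subr_ge0.
Qed.

Lemma logistic_le4 (s : R) : logistic s <= 4^-1.
Proof.
rewrite /logistic; case: ifP => _; last by rewrite invr_ge0.
rewrite -[leRHS]mul1r ler_pdivlMr//; have := sqr_ge0 (2 * s - 1); nra.
Qed.

Lemma logistic_eq (s : R) : 0 <= s <= 1 -> logistic s = s * (1 - s).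
Proof. by rewrite /logistic => ->. Qed.

(** The extension of the reaction by 0 is nonnegative everywhere, so -u is a subsolution of the heat
    equation before any bound on u is known. The constant 1 for [d] means that there is no lateral
    boundary. *)
Lemma solution_ge0 t x : 0 < t -> 0 <= u t x.
Proof.
move=> t0; rewrite -oppr_le0.
have [[M uM] _ _ L1] := hu.
apply: (@initial_comparison _ _ u uinit (fun t x => - u t x) (fun=> 0) (fun _ _ => 0)
  (fun _ _ => 1) 0 M 0 1 1 t L1) => //; last by rewrite t0 /=.
- by move=> p p0; apply: continuous_at_opp; exact: solution_continuous.
- by move=> y; cont.
- by move=> s y s0; rewrite lerNl; have := uM s y s0; rewrite ler_norml => /andP[].
- move=> s y s0; have [a [h [ju aE]]] := solution_jet y s0.
  by apply: (subsolution_at_opp ju); rewrite mul0r addr0 aE lerDl logistic_ge0.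
- move=> s y s0; rewrite subr0 -normrN opprB; apply: le_trans (ler_norm _).
  by rewrite lerBrDr addNr; case/andP: (uinit01 y).
- by move=> q; cont.
- by move=> q; cont.
- move=> s y s0 _; exists 0, (fun=> 0); split; first exact: jet_cst.
  by rewrite mulr0 addr0 big1.
- by move=> s y s0 /eqP; rewrite oner_eq0.
- by move=> delta s y n _ _ n0 _; rewrite grid_avg_cst.
Qed.

(** The positive part of u - 1 is a subsolution of the heat equation: the reaction vanishes where u
    > 1, and elsewhere the constant 0 touches from below. *)
Lemma solution_le1 t x : 0 < t -> u t x <= 1.
Proof.
move=> t0; rewrite -subr_le0.
have [[M uM] _ _ L1] := hu.
apply: (@le_trans _ _ (Num.max (u t x - 1) 0)); first by rewrite le_max lexx.
apply: (@initial_comparison _ _ u uinit (fun t x => Num.max (u t x - 1) 0) (fun=> 0)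
  (fun _ _ => 0) (fun _ _ => 1) 0 `|M| 0 1 1 t L1) => //; last by rewrite t0 /=.
- move=> p p0; apply: continuous_at_max; last by cont.
  by apply: continuous_at_add; [exact: solution_continuous|cont].
- by move=> y; cont.
- move=> s y s0; rewrite ge_max normr_ge0 andbT.
  have := uM s y s0; have := ler_norm (u s y); have := ler_norm M.
  by lra.
- move=> s y s0; have [a [h [ju aE]]] := solution_jet y s0.
  have [u1|u1] := ltrP 1 (u s y).
    exists (fun t x => u t x + -1), (a + 0), (fun i => h i + 0); split.
    + by apply: jetD => //; exact: jet_cst.
    + by move=> *; rewrite le_max lexx.
    + by rewrite max_l// subr_ge0 ltW.
    + rewrite mul0r !addr0 aE big_split /= sumr_const mul0rn addr0.
      by rewrite /logistic [u s y <= 1]leNgt u1 andbF addr0.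
  exists (fun _ _ => 0), 0, (fun=> 0); split.
  + exact: jet_cst.
  + by move=> *; rewrite le_max lexx orbT.
  + by rewrite max_r// subr_le0.
  + by rewrite mul0r addr0 big1.
- move=> s y s0; rewrite subr0 ge_max normr_ge0 andbT.
  by apply: le_trans (ler_norm _); rewrite lerD2l lerN2; case/andP: (uinit01 y).
- by move=> q; cont.
- by move=> q; cont.
- move=> s y s0 _; exists 0, (fun=> 0); split; first exact: jet_cst.
  by rewrite mulr0 addr0 big1.
- by move=> s y s0 /eqP; rewrite oner_eq0.
- by move=> delta s y n _ _ n0 _; rewrite grid_avg_cst.
Qed.

Lemma logistic_solution t x : 0 < t -> logistic (u t x) = u t x * (1 - u t x).
Proof. by move=> t0; rewrite logistic_eq// solution_ge0//= solution_le1. Qed.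

End logistic_equation.

(** * Lipschitz bound by reflection *)

Section lipschitz.
Context {R : realType} {N : nat}.
Implicit Types (x p v : 'rV[R]_N) (t r a : R) (w : R -> 'rV[R]_N -> R).

Definition reflection (i : 'I_N) (c : R) x : 'rV[R]_N :=
  x + (2 * (c - x ord0 i)) *: delta_mx ord0 i.

Lemma reflection_line (i j : 'I_N) c x r :
  reflection i c (x + r *: delta_mx ord0 j) =
  reflection i c x + (if j == i then - r else r) *: delta_mx ord0 j.
Proof.
rewrite /reflection !mxE eqxx /=; have [->|ji] := eqVneq i j.
  rewrite mulr1 -!addrA; congr (_ + _).
  by rewrite -!scalerDl; congr (_ *: _); ring.
by rewrite mulr0 addr0 addrAC.
Qed.

Lemma jet_reflection i c w t x a h : jet w t (reflection i c x) a h ->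
  jet (fun t x => w t (reflection i c x)) t x a h.
Proof.
move=> [dt dh]; split=> // j; have [g [g1 g2]] := dh j.
have [ji|ji] := eqVneq j i; last first.
  exists g; split=> // r; under eq_fun do rewrite reflection_line (negbTE ji).
  exact: g1.
have dN (f : R -> R) (r b : R) : is_derive (- r) 1 f b ->
    is_derive r 1 (fun s => f (- s)) (- b).
  move=> df; have := @is_derive1_comp R f -%R r b (-1) df (is_deriveNid _ _).
  by rewrite mulrN1.
subst j; exists (fun r => - g (- r)); split=> [r|].
  under eq_fun do rewrite reflection_line eqxx.
  exact: (dN (fun s => w t (reflection i c x + s *: delta_mx ord0 i))).
by rewrite -[h i]opprK; apply: der_opp; apply: dN; rewrite oppr0.
Qed.

Lemma jet_time s w t x a h : jet w t x a h ->
  jet (fun t x => (t - s) * w t x) t x (w t x + (t - s) * a) (fun i => (t - s) * h i).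
Proof.
move=> [dt dh]; split.
  have d1 : is_derive t 1 (fun t : R => t - s) 1.
    by apply: der_eq; rewrite subr0.
  by apply: der_eq (der_mul d1 dt); ring.
by have [] := jetZ (t - s) (conj dt dh).
Qed.

Lemma jet_parabola (i : 'I_N) (c : R) t x :
  jet (fun _ x => (c - x ord0 i) ^+ 2 - 2 * (c - x ord0 i)) t x 0
    (fun j => if j == i then 2 else 0).
Proof.
split; first exact: der_cst.
move=> j; have [->|ji] := eqVneq j i; last first.
  exists (fun=> 0); split=> [r|]; last exact: der_cst.
  under eq_fun do rewrite !mxE eqxx /= [i == j]eq_sym (negbTE ji) mulr0 addr0.
  exact: der_cst.
exists (fun r => 2 * (r - (c - x ord0 i)) + 2); split=> [r|].
  under eq_fun do rewrite !mxE !eqxx /= mulr1.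
  by apply: der_eq; rewrite /GRing.scale /=; ring.
by apply: der_eq; rewrite /GRing.scale /=; ring.
Qed.

Variables (u : R -> 'rV[R]_N -> R) (uinit : 'rV[R]_N -> R).
Hypothesis hu : bounded_classical_solution logistic uinit u.
Hypothesis uinit01 : forall x, 0 <= uinit x <= 1.

(* The difference of u and its reflection in the hyperplane {x_i = c} vanishes
   there, and is compared with a concave parabola in the slab c - 1 <= x_i <= c. *)
Lemma solution_lipschitz_coord t x (i : 'I_N) r : 1 < t -> 0 <= r <= 2 ->
  u t x <= u t (x + r *: delta_mx ord0 i) + r.
Proof.
move=> t1 /andP[r0 r2]; have s0 : 0 < t - 1 by rewrite subr_gt0.
(* The midpoint, so that the reflection of x is x + r e_i; r <= 2 keeps x in the slab. *)
pose c := x ord0 i + r / 2.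
(* The time factor vanishes at t - 1, where nothing is known of the difference, and equals 1 at
   t. *)
pose w (t' : R) (y : 'rV[R]_N) := (t' - (t - 1)) * (u t' y - u t' (reflection i c y)) +
  ((c - y ord0 i) ^+ 2 - 2 * (c - y ord0 i)).
pose d (t' : R) (y : 'rV[R]_N) := (c - y ord0 i) * (1 - (c - y ord0 i)).
have u01 t' y : 0 < t' -> 0 <= u t' y <= 1.
  by move=> t'0; rewrite (solution_ge0 hu uinit01)// (solution_le1 hu uinit01).
have uu t' y y' : 0 < t' -> u t' y - u t' y' <= 1.
  by move=> t'0; have /andP[? ?] := u01 t' y t'0; have /andP[? ?] := u01 t' y' t'0; lra.
have dh (y : 'rV[R]_N) : 0 <= (c - y ord0 i) * (1 - (c - y ord0 i)) ->
    0 <= c - y ord0 i <= 1 by nra.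
have : w t x <= 0.
  apply: (@maximum_principle0 _ _ 0 1 (t - 1) t w d) => //.
  - move=> p /andP[p1 _]; have p0 : 0 < p.1 by exact: lt_le_trans p1.
    apply: continuous_at_add; last by cont.
    apply: continuous_at_mul; first by cont.
    apply: continuous_at_add; first exact: (solution_continuous hu).
    apply: continuous_at_opp.
    apply: (@continuous_comp _ _ _ (fun q : R * 'rV[R]_N => (q.1, reflection i c q.2))
      (fun q : R * 'rV[R]_N => u q.1 q.2)).
      by rewrite /reflection; cont.
    exact: (solution_continuous hu).
  - by move=> q; rewrite /d; cont.
  - move=> t' y /andP[t'1 t't] /dh /andP[h0 h1]; rewrite /w.
    have := uu t' y (reflection i c y) (lt_le_trans s0 t'1).
    set D := u _ _ - _ => D1.
    have : (t' - (t - 1)) * D <= (t' - (t - 1)) * 1 by rewrite ler_wpM2l//; lra.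
    nra.
  - by move=> y /dh /andP[h0 h1]; rewrite /w subrr mul0r add0r; nra.
  - move=> t' y /andP[t'1 t't] dty; rewrite /w.
    have /eqP : (c - y ord0 i) * (1 - (c - y ord0 i)) = 0 by exact: dty.
    rewrite mulf_eq0 => /orP[] /eqP E.
      have -> : reflection i c y = y by rewrite /reflection E mulr0 scale0r addr0.
      by rewrite E; lra.
    have -> : c - y ord0 i = 1 by lra.
    have := uu t' y (reflection i c y) (lt_le_trans s0 t'1).
    set D := u _ _ - _ => D1.
    have : (t' - (t - 1)) * D <= (t' - (t - 1)) * 1 by rewrite ler_wpM2l//; lra.
    rewrite expr1n; lra.
  - move=> t' y /andP[t'1 t't] _ _.
    have t'0 : 0 < t' by exact: lt_trans t'1.
    have [a [h [ju aE]]] := solution_jet hu y t'0.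
    have [b [k [jv bE]]] := solution_jet hu (reflection i c y) t'0.
    have jw := jetD (jet_time (t - 1) (jetD ju (jetN (jet_reflection jv))))
      (jet_parabola i c t' y).
    eexists _, _, _; split; [exact: jw|by []|by []|].
    (* Differentiating the time factor contributes at most 1 and the reaction terms at most 1/4; the
       Laplacian 2 of the parabola absorbs both. *)
    rewrite mul0r !addr0 big_split /= -mulr_sumr big_split /= sumrN.
    rewrite -big_mkcond big_pred1_eq aE bE.
    have := uu t' y (reflection i c y) t'0.
    have := logistic_le4 (u t' y); have := logistic_ge0 (u t' (reflection i c y)).
    set S := \sum_(_ < _) h _; set S' := \sum_(_ < _) k _.
    set D := u t' y - _; set F := logistic _; set F' := logistic _ => F0 F1 D1.
    nra.
  - by rewrite lexx andbT; lra.
  - rewrite /d /c addrAC subrr add0r; nra.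
rewrite /w subKr mul1r.
have -> : c - x ord0 i = r / 2 by rewrite /c addrAC subrr add0r.
have -> : reflection i c x = x + r *: delta_mx ord0 i.
  by rewrite /reflection /c; congr (_ + _ *: _); field.
have := sqr_ge0 (r / 2); lra.
Qed.

(** One coordinate at a time. Nonnegative displacements are those of grid points, which is how an
    average is turned into a point value. *)
Lemma solution_lipschitz t x p (delta : R) : 1 < t -> delta <= 2 ->
  (forall i, 0 <= p ord0 i <= delta) -> u t x <= u t (x + p) + N%:R * delta.
Proof.
move=> t1 d2 pd; rewrite {1}[p]row_sum_delta.
suff : forall s : seq 'I_N, u t x <=
    u t (x + \sum_(j <- s) p ord0 j *: delta_mx ord0 j) + (size s)%:R * delta.
  move=> /(_ (index_enum 'I_N)).
  by rewrite (_ : size _ = N)// /index_enum -enumT size_enum_ord.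
move=> s; elim: s x => [|j s IH] y; first by rewrite big_nil addr0 mul0r addr0.
have /andP[p0 pj] := pd j.
have := @solution_lipschitz_coord t y j (p ord0 j) t1.
rewrite p0 (le_trans pj)// => /(_ isT) /le_trans; apply.
have := IH (y + p ord0 j *: delta_mx ord0 j).
rewrite big_cons addrA /= -natr1; nra.
Qed.

End lipschitz.

(** * Moving bumps *)

Section spreading.
Context {R : realType} {N : nat}.
Implicit Types (x p c : 'rV[R]_N) (t r : R).

(** Positive exactly in the ball of squared radius rho + sig t about the moving centre p + t c. *)
Definition bump_radius (rho sig : R) c p t x : R :=
  rho + sig * t - dot (x - p - t *: c) (x - p - t *: c).

(** The factor exp(-c.y / 2) removes the drift of the moving frame at the price |c|^2 / 4. The
    formula serves only inside the ball, where [bump_radius] is nonnegative. *)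
Definition bump (kap K rho sig : R) c p t x : R :=
  kap * expR (- K * t - dot c (x - p - t *: c) / 2) * bump_radius rho sig c p t x ^+ 2.

Lemma bump_jet kap K rho sig c p t x :
  let y := x - p - t *: c in
  let S := bump_radius rho sig c p t x in
  let E := kap * expR (- K * t - dot c y / 2) in
  jet (bump kap K rho sig c p) t x
    (E * ((dot c c / 2 - K) * S ^+ 2 + 2 * S * (sig + 2 * dot c y)))
    (fun i => E * (c ord0 i ^+ 2 / 4 * S ^+ 2 + 4 * S * (c ord0 i * y ord0 i) +
      8 * y ord0 i ^+ 2 - 4 * S)).
Proof.
move=> y S E; split.
  have -> : (bump kap K rho sig c p)^~ x =
      (fun t => kap * expR (- K * t - (dot c (x - p) - t * dot c c) / 2) *
       (rho + sig * t - (dot (x - p) (x - p) - 2 * t * dot c (x - p) +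
         t ^+ 2 * dot c c)) ^+ 2).
    apply/funext => r; rewrite /bump /bump_radius.
    have -> : dot c (x - p - r *: c) = dot c (x - p) - r * dot c c.
      by rewrite dotDr dotNr dotZr.
    congr (_ * (_ - _) ^+ 2).
    rewrite !(dotDl (x - p)) !(dotDr (x - p)) !(dotNl, dotNr, dotZl, dotZr).
    by rewrite (dotC (x - p) c); ring.
  apply: der_eq; rewrite /GRing.scale /= /E /S /bump_radius /y.
  have -> : dot c (x - p - t *: c) = dot c (x - p) - t * dot c c.
    by rewrite dotDr dotNr dotZr.
  rewrite !(dotDl (x - p)) !(dotDr (x - p)) !(dotNl, dotNr, dotZl, dotZr).
  by rewrite (dotC (x - p) c); field.
move=> i.
exists (fun r => kap * expR (- K * t - (dot c y + r * c ord0 i) / 2) *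
  (- (c ord0 i / 2) * (S - 2 * r * y ord0 i - r ^+ 2) ^+ 2 +
   2 * (S - 2 * r * y ord0 i - r ^+ 2) * (- (2 * y ord0 i) - 2 * r))); split=> [r|].
  have -> : (fun s => bump kap K rho sig c p t (x + s *: delta_mx ord0 i)) =
      (fun r => kap * expR (- K * t - (dot c y + r * c ord0 i) / 2) *
        (S - 2 * r * y ord0 i - r ^+ 2) ^+ 2).
    apply/funext => s; rewrite /bump /bump_radius.
    have -> : x + s *: delta_mx ord0 i - p - t *: c = y + s *: delta_mx ord0 i.
      by rewrite /y -!addrA; congr (_ + _); rewrite addrC -addrA.
    rewrite dot_line dotDr dotZr dot_delta /S /bump_radius -/y.
    by congr (_ * _ ^+ 2); ring.
  by apply: der_eq; rewrite /GRing.scale /=; field.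
by apply: der_eq; rewrite /GRing.scale /= /E !(mul0r, mulr0, addr0, expr0n, subr0) /=; field.
Qed.

(* The drift terms cancel: up to a positive factor, Delta v + m v - v_t is a quadratic
   polynomial in S = bump_radius, and the last hypothesis makes its discriminant <= 0. *)
Lemma bump_subsolution kap K m rho sig c p t x : 0 <= kap ->
  0 < K + m - dot c c / 4 ->
  (2 * sig + 4 * N%:R + 8) ^+ 2 <= 32 * (rho + sig * t) * (K + m - dot c c / 4) ->
  exists a h, jet (bump kap K rho sig c p) t x a h /\
    a <= \sum_(i < N) h i + m * bump kap K rho sig c p t x.
Proof.
move=> kap0 A0 disc; eexists _, _; split; first exact: bump_jet.
rewrite -mulr_sumr /bump; set y := x - p - t *: c; set S := bump_radius _ _ _ _ _ _.
set E := kap * expR _.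
have E0 : 0 <= E by rewrite mulr_ge0 ?expR_ge0.
have -> : \sum_(i < N) (c ord0 i ^+ 2 / 4 * S ^+ 2 + 4 * S * (c ord0 i * y ord0 i) +
      8 * y ord0 i ^+ 2 - 4 * S) =
    dot c c / 4 * S ^+ 2 + 4 * S * dot c y + 8 * dot y y - 4 * S * N%:R.
  rewrite !big_split /= -!mulr_sumr sumrN sumr_const card_ord; congr (_ + _ + _ + _); last first.
    by rewrite mulr_natr.
  by rewrite -!mulr_suml; congr (_ / _ * _); apply: eq_bigr => i _; rewrite expr2.
have -> : dot y y = rho + sig * t - S by rewrite /S /bump_radius subKr.
rewrite -subr_ge0.
set A := K + m - dot c c / 4 in A0 disc.
have -> : E * (dot c c / 4 * S ^+ 2 + 4 * S * dot c y + 8 * (rho + sig * t - S) - 4 * S * N%:R) +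
    m * (E * S ^+ 2) - E * ((dot c c / 2 - K) * S ^+ 2 + 2 * S * (sig + 2 * dot c y)) =
    E * (A * S ^+ 2 - (2 * sig + 4 * N%:R + 8) * S + 8 * (rho + sig * t)).
  by rewrite /A; field.
apply: mulr_ge0 => //; set b := 2 * sig + _ + _ in disc *.
(* Completing the square: this equals (2 A S - b)^2 plus the nonnegative quantity of [disc]. *)
have : 0 <= A * (4 * (A * S ^+ 2 - b * S + 8 * (rho + sig * t))).
  have := sqr_ge0 (2 * A * S - b); nra.
by rewrite pmulr_rge0// pmulr_rge0.
Qed.

Lemma continuous_bump_radius rho sig c p :
  continuous (fun q : R * 'rV[R]_N => bump_radius rho sig c p q.1 q.2).
Proof. by move=> q; rewrite /bump_radius; cont. Qed.

Lemma continuous_bump kap K rho sig c p :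
  continuous (fun q : R * 'rV[R]_N => bump kap K rho sig c p q.1 q.2).
Proof. by move=> q; rewrite /bump /bump_radius; cont. Qed.

End spreading.

(** * Lower bounds spreading from a full unit ball *)

Section uniform_spreading.
Context {R : realType} {N : nat}.
Implicit Types (x p c : 'rV[R]_N) (t r : R).
Variables (u : R -> 'rV[R]_N -> R) (uinit : 'rV[R]_N -> R).
Hypothesis hu : bounded_classical_solution logistic uinit u.
Hypothesis uinit01 : forall x, 0 <= uinit x <= 1.

Definition unit_ball_full p := forall y, enorm (y - p) < 1 -> uinit y = 1.

Let u01 t x : 0 < t -> 0 <= u t x <= 1.
Proof. by move=> t0; rewrite (solution_ge0 hu uinit01)// (solution_le1 hu uinit01). Qed.

(** The bound is uniform in [p]: the barrier is one expanding bump for the heat equation, translated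
    to [p]; the reaction is nonnegative. *)
Lemma solution_pos_ball (L : R) : exists2 k0 : R, 0 < k0 &
  forall p, unit_ball_full p -> forall x, enorm (x - p) <= L -> k0 <= u 1 x.
Proof.
(* [sig] brings the squared radius to L^2 + 5/4 at time 1; [K] makes the discriminant condition of
   [bump_subsolution] hold for rho = 1/4 and m = 0. *)
pose sig : R := L ^+ 2 + 1; pose K : R := (2 * sig + 4 * N%:R + 8) ^+ 2 / 8.
have sig1 : 1 <= sig by rewrite lerDr sqr_ge0.
have K0 : 0 < K.
  by have N0 : 0 <= N%:R :> R by []; rewrite divr_gt0// exprn_gt0//; lra.
exists (expR (- K) / 16) => [|p pfull x xp]; first by rewrite divr_gt0// expR_gt0.
pose v := bump 1 K (4^-1) sig 0 p.
pose d := bump_radius (4^-1) sig 0 p.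
have c0 t y : y - p - t *: 0 = y - p by rewrite scaler0 subr0.
have vE t y : v t y = expR (- K * t) * d t y ^+ 2.
  by rewrite /v /bump dot0l mul0r subr0 mul1r.
have dE t y : d t y = 4^-1 + sig * t - dot (y - p) (y - p).
  by rewrite /d /bump_radius c0.
have [_ _ _ L1] := hu.
(* [- g] is a continuous function below the datum. *)
pose g y := - Num.max 0 (1 - dot (y - p) (y - p)).
have N0 : 0 <= N%:R :> R by [].
have sm : 0 < 4^-1 / sig by rewrite divr_gt0//; lra.
have d0 : 0 < (N%:R + 1)^-1 / 10 :> R by rewrite divr_gt0// invr_gt0; lra.
have e1 t : 0 <= t -> expR (- K * t) <= 1.
  by move=> t0; rewrite -expR0 ler_expR mulNr oppr_le0 mulr_ge0// ltW.
have dot0 y : 0 <= dot (y - p) (y - p) by exact: dot_ge0.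
have xL : dot (x - p) (x - p) <= L ^+ 2.
  by rewrite -sqr_enorm lerXn2r ?nnegrE ?enorm_ge0// (le_trans (enorm_ge0 _) xp).
suff : - u 1 x <= - v 1 x.
  rewrite lerN2; apply: le_trans; rewrite vE dE !mulr1 ler_wpM2l ?expR_ge0//.
  have -> : 16^-1 = (4^-1) ^+ 2 :> R by field.
  by rewrite lerXn2r ?nnegrE// /sig; lra.
apply: (@initial_comparison _ _ u uinit (fun t x => - u t x) g (fun t x => - v t x) d
  0 0 ((4^-1 + sig) ^+ 2) (4^-1 / sig) ((N%:R + 1)^-1 / 10) 1 L1) => //.
- by move=> q q0; apply: continuous_at_opp; exact: (solution_continuous hu).
- by move=> y; rewrite /g; cont.
- by move=> t y /(u01 y)/andP[]; rewrite oppr_le0.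
- move=> t y t0; have [a [h [ju aE]]] := solution_jet hu y t0.
  by apply: (subsolution_at_opp ju); rewrite mul0r addr0 aE lerDl logistic_ge0.
- move=> t y t0; have /andP[u0 u1] := u01 y t0; have /andP[i0 i1] := uinit01 y.
  rewrite -normrN opprB /g opprK addrC.
  apply: le_trans (ler_norm _); rewrite lerD2r ge_max i0 /=.
  have [yp|yp] := ltrP (enorm (y - p)) 1; first by rewrite pfull// gerBl.
  apply: le_trans i0; rewrite subr_le0 -sqr_enorm -[leLHS](expr1n _ 2).
  by rewrite lerXn2r ?nnegrE ?enorm_ge0.
- by move=> q; apply: continuous_at_opp; exact: continuous_bump.
- exact: continuous_bump_radius.
- move=> t y /andP[t0 t1] dty; rewrite lerN2 vE.
  rewrite -[leRHS]mul1r ler_pM ?expR_ge0 ?sqr_ge0 ?e1 ?(ltW t0)//.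
  rewrite lerXn2r ?nnegrE//; first by lra.
  by rewrite dE; have := dot0 y; nra.
- move=> t y t0 dty.
  have [||a [h [jv av]]] := @bump_subsolution _ _ 1 K 0 (4^-1) sig 0 p t y ler01.
  + by rewrite dot0l mul0r subr0 addr0.
  + rewrite dot0l mul0r subr0 addr0.
    have -> : (2 * sig + 4 * N%:R + 8) ^+ 2 = 8 * K by rewrite /K; field.
    rewrite ler_pM2r//; nra.
  exists (- a), (fun i => - h i); split; first exact: jetN.
  by rewrite mul0r addr0 sumrN lerN2; rewrite mul0r addr0 in av.
- by move=> t y t0 dty; rewrite vE dty expr0n /= mulr0 oppr0.
(* For these times the squared radius is at most 1/2 and the bump at most 1/4; the sampled points
   lie within 3/4 + 1/10 of [p], where [- g] exceeds 1/4. *)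
- move=> delta s y n /andP[del0 del1] /andP[s0 s1] n0 dsy.
  have sig0 : 0 < sig by lra.
  have ss : sig * s <= 4^-1 by rewrite ltr_pdivlMr// in s1; lra.
  have yp : dot (y - p) (y - p) <= 2^-1 by rewrite dE in dsy; lra.
  rewrite -[leRHS](grid_avg_cst delta _ y n0); apply: ler_grid_avg => q qg.
  rewrite lerN2 vE.
  have : expR (- K * s) * d s y ^+ 2 <= 4^-1.
    have -> : 4^-1 = 1 * (2^-1) ^+ 2 :> R by field.
    rewrite ler_pM ?expR_ge0 ?sqr_ge0 ?e1 ?(ltW s0)//.
    by rewrite lerXn2r ?nnegrE//; rewrite dE; have := dot0 y; lra.
  move/le_trans; apply; rewrite le_max; apply/orP; right.
  rewrite -sqr_enorm.
  have qn : enorm q <= 10^-1.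
    apply: le_trans (ler_enorm_norm _) _; apply: (@le_trans _ _ (N%:R * delta)).
      apply: ler_wpM2l => //; apply: ler_norm_coord => [|i]; first exact: ltW.
      by have /andP[q0 q1] := mem_grid i del0 n0 qg; rewrite ger0_norm// ltW.
    have N1 : 0 < N%:R + 1 :> R by lra.
    rewrite [_ / 10]mulrC ltr_pdivlMr// in del1; nra.
  have yn : enorm (y - p) <= 3 / 4.
    by apply: enorm_le; lra.
  have : enorm (y + q - p) <= enorm (y - p) + enorm q by rewrite addrAC ler_enormD.
  have := enorm_ge0 (y + q - p); nra.
- by rewrite ltr01 lexx.
- by rewrite dE mulr1 /sig; lra.
Qed.

(** A bump of constant radius starts at [p] at time 1 with the velocity that brings its centre to
    [x] at time [t]. *)
Lemma solution_pos_cone (c0 : R) : 0 <= c0 < 2 -> exists2 e0 : R, 0 < e0 <= 1 &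
  forall p, unit_ball_full p -> forall t x, 1 <= t -> enorm (x - p) <= c0 * (t - 1) ->
    e0 <= u t x.
Proof.
move=> /andP[c00 c02].
pose m := (1 + c0 ^+ 2 / 4) / 2.
have c04 : c0 ^+ 2 / 4 < 1 by rewrite ltr_pdivrMr// mul1r; nra.
have [m0 m1] : c0 ^+ 2 / 4 < m /\ m < 1 by rewrite /m; split; lra.
pose b : R := (4 * N%:R + 8) ^+ 2 / (32 * (m - c0 ^+ 2 / 4)).
pose L := 1 + b.
have b0 : 0 <= b by rewrite divr_ge0 ?sqr_ge0// mulr_ge0// subr_ge0 ltW.
have L1 : 1 <= L by rewrite lerDl.
have [k0 k00 Hk0] := solution_pos_ball L.
(* A bump at most k0 fits below u at time 1; being at most 1 - m, it forces u (1 - u) >= m u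
   wherever it exceeds u. *)
pose k1 := Num.min k0 (1 - m).
have k10 : 0 < k1 by rewrite lt_min k00 subr_gt0.
have eL : 0 < expR (- L) by exact: expR_gt0.
exists (k1 * expR (- L)) => [|p pfull t x t1 xp].
  rewrite mulr_gt0//= mulr_ile1//; try exact: ltW.
    by rewrite ge_min; apply/orP; right; have := sqr_ge0 c0; lra.
  by rewrite -expR0 ler_expR; lra.
(* For t = 1 the inverse is 0 by convention, so c = 0, which fits since then x = p. *)
pose c := (t - 1)^-1 *: (x - p).
have cc : enorm c <= c0.
  have [t1'|t1'] := eqVneq t 1; first by rewrite /c t1' subrr invr0 scale0r enorm0.
  have t10 : 0 < t - 1 by rewrite subr_gt0 lt_neqAle eq_sym t1'.
  rewrite /c enormZ ger0_norm ?invr_ge0 ?(ltW t10)// mulrC ler_pdivrMr//.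
have xE : x = p + (t - 1) *: c.
  have [t1'|t1'] := eqVneq t 1.
    rewrite t1' subrr scale0r addr0; apply/eqP; rewrite -subr_eq0; apply/eqP.
    apply: enorm_eq0; apply/eqP; rewrite eq_le enorm_ge0 andbT.
    by rewrite t1' subrr mulr0 in xp.
  by rewrite /c scalerA divff ?scale1r ?subrKC// subr_eq0.
have ccm : dot c c / 4 <= c0 ^+ 2 / 4.
  by rewrite ler_pM2r ?invr_gt0// -sqr_enorm lerXn2r ?nnegrE ?enorm_ge0.
(* On the ball exp(-c.y / 2) <= exp L, so the bump is at most [k1], and its value at the centre is
   k1 exp(-L). *)
pose kap := k1 * expR (- L) / L ^+ 4.
have L40 : 0 < L ^+ 4 by rewrite exprn_gt0//; lra.
have kap0 : 0 < kap by rewrite divr_gt0// mulr_gt0.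
pose v := bump kap 0 (L ^+ 2) 0 c (p - c).
pose d := bump_radius (L ^+ 2) 0 c (p - c).
have vE s y : v s y = kap * expR (- dot c (y - (p - c) - s *: c) / 2) * d s y ^+ 2.
  by rewrite /v /bump oppr0 mul0r add0r mulNr.
have dE s y : d s y = L ^+ 2 - dot (y - (p - c) - s *: c) (y - (p - c) - s *: c).
  by rewrite /d /bump_radius mul0r addr0.
have vk s y : 0 <= d s y -> v s y <= k1.
  move=> dsy; have yL : enorm (y - (p - c) - s *: c) <= L.
    by rewrite dE in dsy; apply: enorm_le; lra.
  have dL : d s y ^+ 2 <= L ^+ 4.
    rewrite (exprM L 2 2) lerXn2r ?nnegrE ?sqr_ge0//.
    by rewrite dE; have := dot_ge0 (y - (p - c) - s *: c); lra.
  have cy : - dot c (y - (p - c) - s *: c) / 2 <= L.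
    have := dot_le_enorm (- c) (y - (p - c) - s *: c).
    rewrite dotNl enormN; have := enorm_ge0 c; have := enorm_ge0 (y - (p - c) - s *: c).
    nra.
  rewrite vE; apply: (@le_trans _ _ (kap * expR L * L ^+ 4)).
    apply: ler_pM => //.
    - by apply: mulr_ge0; [exact: ltW|exact: expR_ge0].
    - exact: sqr_ge0.
    - by rewrite ler_pM2l// ler_expR.
  rewrite /kap expRN; have eL0 := expR_gt0 L.
  by rewrite le_eqVlt; apply/orP; left; apply/eqP; field; rewrite !gt_eqF//=; lra.
have vc : v t x = k1 * expR (- L).
  have -> : v t x = kap * L ^+ 4.
    rewrite vE dE xE.
    have -> : p + (t - 1) *: c - (p - c) - t *: c = 0.
      by apply/rowP => i; rewrite !mxE; ring.
    by rewrite (dotC c) !dot0l oppr0 mul0r expR0 mulr1 addr0 -exprM.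
  by rewrite /kap divfK// gt_eqF.
rewrite -vc -subr_le0.
apply: (@maximum_principle0 _ _ 1 k1 1 t (fun t x => v t x - u t x) d) => //.
- move=> q /andP[q1 _]; apply: continuous_at_add; first exact: continuous_bump.
  by apply: continuous_at_opp; apply: (solution_continuous hu); lra.
- exact: continuous_bump_radius.
- move=> s y /andP[s1 _] dsy; have := vk s y dsy.
  by have /andP[] := u01 y (lt_le_trans ltr01 s1); lra.
- move=> y dy; rewrite subr_le0; apply: le_trans (vk _ _ dy) _.
  apply: (@le_trans _ _ k0); first by rewrite ge_min lexx.
  apply: Hk0 pfull _ _; apply: enorm_le; first by lra.
  rewrite dE scale1r in dy.
  by rewrite (_ : y - (p - c) - c = y - p) in dy; [lra|apply/rowP => i; rewrite !mxE; ring].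
- move=> s y /andP[s1 _] dsy.
  rewrite vE dsy expr0n /= mulr0 sub0r oppr_le0.
  by have /andP[] := u01 y (lt_le_trans ltr01 s1).
- move=> s y /andP[s1 _] dsy; rewrite subr_gt0 => uv.
  have s0 : 0 < s by lra.
  have [a [h [ju aE]]] := solution_jet hu y s0.
  have [||b' [k [jv bv]]] := @bump_subsolution _ _ kap 0 m (L ^+ 2) 0 c (p - c) s y (ltW kap0).
  + by rewrite add0r subr_gt0; lra.
  + rewrite mulr0 !add0r mul0r addr0.
    have mc : 0 < m - c0 ^+ 2 / 4 by rewrite subr_gt0.
    have bE : (4 * N%:R + 8) ^+ 2 = 32 * b * (m - c0 ^+ 2 / 4).
      by rewrite [RHS]mulrAC [RHS]mulrC /b divfK// gt_eqF// mulr_gt0.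
    rewrite bE ler_pM//; first by rewrite mulr_ge0.
      by rewrite ltW.
      by rewrite /L; nra.
    by lra.
  eexists _, _, _; split; [exact: jetD jv (jetN ju)|by []|by []|].
  rewrite big_split /= sumrN aE (logistic_solution hu uinit01)//.
  have vm : v s y <= 1 - m by apply: le_trans (vk _ _ (ltW dsy)) _; rewrite ge_min lexx orbT.
  have /andP[u0 u1] := u01 y s0.
  rewrite -/v in bv; nra.
- by rewrite t1 /=.
- rewrite dE xE.
  have -> : p + (t - 1) *: c - (p - c) - t *: c = 0.
    by apply/rowP => i; rewrite !mxE; ring.
  by rewrite dot0l subr0 exprn_ge0//; lra.
Qed.

(* Where u >= e0, the function 1 - u satisfies w_t <= Delta w - e0 w. *)
Lemma solution_near1 (e0 rho s tau : R) x0 : 0 < s -> 0 < e0 -> 0 < rho -> 0 <= tau ->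
  (forall t x, s <= t <= s + tau -> enorm (x - x0) <= rho -> e0 <= u t x) ->
  1 - expR (- e0 * tau) - 2 * N%:R * tau / rho ^+ 2 <= u (s + tau) x0.
Proof.
move=> s0 e00 rho0 tau0 ue.
(* Special cases of the barrier: [q1] is the spatially constant decay exp(-e0 (t - s)), and [q2]
   solves the heat equation and is at least 1 on the sphere of radius [rho] about [x0]. *)
pose q1 := quad_barrier (N := N) (- e0) 1 0 s.
pose q2 t x := quad_barrier 0 0 (rho ^- 2) s t (x + - x0).
pose w (t : R) (x : 'rV[R]_N) := 1 - u t x - q1 t x - q2 t x.
pose d (t : R) (x : 'rV[R]_N) := rho ^+ 2 - dot (x - x0) (x - x0).
have rho2 : 0 < rho ^- 2 by rewrite invr_gt0 exprn_gt0.
have q1E t x : q1 t x = expR (- e0 * (t - s)).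
  by rewrite /q1 /quad_barrier mul0r addr0 mulr1.
have q2E t x : q2 t x = rho ^- 2 * (dot (x - x0) (x - x0) + 2 * N%:R * (t - s)).
  by rewrite /q2 /quad_barrier mul0r expR0 mul1r add0r.
have q20 t x : s <= t -> 0 <= q2 t x.
  move=> st; rewrite q2E mulr_ge0 ?(ltW rho2)// addr_ge0 ?dot_ge0//.
  by rewrite mulr_ge0 ?mulr_ge0// subr_ge0.
have ts t x : s <= t <= s + tau -> 0 <= d t x -> e0 <= u t x.
  move=> st dtx; apply: ue => //; apply: enorm_le; first exact: ltW.
  by rewrite -subr_ge0.
suff : w (s + tau) x0 <= 0.
  rewrite /w q1E q2E (_ : s + tau - s = tau); last by ring.
  by rewrite subrr dot0l add0r [rho ^- 2 * _]mulrC; lra.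
apply: (@maximum_principle0 _ _ 0 1 s (s + tau) w d) => //.
- move=> q /andP[sq _]; have q0 : 0 < q.1 by exact: lt_le_trans sq.
  apply: continuous_at_add; last by rewrite /q2 /quad_barrier; cont.
  apply: continuous_at_add; last by rewrite /q1 /quad_barrier; cont.
  apply: continuous_at_add; first by cont.
  by apply: continuous_at_opp; exact: (solution_continuous hu).
- by move=> q; rewrite /d; cont.
- move=> t x /andP[st _] _; rewrite /w.
  have := u01 x (lt_le_trans s0 st) => /andP[? ?].
  by have := q20 t x st; have := expR_ge0 (- e0 * (t - s)); rewrite q1E; lra.
- move=> x _; rewrite /w q1E subrr mulr0 expR0.
  by have := q20 s x (lexx s); have /andP[? ?] := u01 x s0; lra.
- move=> t x /andP[st tT] dtx; have t0 := lt_le_trans s0 st.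
  have : 1 <= q2 t x.
    have dE : dot (x - x0) (x - x0) = rho ^+ 2.
      by apply/esym/eqP; rewrite -subr_eq0 -[_ - _]/(d t x) dtx.
    rewrite q2E dE mulrDr mulVf ?gt_eqF ?exprn_gt0// lerDl.
    by rewrite mulr_ge0 ?(ltW rho2)// mulr_ge0 ?mulr_ge0// subr_ge0.
  have := expR_ge0 (- e0 * (t - s)); rewrite /w q1E.
  by have /andP[? ?] := u01 x t0; lra.
- move=> t x /andP[st tT] dtx wtx; have t0 := lt_trans s0 st.
  have [a [h [ju aE]]] := solution_jet hu x t0.
  have j2 := jet_shift (quad_barrier_jet 0 0 (rho ^- 2) s t (x + - x0)).
  have j1 := quad_barrier_jet (N := N) (- e0) 1 0 s t x.
  have jw := jetD (jetD (jetD (jet_cst 1 t x) (jetN ju)) (jetN j1)) (jetN j2).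
  eexists _, _, _; split; [exact: jw|by []|by []|].
  rewrite [0 * (t - s)]mul0r expR0.
  rewrite [X in _ <= X + _](_ : _ = - (\sum_(i < N) h i) - N%:R * (rho ^- 2 * 2)); last first.
    have -> : N%:R * (rho ^- 2 * 2) = \sum_(i < N) (rho ^- 2 * 2).
      by rewrite sumr_const card_ord mulr_natl.
    rewrite -sumrN -sumrB.
    by apply: eq_bigr => i _ /=; ring.
  rewrite aE (logistic_solution hu uinit01)//.
  have ue0 : e0 <= u t x by apply: ts; rewrite ?(ltW dtx)// (ltW st) tT.
  have := q20 t x (ltW st); move: wtx; rewrite /w -/(q1 t x).
  set q := q1 t x; set S := \sum_(_ < _) _.
  move: ue0 (u01 x t0) => + /andP[+ +]; set U := u t x => ue0 U0 U1 wtx q20'.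
  (* w > 0 gives 1 - U > q, and U >= e0. *)
  have : e0 * q <= U * (1 - U).
    apply: (@le_trans _ _ (e0 * (1 - U))); first by rewrite ler_pM2l//; lra.
    by rewrite ler_wpM2r//; lra.
  lra.
- by rewrite lexx andbT lerDl.
- by rewrite /d subrr dot0l subr0 ltW// exprn_gt0.
Qed.

(** Positivity in the wider cone of speed [c1] holds on a large ball about [x] during the last [tau]
    time units, and [solution_near1] upgrades it to closeness to 1. *)
Lemma solution_spreading (c lam : R) : 0 <= c < 2 -> lam < 1 -> exists2 T : R, 1 <= T &
  forall t p x, T <= t -> unit_ball_full p -> enorm (x - p) <= c * t -> lam <= u t x.
Proof.
move=> /andP[c0 c2] lam1.
pose c1 := (c + 2) / 2.
have c1i : 0 <= c1 < 2 by rewrite /c1; apply/andP; split; lra.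
have [e0 /andP[e00 e01] He0] := solution_pos_cone c1i.
have l0 : 0 < 1 - lam by lra.
(* [tau] and then [rho] make each of the two error terms of [solution_near1] at most (1 - lam) /
   2. *)
pose tau := 2 / (e0 * (1 - lam)).
have tau0 : 0 < tau by rewrite divr_gt0// mulr_gt0.
pose rho := 1 + 4 * N%:R * tau / (1 - lam).
have rho1 : 1 <= rho.
  rewrite lerDl; apply: divr_ge0; last exact: ltW.
  by apply: mulr_ge0; [exact: mulr_ge0|exact: ltW].
(* The gain (c1 - c) t must cover the radius [rho] and the time lag tau + 1 travelled at speed c1 <
   2. *)
pose T := (rho + 2 * (tau + 1)) / (c1 - c).
have cc0 : 0 < c1 - c by rewrite /c1; lra.
have cc1 : c1 - c <= 1 by rewrite /c1; lra.
have TE : (c1 - c) * T = rho + 2 * (tau + 1) by rewrite /T mulrC divfK// gt_eqF.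
have T1 : rho + 2 * (tau + 1) <= T.
  by rewrite /T ler_pdivlMr// ler_piMr//; lra.
exists T => [|t p x Tt pfull xp]; first by lra.
have s0 : 0 < t - tau by lra.
have := @solution_near1 e0 rho (t - tau) tau x s0 e00 (lt_le_trans ltr01 rho1) (ltW tau0).
rewrite subrK => /(_ _) H.
apply: le_trans (H _); last first.
  move=> s y /andP[s1 s2] yx; apply: (He0 p pfull); first by lra.
  apply: le_trans (ler_enormB _ x _) _.
  have : c1 * (t - tau - 1) <= c1 * (s - 1) by rewrite ler_wpM2l//; lra.
  apply: le_trans; apply: (@le_trans _ _ (rho + c * t)); first exact: lerD.
  have : (c1 - c) * T <= (c1 - c) * t by rewrite ler_pM2l.
  have : c1 * (tau + 1) <= 2 * (tau + 1) by rewrite ler_wpM2r//; lra.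
  lra.
have h1 : expR (- e0 * tau) <= (1 - lam) / 2.
  rewrite mulNr expRN.
  have -> : (1 - lam) / 2 = (e0 * tau)^-1 by rewrite /tau; field; rewrite !gt_eqF.
  rewrite lef_pV2 ?posrE ?expR_gt0//; last exact: mulr_gt0.
  by apply: le_trans (expR_ge1Dx _); rewrite lerDr.
have h2 : 2 * N%:R * tau / rho ^+ 2 <= (1 - lam) / 2.
  rewrite ler_pdivrMr ?exprn_gt0//; last by lra.
  apply: (@le_trans _ _ ((1 - lam) / 2 * rho)).
    rewrite /rho mulrDr mulr1.
    have -> : (1 - lam) / 2 * (4 * N%:R * tau / (1 - lam)) = 2 * N%:R * tau.
      by field; rewrite gt_eqF.
    by rewrite lerDr; lra.
  rewrite ler_wpM2l//; first by lra.
  by rewrite expr2 ler_peMl//; lra.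
lra.
Qed.

End uniform_spreading.

(** * Averages over a thin tube *)

Section thin_tube.
Context {R : realType}.
Implicit Types (h eta b S : R).

(* The number of grid points b + eta k with |b + eta k - S| < 2h is at most
   4h / eta + 1: it telescopes along the clamped position G. *)
Lemma sum_tent_le h eta b S n : 0 < h -> 0 < eta ->
  \sum_(0 <= k < n) Num.max 0 (2 - `|b + eta * k%:R - S| / h) <=
  2 * (4 * h / eta + 1).
Proof.
move=> h0 eta0; pose W := 4 * h / eta.
have W0 : 0 < W by rewrite divr_gt0// mulr_gt0.
(* Position of the k-th point in units of [eta], measured from the left end of the support of the
   tent, whose length is [W] in these units. *)
pose X (k : nat) := (b - S + 2 * h) / eta + k%:R.
pose G (k : nat) := Num.min (Num.max (X k) 0) (W + 1).
have XS k : X k.+1 = X k + 1 by rewrite /X -natr1; ring.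
have G_mono k : 0 <= 2 * (G k.+1 - G k).
  rewrite mulr_ge0// subr_ge0 /G le_min !ge_min lexx orbT andbT.
  by rewrite ge_max !le_max lexx orbT andbT XS lerDl ler01.
apply: (@le_trans _ _ (\sum_(0 <= k < n) 2 * (G k.+1 - G k))); last first.
  rewrite -mulr_sumr telescope_sumr// ler_pM2l//.
  have : G n <= W + 1 by rewrite /G ge_min lexx orbT.
  have : 0 <= G 0%N by rewrite /G le_min le_max lexx orbT /=; lra.
  by rewrite -/W; lra.
apply: ler_sum => k _; rewrite ge_max; apply/andP; split.
  exact: G_mono.
(* Inside the support [G] grows by exactly 1 and the tent is at most 2; outside the tent
   vanishes. *)
have [Xk|Xk] := boolP (0 < X k < W).
  case/andP: Xk => X0 XW; rewrite /G XS !max_l; [|lra|lra].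
  rewrite !min_l; [|lra|lra].
  have : 0 <= `|b + eta * k%:R - S| / h by apply: divr_ge0 => //; exact: ltW.
  by lra.
have -> : b + eta * k%:R - S = eta * (X k - W / 2).
  by rewrite /X /W; field; rewrite gt_eqF.
suff : 2 <= `|eta * (X k - W / 2)| / h.
  by have := G_mono k; lra.
rewrite ler_pdivlMr// normrM gtr0_norm//.
have -> : 2 * h = eta * (W / 2) by rewrite /W; field; rewrite gt_eqF.
rewrite ler_pM2l//; move: Xk; rewrite negb_and -!leNgt => /orP[X0|X0].
  by rewrite ler0_norm; lra.
by rewrite ger0_norm; lra.
Qed.

(** With the other coordinates fixed, a line of grid points in the second direction meets the tube
    in an interval of length 4h, whatever the value of [f]. *)
Lemma grid_avg_tube m h delta n (x : 'rV[R]_m.+2) (f : R -> R) :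
  0 < h -> 0 < delta -> (0 < n)%N ->
  grid_avg delta n (fun y : 'rV[R]_m.+2 => Num.max 0 (2 - `|y ord0 (lift ord0 ord0) -
    f (y ord0 ord0)| / h)) x <= 2 * (4 * h / delta + n%:R^-1).
Proof.
move=> h0 delta0 n0; have nR : 0 < n%:R :> R by rewrite ltr0n.
rewrite /grid_avg mulrC ler_pdivrMr ?exprn_gt0//.
rewrite [grid _ _ _]/= big_allpairs_dep.
apply: (@le_trans _ _ (\sum_(0 <= j < n) n%:R ^+ m * (2 * (4 * h / (delta / n%:R) + 1)))).
  apply: ler_sum => j _; rewrite -/(grid delta n m) big_allpairs_dep exchange_big /=.
  pose F (k : nat) := Num.max 0 (2 - `|x ord0 (lift ord0 ord0) + delta / n%:R * k%:R -
    f (x ord0 ord0 + delta * j%:R / n%:R)| / h).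
  apply: (@le_trans _ _ (\sum_(y <- grid delta n m) \sum_(0 <= k < n) F k)).
    rewrite le_eqVlt; apply/orP; left; apply/eqP.
    apply: eq_bigr => y _; apply: eq_bigr => k _; rewrite /F.
    have xp (p : 'rV[R]_m.+2) i : (x + p) ord0 i = x ord0 i + p ord0 i by rewrite mxE.
    by rewrite !xp !row_const_mxE liftK unlift_none row_const_mxE unlift_none mulrAC.
  rewrite (big_const_seq 0) count_predT size_grid iter_addr_0 -[_ *+ _]mulr_natl natrX.
  rewrite ler_pM2l ?exprn_gt0//.
  by apply: sum_tent_le => //; rewrite divr_gt0.
rewrite sumr_const_nat subn0 -mulr_natl !exprS le_eqVlt; apply/orP; left; apply/eqP.
field; by rewrite !gt_eqF.
Qed.

End thin_tube.

(** * Distance to the half-line and shape of U *)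

Section tube_geometry.
Context {R : realType} {m : nat}.
Implicit Types (x y p : 'rV[R]_m.+2) (s t r : R).

Let i0 : 'I_m.+2 := ord0.
Let i1 : 'I_m.+2 := lift ord0 ord0.

Definition axis : 'rV[R]_m.+2 := delta_mx ord0 i0.
Definition axis2 : 'rV[R]_m.+2 := delta_mx ord0 i1.
Definition ray_proj x : 'rV[R]_m.+2 := Num.max 0 (x ord0 i0) *: axis.
Definition ray_dist x : R := enorm (x - ray_proj x).

Lemma dot_axis x : dot x axis = x ord0 i0. Proof. exact: dot_delta. Qed.
Lemma dot_axis2 x : dot x axis2 = x ord0 i1. Proof. exact: dot_delta. Qed.
Lemma axis_axis : dot axis axis = 1. Proof. by rewrite dot_axis mxE !eqxx. Qed.
Lemma axis2_axis2 : dot axis2 axis2 = 1. Proof. by rewrite dot_axis2 mxE !eqxx. Qed.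
Lemma dot_sub_axis x s :
  dot (x - s *: axis) (x - s *: axis) = dot x x - 2 * s * x ord0 i0 + s ^+ 2.
Proof.
rewrite !(dotDl, dotDr, dotNl, dotNr, dotZl, dotZr) (dotC axis x) axis_axis !dot_axis.
ring.
Qed.

Lemma dot_sub_axis2 x s :
  dot (x - s *: axis2) (x - s *: axis2) = dot x x - 2 * s * x ord0 i1 + s ^+ 2.
Proof.
rewrite !(dotDl, dotDr, dotNl, dotNr, dotZl, dotZr) (dotC axis2 x) axis2_axis2 !dot_axis2.
ring.
Qed.

Lemma ray_dist_ge0 x : 0 <= ray_dist x. Proof. exact: enorm_ge0. Qed.

Lemma ray_dist_le x s : 0 <= s -> ray_dist x <= enorm (x - s *: axis).
Proof.
move=> s0; apply: enorm_le; first exact: enorm_ge0.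
rewrite sqr_enorm /ray_proj !dot_sub_axis; have := sqr_ge0 (x ord0 i0 - s).
by case: (leP 0 (x ord0 i0)) => x0; nra.
Qed.

Lemma ray_dist_lip x y : ray_dist x <= enorm (x - y) + ray_dist y.
Proof.
apply: (le_trans (@ray_dist_le x (Num.max 0 (y ord0 i0)) _)); first by rewrite le_max lexx.
exact: ler_enormB.
Qed.

Lemma ray_projZ a x : 0 <= a -> ray_proj (a *: x) = a *: ray_proj x.
Proof. by move=> a0; rewrite /ray_proj mxE scalerA maxr_pMr// mulr0. Qed.

Lemma ray_distZ a x : 0 <= a -> ray_dist (a *: x) = a * ray_dist x.
Proof.
by move=> a0; rewrite /ray_dist ray_projZ// -scalerBr enormZ ger0_norm.
Qed.

(** x - ray_proj x is orthogonal to ray_proj x. *)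
Lemma ray_dist_sqr x : dot (x - ray_proj x) x = ray_dist x ^+ 2.
Proof.
rewrite /ray_dist sqr_enorm [in RHS]dotDr; apply/esym.
rewrite dotNr dotZr dot_axis !mxE !eqxx mulr1.
by case: (leP 0 (x ord0 i0)) => x0; ring.
Qed.

Lemma xcoordE x (i : 'I_m.+2) : xcoord x i = x ord0 i.
Proof. by rewrite /xcoord valK. Qed.

Lemma sum_coord_ge1 y :
  \sum_(i < m.+2 | (1 <= i)%N) y ord0 i ^+ 2 = dot (y - y ord0 i0 *: axis) (y - y ord0 i0 *: axis).
Proof.
rewrite dot_sub_axis /dot [in RHS](bigD1 i0)//= -expr2.
under [X in _ = _ + X - _ + _]eq_bigr do rewrite -expr2.
rewrite (eq_bigl (fun i : 'I_m.+2 => i != i0)); last by move=> i; rewrite lt0n.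
ring.
Qed.

Lemma sum_coord_ge2 y (s : R) :
  (y ord0 i1 - s) ^+ 2 + \sum_(i < m.+2 | (2 <= i)%N) y ord0 i ^+ 2 =
  dot (y - y ord0 i0 *: axis - s *: axis2) (y - y ord0 i0 *: axis - s *: axis2).
Proof.
set z := y - _.
rewrite dot_sub_axis2.
have -> : z ord0 i1 = y ord0 i1 by rewrite !mxE /= mulr0 subr0.
rewrite -sum_coord_ge1 [X in _ = X - _ + _](bigD1 i1)//=.
rewrite (eq_bigl (fun i : 'I_m.+2 => (0 < i)%N && (i != i1))).
  ring.
by move=> i; rewrite -val_eqE /= ltn_neqAle eq_sym andbC.
Qed.

Lemma U1_axis y : U1 y <-> 0 <= y ord0 i0 /\ enorm (y - y ord0 i0 *: axis) <= 1.
Proof.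
rewrite /U1 /= (xcoordE y i0) sum_coord_ge1 -sqr_enorm.
split=> -[y0 y1]; split=> //; first by rewrite -(expr_le1 (n := 2)) ?enorm_ge0.
by rewrite expr_le1 ?enorm_ge0.
Qed.

Lemma U2_axis y : U2 y <-> 0 <= y ord0 i0 /\
  enorm (y - y ord0 i0 *: axis - Num.sqrt (y ord0 i0) *: axis2) ^+ 2 <=
  expR (- y ord0 i0 ^+ 2).
Proof.
rewrite /U2 /= (xcoordE y i0) (xcoordE y i1) sum_coord_ge2 -sqr_enorm.
by split.
Qed.

Lemma U2_near_curve y : U2 y -> [/\ 0 <= y ord0 i0,
  enorm (y - y ord0 i0 *: axis - Num.sqrt (y ord0 i0) *: axis2) <= 1 &
  `|y ord0 i1 - Num.sqrt (y ord0 i0)| <= expR (- (y ord0 i0 ^+ 2 / 2))].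
Proof.
move=> /U2_axis[y0 ye]; set z := _ - _ in ye *; split=> //.
  rewrite -(expr_le1 (n := 2)) ?enorm_ge0//; apply: (le_trans ye).
  by rewrite -expR0 ler_expR oppr_le0 sqr_ge0.
have -> : y ord0 i1 - Num.sqrt (y ord0 i0) = z ord0 i1.
  by rewrite !mxE /= mulr0 subr0 mulr1.
apply: (le_trans (ler_coord_enorm _ _)).
rewrite -(ler_pXn2r (n := 2)) ?nnegrE ?enorm_ge0 ?expR_ge0//; apply: (le_trans ye).
by rewrite -expRM_natl ler_expR; lra.
Qed.

Lemma U12_coord0 y : U12 y -> 0 <= y ord0 i0.
Proof. by case=> [/U1_axis[]|/U2_axis[]]. Qed.

(** The width grows sublinearly, so at linear scale U is indistinguishable from the half-line. *)
Lemma U12_ray_dist y : U12 y -> ray_dist y <= 1 + Num.sqrt (y ord0 i0).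
Proof.
move=> Uy; have y0 := U12_coord0 Uy; apply: (le_trans (ray_dist_le _ y0)).
case: Uy => [/U1_axis[_ y1]|/U2_near_curve[_ y1 _]].
  by apply: (le_trans y1); rewrite lerDl sqrtr_ge0.
rewrite -[_ - _ *: axis](subrK (Num.sqrt (y ord0 i0) *: axis2)).
apply: (le_trans (ler_enormD _ _)); rewrite lerD// enormZ ger0_norm ?sqrtr_ge0//.
by rewrite /enorm axis2_axis2 sqrtr1 mulr1.
Qed.

Lemma unit_ball_U12 s : 1 <= s -> unit_ball_full (\1_(@U12 R m.+2)) (s *: axis).
Proof.
move=> s1 y ys; rewrite indicE mem_set//; left; apply/U1_axis.
have y0 : 0 <= y ord0 i0.
  have := ler_coord_enorm (y - s *: axis) i0; rewrite !mxE !eqxx mulr1 ler_norml => /andP[+ _].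
  lra.
split=> //; rewrite -(expr_le1 (n := 2)) ?enorm_ge0// sqr_enorm dot_sub_axis.
have : enorm (y - s *: axis) ^+ 2 <= 1 by rewrite expr_le1 ?enorm_ge0// ltW.
rewrite sqr_enorm dot_sub_axis; have := sqr_ge0 (y ord0 i0 - s); lra.
Qed.

Lemma curve_U12 s : 0 <= s -> U12 (s *: axis + Num.sqrt s *: axis2).
Proof.
move=> s0; right; apply/U2_axis.
have E : (s *: axis + Num.sqrt s *: axis2) ord0 i0 = s.
  by rewrite !mxE /= mulr1 mulr0 addr0.
by rewrite E; split=> //; rewrite addrAC addrK subrr enorm0 expr0n expR_ge0.
Qed.

Lemma curve_ray_dist s : 0 <= s -> ray_dist (s *: axis + Num.sqrt s *: axis2) = Num.sqrt s.
Proof.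
move=> s0; rewrite /ray_dist /ray_proj.
have -> : (s *: axis + Num.sqrt s *: axis2) ord0 i0 = s.
  by rewrite !mxE /= mulr1 mulr0 addr0.
rewrite max_r// addrAC subrr add0r enormZ ger0_norm ?sqrtr_ge0//.
by rewrite /enorm axis2_axis2 sqrtr1 mulr1.
Qed.

End tube_geometry.

(** * Decay beyond speed 2 *)

Section upper_bound.
Context {R : realType} {m : nat}.
Implicit Types (x y e : 'rV[R]_m.+2) (t : R).
Variable u : R -> 'rV[R]_m.+2 -> R.
Hypothesis hu : bounded_classical_solution logistic (\1_(@U12 R m.+2)) u.

Lemma indic01 (A : set 'rV[R]_m.+2) x : 0 <= (\1_A x : R) <= 1.
Proof. by rewrite indicE ler0n lern1 leq_b1. Qed.

Lemma exp_wave_jet e (a : R) t x :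
  jet (fun t x => expR (2 * t - dot e x + a)) t x
    (2 * expR (2 * t - dot e x + a)) (fun i => e ord0 i ^+ 2 * expR (2 * t - dot e x + a)).
Proof.
split; first by apply: der_eq; rewrite /GRing.scale /=; ring.
move=> i; exists (fun r => - e ord0 i * expR (2 * t - (dot e x + r * e ord0 i) + a)).
split=> [r|].
  under eq_fun do rewrite dotDr dotZr dot_delta.
  by apply: der_eq; rewrite /GRing.scale /=; ring.
by apply: der_eq; rewrite /GRing.scale /= mul0r addr0; ring.
Qed.

(** Up to y_1 = M^2 the set stays within M + 1 of the half-line, on which e.x <= 0; beyond, the tube
    has radius exp(-y_1^2 / 2) <= exp(-M^4 / 2). *)
Lemma U12_cover e (M : R) y : enorm e = 1 -> dot e axis <= 0 -> 0 <= M -> U12 y ->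
  dot e y <= M + 1 \/
  `|y ord0 (lift ord0 ord0) - Num.sqrt (y ord0 ord0)| <= expR (- (M ^+ 4 / 2)).
Proof.
move=> e1 e0 M0 [/U1_axis[y0 y1]|/U2_near_curve[y0 y1 ythin]].
  left; rewrite -[y](subrK (y ord0 ord0 *: axis)) dotDr dotZr.
  have := dot_le_enorm e (y - y ord0 ord0 *: axis); rewrite e1 mul1r.
  have : y ord0 ord0 * dot e axis <= 0 by rewrite mulr_ge0_le0.
  lra.
have [yM|yM] := lerP (Num.sqrt (y ord0 ord0)) M.
  left; set s := Num.sqrt _ in y1 yM *.
  have -> : y = (y - y ord0 ord0 *: axis - s *: axis2) + s *: axis2 + y ord0 ord0 *: axis.
    by rewrite !subrK.
  rewrite [dot e _]dotDr dotDr !dotZr.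
  have := dot_le_enorm e (y - y ord0 ord0 *: axis - s *: axis2); rewrite e1 mul1r.
  have : y ord0 ord0 * dot e axis <= 0 by rewrite mulr_ge0_le0.
  have : s * dot e axis2 <= s.
    rewrite ler_piMr ?sqrtr_ge0//; apply: (le_trans (dot_le_enorm _ _)).
    by rewrite e1 mul1r /enorm axis2_axis2 sqrtr1.
  lra.
right; apply: (le_trans ythin); rewrite ler_expR lerN2 ler_pM2r ?invr_gt0//.
rewrite (exprM M 2 2) lerXn2r ?nnegrE ?sqr_ge0//.
rewrite -[leRHS]sqr_sqrtr// lerXn2r ?nnegrE ?sqrtr_ge0// ltW//.
Qed.

(* The part of U2 beyond y_1 = M^2 has exponentially small averages over boxes of
   side delta, so it only contributes the last term. *)
Lemma solution_upper e (M delta : R) t x : enorm e = 1 -> dot e axis <= 0 -> 0 <= M ->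
  0 < delta <= 2 -> 1 < t ->
  u t x <= m.+2%:R * delta + (expR (2 * t - dot e x + (M + 1 + m.+2%:R * delta)) +
    expR t * (expR (- (M ^+ 4 / 2)) * (8 / delta + 2))).
Proof.
move=> e1 e0 M0 /andP[delta0 delta2] t1; have t0 : 0 < t by lra.
set h := expR (- (M ^+ 4 / 2)); have h0 : 0 < h by exact: expR_gt0.
(* The last summand of [a] bounds the variation of e.x over a box of side [delta]. *)
set a := M + 1 + _.
have u01 s y : 0 < s -> 0 <= u s y <= 1.
  by move=> s0; rewrite (solution_ge0 hu (indic01 _))// (solution_le1 hu (indic01 _)).
have [n0 Hn0] : exists n0 : nat, h^-1 < n0%:R.
  by exists (Num.truncn h^-1).+1; exact: truncnS_gt.
(* Twice the bound 4 h / delta + 1 / n of [grid_avg_tube], with 1 / n <= h by the choice of [n0]. *)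
pose B0 := h * (8 / delta + 2).
have B00 : 0 < B0 by rewrite mulr_gt0// addr_gt0// divr_gt0.
pose V s (y : 'rV[R]_m.+2) := expR (2 * s - dot e y + a) + quad_barrier 1 B0 0 0 s y.
have qE s y : quad_barrier 1 B0 0 0 s y = expR s * B0.
  by rewrite /quad_barrier mul1r subr0 mul0r addr0.
(* A continuous majorant of the indicator: by [U12_cover], at each point of U one of the two
   summands is at least 1. *)
pose g (y : 'rV[R]_m.+2) := expR (- dot e y + (M + 1)) +
  Num.max 0 (2 - `|y ord0 (lift ord0 ord0) - Num.sqrt (y ord0 ord0)| / h).
have [_ _ _ L1] := hu.
have V0 s y : 0 <= V s y.
  by rewrite /V qE addr_ge0 ?expR_ge0// mulr_ge0 ?expR_ge0 ?ltW.
suff H : forall eps, 0 < eps -> u t x <= m.+2%:R * delta + V t x + eps.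
  by rewrite addrA -(qE t x) -addrA -/(V t x); exact/ler_addgt0Pr.
move=> eps eps0.
have [] := @grid_avg_comparison _ _ u (\1_(@U12 R m.+2)) u g V (fun _ _ => 1) 1 1 0 delta 1 t
  (maxn n0 1) L1 _ delta0 _ _ _ _ _ _ _ _ _ _ _ _ t x eps _ _ eps0 => //.
- by move=> q q0; exact: (solution_continuous hu).
- move=> y; apply: continuous_at_add; first by cont.
  apply: continuous_at_max; first by cont.
  apply: continuous_at_add; first by cont.
  apply: continuous_at_opp; apply: continuous_at_mul; last by cont.
  apply: (@continuous_comp _ _ _ (fun y : 'rV[R]_m.+2 =>
    y ord0 (lift ord0 ord0) - Num.sqrt (y ord0 ord0))); last exact: norm_continuous.
  apply: continuous_at_add; first by cont.
  apply: continuous_at_opp.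
  apply: (@continuous_comp _ _ _ (fun y : 'rV[R]_m.+2 => y ord0 ord0)); first by cont.
  exact: sqrt_continuous.
- by move=> s y s0; case/andP: (u01 s y s0).
- move=> s y s0; have [b [k [ju bE]]] := solution_jet hu y s0.
  exists u, b, k; split=> //; rewrite bE lerD2l mul1r (logistic_solution hu (indic01 _))//.
  by have := u01 s y s0 => /andP[? ?]; nra.
- move=> s y s0; apply: le_trans (ler_norm _); rewrite lerD2l lerN2 indicE.
  have e2 := expR_ge0 (- dot e y + (M + 1)).
  have m0 : 0 <= Num.max 0 (2 - `|y ord0 (lift ord0 ord0) - Num.sqrt (y ord0 ord0)| / h).
    by rewrite le_max lexx.
  case: (boolP (y \in _)) => [|_]; last by rewrite addr_ge0.
  rewrite -[true%:R]/(1 : R) inE => /(U12_cover e1 e0 M0)[ey|ythin].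
    by apply: ler_wpDr => //; rewrite -[leLHS]expR0 ler_expR; lra.
  apply: ler_wpDl => //; rewrite le_max; apply/orP; right.
  by rewrite lerBrDl -lerBrDr ler_pdivrMr// (_ : 2 - 1 = 1) ?mul1r//; lra.
- by move=> q; rewrite /V /quad_barrier; cont.
- by move=> q; cont.
- by move=> s y _ _; rewrite oppr0.
- move=> s y s0 _.
  have := jetD (exp_wave_jet e a s y) (quad_barrier_jet 1 B0 0 0 s y).
  set b := _ + _ => jV; eexists _, _; split; first exact: jV.
  rewrite big_split /= mul0r mulr0 sumr_const mul0rn addr0.
  rewrite -mulr_suml (_ : \sum_(_ < _) _ = 1); last first.
    by rewrite -(expr1n _ 2) -e1 sqr_enorm; apply: eq_bigr => i _; rewrite expr2.
  by rewrite /b /V; lra.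
- by move=> s y _ /eqP; rewrite oner_eq0.
- move=> s y n /andP[s0 _] nn _.
  have np : (0 < n)%N by apply: leq_trans nn; rewrite leq_max orbT.
  have nn0 : (n0 <= n)%N by apply: leq_trans nn; rewrite leq_max leqnn.
  rewrite /g grid_avgD; apply: lerD.
    rewrite -[leRHS](grid_avg_cst delta _ y np); apply: ler_grid_avg => p pg.
    rewrite ler_expR dotDr.
    have := dot_le_enorm (- e) p; rewrite dotNl enormN e1 mul1r.
    have : enorm p <= m.+2%:R * delta.
      apply: (le_trans (ler_enorm_norm _)); apply: ler_wpM2l => //.
      apply: ler_norm_coord => [|i]; first exact: ltW.
      by have /andP[p0 pd] := mem_grid i delta0 np pg; rewrite ger0_norm// ltW.
    rewrite /a; lra.
  apply: (le_trans (grid_avg_tube y _ h0 delta0 np)).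
  rewrite qE; apply: (@le_trans _ _ B0); last first.
    by rewrite ler_peMl ?(ltW B00)// -expR0 ler_expR ltW.
  have : n%:R^-1 <= h.
    rewrite -[h]invrK lef_pV2 ?posrE ?ltr0n ?invr_gt0//.
    by apply: (le_trans (ltW Hn0)); rewrite ler_nat.
  rewrite /B0 mulrDr; have -> : 4 * h / delta = h * (8 / delta) / 2 by field; rewrite gt_eqF.
  lra.
- by rewrite t0 lexx.
move=> n [_ np H].
(* From the average back to the point value, at the cost of the Lipschitz term. *)
rewrite -addrA; apply: (@le_trans _ _ (m.+2%:R * delta + grid_avg delta n (u t) x)); last first.
  by rewrite lerD2l.
rewrite -lerBlDl -[leLHS](grid_avg_cst delta _ x np); apply: ler_grid_avg => p pg.
rewrite lerBlDr; apply: (solution_lipschitz hu (indic01 _)) => // i.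
by have /andP[-> /ltW->] := mem_grid i delta0 np pg.
Qed.

(** The parameter [delta] is fixed by [eta], and M = (c - 2) t / 2 grows linearly: the wave still
    decays like exp(-(c - 2) t / 2), and exp(t - M^4 / 2) tends to 0. *)
Lemma solution_decay (c eta : R) : 2 < c -> 0 < eta -> exists2 T : R, 1 <= T &
  forall t x, T <= t -> c * t <= ray_dist x -> u t x <= eta.
Proof.
move=> c2 eta0.
pose N : R := m.+2%:R; have N0 : 0 < N by rewrite ltr0n.
pose delta := Num.min 2 (eta / (2 * N)).
have delta0 : 0 < delta by rewrite lt_min ltr0n /= divr_gt0// mulr_gt0.
have dN : N * delta <= eta / 2.
  apply: (@le_trans _ _ (N * (eta / (2 * N)))); first by rewrite ler_pM2l// ge_min lexx orbT.
  by rewrite le_eqVlt; apply/orP; left; apply/eqP; field; rewrite gt_eqF.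
pose eps := c - 2; have eps0 : 0 < eps by rewrite subr_gt0.
pose kap := (eps / 2) ^+ 4 / 2.
have kap0 : 0 < kap by rewrite divr_gt0// exprn_gt0// divr_gt0.
pose D := 8 / delta + 2; have D0 : 0 < D by rewrite addr_gt0// divr_gt0.
have expV (a : R) : 0 < a -> expR (- a) <= a^-1.
  move=> a0; rewrite expRN lef_pV2 ?posrE ?expR_gt0//.
  by apply: le_trans (expR_ge1Dx a); rewrite lerDr.
have h1 : 0 < 2 / kap by rewrite divr_gt0.
have h2 : 0 < 4 * D / eta by rewrite divr_gt0// mulr_gt0.
have h3 : 0 < 2 / eps * (4 / eta + 1 + N * delta).
  have h4 : 0 < 4 / eta by rewrite divr_gt0.
  have h5 : 0 < N * delta by rewrite mulr_gt0.
  by rewrite mulr_gt0 ?divr_gt0//; lra.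
exists (2 + 2 / kap + 4 * D / eta + 2 / eps * (4 / eta + 1 + N * delta)) => [|t x tT xc].
  by lra.
have t1 : 1 < t by lra.
have xd : 0 < ray_dist x by apply: lt_le_trans xc; rewrite mulr_gt0; lra.
(* The direction from the nearest point of the half-line to x; it satisfies e.x = ray_dist x. *)
pose e := (ray_dist x)^-1 *: (x - ray_proj x).
have e1 : enorm e = 1.
  by rewrite /e enormZ ger0_norm ?invr_ge0 ?ray_dist_ge0// mulVf// gt_eqF.
have e0 : dot e axis <= 0.
  rewrite /e dotZl; apply: mulr_ge0_le0; first by rewrite invr_ge0 ray_dist_ge0.
  rewrite dot_axis !mxE eqxx mulr1; case: (leP 0 (x ord0 ord0)) => ?; lra.
have ex : dot e x = ray_dist x.
  by rewrite /e dotZl ray_dist_sqr expr2 mulKf// gt_eqF.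
pose M := eps / 2 * t.
have M0 : 0 <= M by rewrite mulr_ge0 ?divr_ge0// ltW//; lra.
apply: le_trans (solution_upper x e1 e0 M0 (delta := delta) _ t1) _.
  by rewrite delta0 ge_min lexx.
rewrite ex -/N -/D.
have b1 : expR (2 * t - ray_dist x + (M + 1 + N * delta)) <= eta / 4.
  have -> : eta / 4 = (4 / eta)^-1 by rewrite invf_div.
  apply: le_trans (expV (4 / eta) _); last by rewrite divr_gt0.
  rewrite ler_expR.
  have : 2 / eps * (4 / eta + 1 + N * delta) <= t by lra.
  rewrite mulrAC ler_pdivrMr// => H.
  have : c * t = 2 * t + eps * t by rewrite /eps; ring.
  have : M = eps * t / 2 by rewrite /M; ring.
  lra.
have b2 : expR t * (expR (- (M ^+ 4 / 2)) * D) <= eta / 4.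
  rewrite mulrA -expRD -ler_pdivlMr//.
  have -> : eta / 4 / D = (4 * D / eta)^-1 by field; rewrite !gt_eqF.
  apply: le_trans (expV (4 * D / eta) _); last by rewrite divr_gt0// mulr_gt0.
  rewrite ler_expR.
  have -> : M ^+ 4 / 2 = kap * t * t ^+ 3 by rewrite /M /kap; field.
  have k2 : 2 <= kap * t by rewrite mulrC -ler_pdivrMr//; lra.
  have t3 : t <= t ^+ 3 by rewrite -{1}(expr1 t) ler_eXn2l// ltW.
  have : 2 * t <= kap * t * t ^+ 3 by apply: ler_pM => //; lra.
  lra.
lra.
Qed.

End upper_bound.

(** * Distances to sets and to frontiers *)

Section distances.
Context {R : realType} {N : nat}.
Implicit Types (x y : 'rV[R]_N) (A B : set 'rV[R]_N) (r : R).

Lemma dist_ge x B r : (forall y, B y -> r <= enorm (y - x)) -> (r%:E <= dist x B)%E.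
Proof. by move=> H; apply: le_ereal_inf_tmp => _ [y By <-]; rewrite lee_fin; exact: H. Qed.

Lemma dist_le x y B : B y -> (dist x B <= (enorm (y - x))%:E)%E.
Proof. by move=> By; apply: ereal_inf_lbound; exists y. Qed.

Lemma dist_ge0 x B : (0 <= dist x B)%E.
Proof. by apply: dist_ge => y _; exact: enorm_ge0. Qed.

Lemma dist_mem x B : B x -> dist x B = 0%E.
Proof.
move=> Bx; apply/eqP; rewrite eq_le dist_ge0 andbT.
by apply: (le_trans (dist_le x Bx)); rewrite subrr enorm0.
Qed.

Lemma dist_ltP x B r : (dist x B < r%:E)%E -> exists2 y, B y & enorm (y - x) < r.
Proof. by move=> /ereal_inf_lt[_ [y By <-]]; rewrite lte_fin => yr; exists y. Qed.

Lemma hausdorff_ge0 A B : (0 <= hausdorff A B)%E.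
Proof. by rewrite /hausdorff le_max lexx. Qed.

Lemma dist_le_hausdorff A B x : A x -> (dist x B <= hausdorff A B)%E.
Proof.
move=> Ax; rewrite /hausdorff !le_max; apply/orP; right; apply/orP; left.
by apply: ereal_sup_ubound; exists x.
Qed.

Lemma dist_le_hausdorffr A B y : B y -> (dist y A <= hausdorff A B)%E.
Proof.
move=> By; rewrite /hausdorff !le_max; apply/orP; right; apply/orP; right.
by apply: ereal_sup_ubound; exists y.
Qed.

Lemma hausdorff_le A B r : 0 <= r ->
  (forall x, A x -> exists2 y, B y & enorm (y - x) <= r) ->
  (forall y, B y -> exists2 x, A x & enorm (x - y) <= r) ->
  (hausdorff A B <= r%:E)%E.
Proof.
move=> r0 AB BA; rewrite /hausdorff !ge_max lee_fin r0 /=; apply/andP; split.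
  apply: ge_ereal_sup => _ [x Ax <-]; have [y By yx] := AB x Ax.
  by apply: (le_trans (dist_le x By)); rewrite lee_fin.
apply: ge_ereal_sup => _ [y By <-]; have [x Ax xy] := BA y By.
by apply: (le_trans (dist_le y Ax)); rewrite lee_fin.
Qed.

Lemma nbhs_enorm x r : 0 < r -> \forall y \near x, enorm (y - x) < r.
Proof.
move=> r0; have cx : continuous_at x (fun y => enorm (y - x)) by cont.
by apply: (cvgr_lt _ cx); rewrite subrr enorm0.
Qed.

(** The frontier point is at the supremum of the parameters whose points on the segment lie in
    [A]. *)
Lemma frontier_segment A x y : A x -> ~ A y ->
  exists2 s : R, 0 <= s <= 1 & frontier A (x + s *: (y - x)).
Proof.
move=> Ax Ay; pose f (s : R) := x + s *: (y - x).
pose S := [set s : R | 0 <= s <= 1 /\ A (f s)].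
have cf s : continuous_at s f by rewrite /f; cont.
have S0 : S 0 by split; [rewrite lexx ler01|rewrite /f scale0r addr0].
have S1 : ubound S 1 by move=> s [/andP[]].
have hS : has_sup S by split; [exists 0|exists 1].
have s0 : 0 <= sup S by apply: ub_le_sup => //; exists 1.
have s1 : sup S <= 1 by apply: ge_sup => //; exists 0.
exists (sup S); first by rewrite s0.
split.
  move=> V Vz; have : \forall s \near sup S, V (f s) by exact: (cf (sup S)).
  move=> /nbhs_ballP[e /= e0 He].
  have [s [s01 As] sS] := sup_adherent e0 hS.
  exists (f s); split=> //; apply: He; rewrite /ball /= ger0_norm.
    by rewrite ltrBlDr addrC -ltrBlDr.
  by rewrite subr_ge0; apply: ub_le_sup => //; exists 1.
move=> Az; have : \forall s \near sup S, A (f s) by exact: (cf (sup S)).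
move=> /nbhs_ballP[e /= e0 He].
have fy : f 1 = y by rewrite /f scale1r subrKC.
have sS1 : sup S < 1.
  rewrite lt_neqAle s1 andbT; apply/eqP => E; apply: Ay; rewrite -fy -E.
  by apply: He; exact: ballxx.
pose s := Num.min 1 (sup S + e / 2).
have ss : sup S < s by rewrite lt_min sS1 ltrDl divr_gt0.
have : S s.
  split; first by rewrite (le_trans s0 (ltW ss))/= ge_min lexx.
  apply: He; rewrite /ball /= distrC ger0_norm ?subr_ge0 ?(ltW ss)//.
  by rewrite ltrBlDl gt_min; apply/orP; right; lra.
move=> Ss; have : s <= sup S by apply: ub_le_sup => //; exists 1.
by rewrite leNgt ss.
Qed.

Lemma dist_frontier_le A x y : A x -> ~ A y -> (dist x (frontier A) <= (enorm (y - x))%:E)%E.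
Proof.
move=> Ax Ay; have [s /andP[s0 s1] Fs] := frontier_segment Ax Ay.
apply: (le_trans (dist_le x Fs)).
by rewrite lee_fin addrAC subrr add0r enormZ ger0_norm// ler_piMl ?enorm_ge0.
Qed.

End distances.

(** * Erosions, directions and speeds of U *)

Section tube_directions.
Context {R : realType} {m : nat}.
Implicit Types (x y e xi : 'rV[R]_m.+2) (r s t tau rho : R).

Local Notation U := (@U12 R m.+2).
Local Notation ax := (@axis R m).
Local Notation ax2 := (@axis2 R m).

Lemma enorm_axis : enorm ax = 1.
Proof. by rewrite /enorm axis_axis sqrtr1. Qed.

Lemma enorm_axis2 : enorm ax2 = 1.
Proof. by rewrite /enorm axis2_axis2 sqrtr1. Qed.

Lemma ray_U12 s : 0 <= s -> U (s *: ax).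
Proof.
move=> s0; left; apply/U1_axis; rewrite !mxE !eqxx mulr1; split=> //.
by rewrite subrr enorm0.
Qed.

Lemma ball_U12 s y : 1 <= s -> enorm (y - s *: ax) < 1 -> U y.
Proof.
move=> s1 ys; have := unit_ball_U12 s1 ys; rewrite indicE.
by case: (boolP (y \in U)) => [|_ /eqP]; [rewrite inE|rewrite eq_sym oner_eq0].
Qed.

Lemma ball_U12_interior s y : 1 <= s -> enorm (y - s *: ax) < 1 -> (U°)%classic y.
Proof.
move=> s1 ys; have r0 : 0 < 1 - enorm (y - s *: ax) by rewrite subr_gt0.
have := nbhs_enorm y r0; apply: filterS => z zy; apply: (ball_U12 s1).
by apply: le_lt_trans (ler_enormB _ y _) _; rewrite -ltrBrDr.
Qed.

Lemma axis_erosion rho s : rho <= 1 -> 1 <= s -> erosion rho U (s *: ax).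
Proof.
move=> rho1 s1; split; first by apply: ray_U12; lra.
apply: (@le_trans _ _ 1%:E); first by rewrite lee_fin.
apply: dist_ge => z [_ zU]; rewrite leNgt; apply/negP => zs; apply: zU.
exact: (ball_U12_interior s1).
Qed.

(** Far along the axis, a point of the tube outside the cylinder leaves U when moved by rho / 2
    along [axis2], so it is too close to the frontier. *)
Lemma erosion_thin rho : 0 < rho -> exists Y : R, forall y, erosion rho U y ->
  y ord0 ord0 <= Y \/ ray_dist y <= 1.
Proof.
(* Beyond 8 / rho, the radius exp(-y_1^2 / 2) <= 2 / y_1 is less than rho / 4. *)
move=> rho0; exists (1 + 8 / rho) => y [Uy Fy].
have y0 := U12_coord0 Uy.
have [yY|yY] := lerP (y ord0 ord0) (1 + 8 / rho); [by left|right].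
have r8 : 0 < 8 / rho by rewrite divr_gt0.
case: (Uy) => [/U1_axis[_ y1]|/U2_near_curve[_ _ ythin]].
  exact: (le_trans (ray_dist_le y y0)).
apply: (le_trans (ray_dist_le y y0)).
set w := y - _; rewrite leNgt; apply/negP => w1.
set s := Num.sqrt _ in ythin; set h := expR _ in ythin.
have s1 : 1 <= s by rewrite -sqrtr1 ler_wsqrtr//; lra.
have h0 : 0 < h by exact: expR_gt0.
have h1 : h <= 1 by rewrite -expR0 ler_expR oppr_le0 divr_ge0 ?sqr_ge0.
have hrho : h < rho / 4.
  have Y0 : 0 < y ord0 ord0 by lra.
  apply: (@le_lt_trans _ _ (2 / y ord0 ord0)).
    rewrite /h expRN -[2 / _]invf_div lef_pV2 ?posrE ?expR_gt0//; last by rewrite divr_gt0.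
    apply: le_trans (expR_ge1Dx _); have : y ord0 ord0 / 2 <= y ord0 ord0 ^+ 2 / 2.
      by rewrite ler_pM2r ?invr_gt0// expr2 ler_peMl//; lra.
    lra.
  rewrite ltr_pdivrMr// mulrAC ltr_pdivlMr//.
  have : 8 / rho * rho < y ord0 ord0 * rho by rewrite ltr_pM2r//; lra.
  by rewrite divfK ?gt_eqF//; lra.
(* Hence moving in the direction [axis2] leads away from the axis and cannot enter the cylinder. *)
have y1 : 0 <= y ord0 (lift ord0 ord0).
  by move: ythin; rewrite ler_norml => /andP[+ _]; lra.
pose z := y + (rho / 2) *: ax2.
have z0 : z ord0 ord0 = y ord0 ord0 by rewrite !mxE /= mulr0 addr0.
have z1 : z ord0 (lift ord0 ord0) = y ord0 (lift ord0 ord0) + rho / 2.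
  by rewrite !mxE /= mulr1.
have zU : ~ U z.
  case=> [/U1_axis[_]|/U2_near_curve[_ _]].
    rewrite z0; have -> : z - y ord0 ord0 *: ax = w + (rho / 2) *: ax2.
      by rewrite /z /w addrAC.
    apply/negP; rewrite -ltNge; apply: (lt_le_trans w1).
    apply: enorm_le; first exact: enorm_ge0.
    have -> : w + (rho / 2) *: ax2 = w - (- (rho / 2)) *: ax2 by rewrite scaleNr opprK.
    rewrite sqr_enorm dot_sub_axis2.
    have -> : w ord0 (lift ord0 ord0) = y ord0 (lift ord0 ord0).
      by rewrite !mxE /= mulr0 subr0.
    by have := sqr_ge0 (rho / 2); nra.
  rewrite z0 z1 -/s -/h; apply/negP; rewrite -ltNge.
  move: ythin; rewrite ler_norml => /andP[h2 _].
  by apply: lt_le_trans (ler_norm _); lra.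
have := le_trans Fy (dist_frontier_le Uy zU).
rewrite lee_fin /z addrAC subrr add0r enormZ enorm_axis2 mulr1 ger0_norm; lra.
Qed.

Lemma not_condD rho : 0 < rho -> ~ condD rho U.
Proof.
move=> rho0; rewrite /condD => fin.
have [Y HY] := erosion_thin rho0.
have hf : hausdorff U (erosion rho U) \is a fin_num.
  by rewrite ge0_fin_numE// hausdorff_ge0.
pose M := fine (hausdorff U (erosion rho U)).
have M0 : 0 <= M by apply: fine_ge0; exact: hausdorff_ge0.
(* A point of the erosion is then at distance at least M + 1 from the curve point: along the axis if
   its first coordinate is at most [Y], transversally if it lies in the cylinder. *)
pose s := (M + 2) ^+ 2 + `|Y| + M + 1.
have s0 : 0 <= s by rewrite /s !addr_ge0// sqr_ge0.
have sM : M + 2 <= Num.sqrt s.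
  rewrite -[leLHS]ger0_norm; last by lra.
  rewrite -sqrtr_sqr ler_wsqrtr// /s -!addrA lerDl !addr_ge0//; lra.
have : (dist (s *: ax + Num.sqrt s *: ax2) (erosion rho U) <= M%:E)%E.
  by rewrite fineK//; apply: dist_le_hausdorff; exact: curve_U12.
apply/negP; rewrite -ltNge; apply: (@lt_le_trans _ _ (M + 1)%:E).
  by rewrite lte_fin ltrDl.
apply: dist_ge => y /HY[yY|yr].
  have := ler_coord_enorm (y - (s *: ax + Num.sqrt s *: ax2)) ord0.
  have -> : (y - (s *: ax + Num.sqrt s *: ax2)) ord0 ord0 = y ord0 ord0 - s.
    by rewrite !mxE /= mulr1 mulr0 addr0.
  rewrite distrC => H; apply: le_trans H; apply: le_trans (ler_norm _).
  by have := ler_norm Y; have := sqr_ge0 (M + 2); rewrite /s; lra.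
have := ray_dist_lip (s *: ax + Num.sqrt s *: ax2) y.
by rewrite curve_ray_dist// enormBC; lra.
Qed.

Lemma ray_dist_unit xi : enorm xi = 1 -> xi <> ax -> 0 < ray_dist xi <= 1.
Proof.
move=> x1 xa; apply/andP; split; last first.
  by have := @ray_dist_le _ _ xi 0 (lexx 0); rewrite scale0r subr0 x1.
rewrite lt_neqAle ray_dist_ge0 andbT eq_sym; apply/eqP => /enorm_eq0/eqP.
rewrite subr_eq0 => /eqP E; apply: xa.
rewrite E /ray_proj in x1 *; move: x1; rewrite enormZ enorm_axis mulr1.
by rewrite ger0_norm ?le_max ?lexx// => ->; rewrite scale1r.
Qed.

(** The point tau xi recedes linearly from the half-line, while U at height at most 2 tau has width
    of order sqrt tau. *)
Lemma dist_direction xi : enorm xi = 1 -> xi <> ax -> exists T : R, 0 < T /\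
  forall tau, T <= tau -> ((ray_dist xi / 2 * tau)%:E <= dist (tau *: xi) U)%E.
Proof.
move=> x1 xa; have /andP[d0 d1] := ray_dist_unit x1 xa; set d := ray_dist xi in d0 d1 *.
exists (32 / d ^+ 2 + 4 / d); split.
  by rewrite addr_gt0// divr_gt0// exprn_gt0.
have T1 : 0 < 4 / d by rewrite divr_gt0.
have T2 : 0 < 32 / d ^+ 2 by rewrite divr_gt0// exprn_gt0.
move=> tau tT; have tau0 : 0 < tau by lra.
apply: dist_ge => y Uy; have y0 := U12_coord0 Uy.
(* A point farther than tau satisfies the bound since ray_dist xi <= 1; the others have y_1 <= 2
   tau. *)
have [yt|yt] := lerP tau (enorm (y - tau *: xi)); first by apply: le_trans yt; nra.
have yy : y ord0 ord0 <= 2 * tau.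
  have := ler_coord_enorm y ord0.
  have := ler_enormD (y - tau *: xi) (tau *: xi); rewrite subrK enormZ x1 mulr1.
  rewrite (ger0_norm (ltW tau0)); have := ler_norm (y ord0 ord0); lra.
have := ray_dist_lip (tau *: xi) y; rewrite ray_distZ ?(ltW tau0)// -/d enormBC.
have := U12_ray_dist Uy.
have : Num.sqrt (y ord0 ord0) <= d * tau / 4.
  have dt0 : 0 <= d * tau / 4 by rewrite divr_ge0// mulr_ge0// ltW.
  rewrite -[leRHS]ger0_norm// -sqrtr_sqr ler_wsqrtr//.
  apply: (le_trans yy).
  have : 32 / d ^+ 2 <= tau by lra.
  rewrite ler_pdivrMr ?exprn_gt0// => H.
  have : tau * 32 <= tau * (tau * d ^+ 2) by rewrite ler_pM2l.
  lra.
have : 4 / d <= tau by lra.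
rewrite ler_pdivrMr// => H; lra.
Qed.

Lemma unbounded_dirs_U12 xi : unbounded_dirs U xi <-> xi = ax.
Proof.
split=> [[x1 xl]|->]; last first.
  split; first exact: enorm_axis.
  apply: (cvg_trans _ (@cvg_cst _ 0%E _ (pinfty_nbhs R) _)).
  apply: near_eq_cvg; near=> tau.
  rewrite dist_mem ?mul0e//; apply: ray_U12; near: tau; exact: nbhs_pinfty_ge.
apply: contrapT => xa; have /andP[d0 _] := ray_dist_unit x1 xa.
have [T [T0 HT]] := dist_direction x1 xa.
have : \forall tau \near +oo, (dist (tau *: xi) U * (tau^-1)%:E < (ray_dist xi / 2)%:E)%E.
  apply: (xl [set y | (y < (ray_dist xi / 2)%:E)%E]).
  apply: open_nbhs_nbhs; split; first exact: open_ereal_lt_ereal.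
  by rewrite /= lte_fin divr_gt0.
move=> H; have [tau [tT]] : exists tau : R, T <= tau /\
    (dist (tau *: xi) U * (tau^-1)%:E < (ray_dist xi / 2)%:E)%E.
  near (pinfty_nbhs R) => tau; exists tau; split; last by near: tau.
  by near: tau; apply: nbhs_pinfty_ge; exact: num_real.
apply/negP; rewrite -leNgt.
have tau0 : 0 < tau by exact: lt_le_trans tT.
apply: (@le_trans _ _ ((ray_dist xi / 2 * tau)%:E * (tau^-1)%:E)%E).
  by rewrite -EFinM mulfK ?gt_eqF.
by rewrite lee_pmul2r ?HT// lte_fin invr_gt0.
Unshelve. all: by end_near. Qed.

Lemma condG_U12 rho : 0 < rho <= 1 -> condG rho U.
Proof.
move=> /andP[rho0 rho1]; apply/seteqP; split=> [xi [[]|[]]//|xi x1].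
have [->|xa] := pselect (xi = ax).
  right; split; first exact: enorm_axis.
  apply: (cvg_trans _ (@cvg_cst _ 0%E _ (pinfty_nbhs R) _)).
  apply: near_eq_cvg; near=> tau.
  by rewrite dist_mem ?mul0e//; apply: axis_erosion.
left; split=> //; have /andP[d0 _] := ray_dist_unit x1 xa.
have [T [T0 HT]] := dist_direction x1 xa.
rewrite limf_einfE.
apply: (@lt_le_trans _ _ (ray_dist xi / 2)%:E); first by rewrite lte_fin divr_gt0.
apply: le_trans (ereal_sup_ubound _); last first.
  exists [set tau | T <= tau] => //; apply: nbhs_pinfty_ge; exact: num_real.
apply: le_ereal_inf_tmp => _ [tau /= tT <-].
have tau0 : 0 < tau by exact: lt_le_trans tT.
apply: (@le_trans _ _ ((ray_dist xi / 2 * tau)%:E * (tau^-1)%:E)%E).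
  by rewrite -EFinM mulfK ?gt_eqF.
by rewrite lee_pmul2r ?HT// lte_fin invr_gt0.
Unshelve. all: by end_near. Qed.

Lemma speed_axis : speed U ax = +oo%E.
Proof. by rewrite /speed; case: asboolP => // -[]; exact/unbounded_dirs_U12. Qed.

(** [ray_dist e] is the sine of the angle between e and the axis if that angle is at most a right
    one, and 1 otherwise, so both finite cases of [speed] have the same form. *)
Lemma speed_U12 e : enorm e = 1 -> e <> ax -> speed U e = (2 / ray_dist e)%:E.
Proof.
move=> e1 ea; rewrite /speed; case: asboolP => [/unbounded_dirs_U12//|_].
have de : dot ax e = e ord0 ord0 by rewrite dotC dot_axis.
case: asboolP => [F0|F0].
  have e0 : e ord0 ord0 < 0.
    rewrite ltNge; apply/negP => e0.
    suff : facing_dirs U e ax by rewrite F0.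
    by split; [exact/unbounded_dirs_U12|rewrite de].
  by rewrite /ray_dist /ray_proj max_l ?(ltW e0)// scale0r subr0 e1 divr1.
have e0 : 0 <= e ord0 ord0.
  rewrite leNgt; apply/negP => e0; apply: F0; apply/seteqP; split=> // xi [/unbounded_dirs_U12->].
  by rewrite de leNgt e0.
have -> : facing_dirs U e = [set ax].
  apply/seteqP; split=> [xi [/unbounded_dirs_U12->]//|xi ->].
  by split; [exact/unbounded_dirs_U12|rewrite de].
rewrite image_set1 ereal_sup1 /cstar de; congr (_ / _)%:E.
rewrite /ray_dist /enorm /ray_proj max_r// dot_sub_axis -sqr_enorm e1.
by congr Num.sqrt; ring.
Qed.

Lemma wulff_U12 x : wulff U x <-> ray_dist x < 2.
Proof.
split=> [[e [r [e1 r0 + ->]]]|x2].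
  rewrite ray_distZ//; have [->|ea] := pselect (e = ax).
    by rewrite /ray_dist /ray_proj !mxE !eqxx max_r// scale1r subrr enorm0 mulr0.
  have /andP[d0 _] := ray_dist_unit e1 ea.
  by rewrite speed_U12// lte_fin ltr_pdivlMr.
have [->|x0] := eqVneq x 0.
  exists ax, 0; split=> //; [exact: enorm_axis|by rewrite speed_axis ltry|by rewrite scale0r].
have xn : 0 < enorm x.
  rewrite lt_neqAle enorm_ge0 andbT eq_sym; apply/eqP => /enorm_eq0 E.
  by rewrite E eqxx in x0.
pose e := (enorm x)^-1 *: x.
have e1 : enorm e = 1 by rewrite /e enormZ ger0_norm ?invr_ge0 ?enorm_ge0// mulVf// gt_eqF.
exists e, (enorm x); split; [exact: e1|exact: ltW| |]; last first.
  by rewrite /e scalerA divff ?scale1r// gt_eqF.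
have [->|ea] := pselect (e = ax); first by rewrite speed_axis ltry.
have /andP[d0 _] := ray_dist_unit e1 ea.
rewrite speed_U12// lte_fin ltr_pdivlMr// -ray_distZ ?enorm_ge0//.
by rewrite /e scalerA divff ?scale1r// gt_eqF.
Qed.

End tube_directions.

(** * Asymptotic properties of the solution *)

Section asymptotics.
Context {R : realType} {m : nat}.
Implicit Types (x y e : 'rV[R]_m.+2) (c t r s lam theta : R).

Local Notation U := (@U12 R m.+2).
Local Notation ax := (@axis R m).
Local Notation ax2 := (@axis2 R m).

Lemma cvg_pinftyP (f : R -> R) (l : R) :
  (forall eps, 0 < eps -> exists T : R, forall t, T <= t -> l - eps <= f t <= l + eps) ->
  f t @[t --> +oo] --> l.
Proof.
move=> H; apply/cvgrPdist_le => eps eps0; have [T HT] := H eps eps0.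
near=> t; have /andP[? ?] : l - eps <= f t <= l + eps.
  by apply: HT; near: t; apply: nbhs_pinfty_ge; exact: num_real.
by rewrite ler_distlC; apply/andP; split; lra.
Unshelve. all: by end_near. Qed.

Lemma cvge_pinftyP (f : R -> \bar R) (l : R) :
  (forall eps, 0 < eps -> exists T : R, forall t, T <= t ->
     ((l - eps)%:E <= f t <= (l + eps)%:E)%E) ->
  f t @[t --> +oo] --> l%:E.
Proof.
move=> H.
have fin t eps : ((l - eps)%:E <= f t <= (l + eps)%:E)%E -> f t \is a fin_num.
  by move=> /andP[h1 h2]; rewrite fin_numElt (lt_le_trans _ h1) ?ltNyr// (le_lt_trans h2) ?ltry.
apply/fine_cvgP; split.
  have [T HT] := H 1 ltr01; near=> t; apply: (fin t 1); apply: HT.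
  by near: t; apply: nbhs_pinfty_ge; exact: num_real.
apply: cvg_pinftyP => eps eps0; have [T HT] := H eps eps0; exists T => t tT.
have h := HT t tT; have ft := fin _ _ h; move: h.
by rewrite -{1 2}(fineK ft) !lee_fin.
Unshelve. all: by end_near. Qed.

(* Contraction towards the ray with ray_proj as fixed foot point, so that it moves x by
   theta * ray_dist x even when x is far from the origin. *)
Definition shrink theta x : 'rV[R]_m.+2 := x - theta *: (x - ray_proj x).

Lemma ray_proj_shrink theta x : 0 <= theta <= 1 -> ray_proj (shrink theta x) = ray_proj x.
Proof.
move=> /andP[t0 t1]; rewrite /ray_proj; congr (_ *: _).
rewrite !mxE !eqxx mulr1; case: (leP 0 (x ord0 ord0)) => x0.
  by rewrite subrr mulr0 subr0 max_r.
by rewrite subr0 max_l//; nra.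
Qed.

Lemma ray_dist_shrink theta x : 0 <= theta <= 1 ->
  ray_dist (shrink theta x) = (1 - theta) * ray_dist x.
Proof.
move=> t01; rewrite /ray_dist ray_proj_shrink// /shrink addrAC -{1}[x - _]scale1r.
rewrite -scalerBl enormZ ger0_norm// subr_ge0; by case/andP: t01.
Qed.

Lemma enorm_shrinkB theta x : 0 <= theta -> enorm (shrink theta x - x) = theta * ray_dist x.
Proof. by move=> t0; rewrite /shrink addrAC subrr add0r enormN enormZ ger0_norm. Qed.

Lemma enorm_shrink theta x : 0 <= theta <= 1 -> enorm (shrink theta x) <= enorm x.
Proof.
move=> /andP[t0 t1]; apply: enorm_le; first exact: enorm_ge0.
rewrite sqr_enorm /shrink; set z := x - ray_proj x.
rewrite dotDl !dotDr !dotNl !dotNr !dotZl !dotZr (dotC x z) ray_dist_sqr.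
rewrite -(sqr_enorm z) -/(ray_dist x).
have := sqr_ge0 (ray_dist x); nra.
Qed.

Lemma nbhs_scale x V : nbhs x V -> exists2 s : R, 0 <= s < 1 & V (s *: x).
Proof.
move=> Vx; have cf : continuous_at (1 : R) (fun s : R => s *: x) by cont.
have : \forall s \near (1 : R), V (s *: x) by apply: cf; rewrite /= scale1r.
move=> /nbhs_ballP[d /= d0 Hd].
have [m0 m1] : 0 < Num.min 1 (d / 2) /\ Num.min 1 (d / 2) <= 1.
  by rewrite lt_min ltr01 divr_gt0//= ge_min lexx.
have md : Num.min 1 (d / 2) <= d / 2 by rewrite ge_min lexx orbT.
exists (1 - Num.min 1 (d / 2)); first by apply/andP; split; lra.
by apply: Hd; rewrite /ball /= subKr ger0_norm; lra.
Qed.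

Lemma closure_eball r : 0 < r -> closure (eball r) = [set x : 'rV[R]_m.+2 | enorm x <= r].
Proof.
move=> r0; apply/seteqP; split=> x.
  move=> cx /=; rewrite leNgt; apply/negP => rx.
  have e0 : 0 < enorm x - r by rewrite subr_gt0.
  have [y [/= yr xy]] := cx _ (nbhs_enorm x e0).
  by have := ler_enormB x y 0; rewrite !subr0 enormBC; rewrite /eball /= in yr; lra.
move=> /= xr V /nbhs_scale[s /andP[s0 s1] Vs]; exists (s *: x); split=> //.
by rewrite /eball /= enormZ ger0_norm//; have := enorm_ge0 x; nra.
Qed.

Lemma closure_wulff x : ray_dist x <= 2 -> closure (wulff U) x.
Proof.
move=> x2 V /nbhs_scale[s /andP[s0 s1] Vs]; exists (s *: x); split=> //.
by apply/wulff_U12; rewrite ray_distZ//; have := ray_dist_ge0 x; nra.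
Qed.

Lemma continuous_ray_dist : continuous (@ray_dist R m).
Proof. by move=> x; rewrite /ray_dist /ray_proj; cont. Qed.

Variable u : R -> 'rV[R]_m.+2 -> R.
Hypothesis hu : bounded_classical_solution logistic (\1_U) u.

Lemma u_ge0 t x : 0 < t -> 0 <= u t x.
Proof. exact: (solution_ge0 hu (indic01 U)). Qed.

Lemma u_le1 t x : 0 < t -> u t x <= 1.
Proof. exact: (solution_le1 hu (indic01 U)). Qed.

(** Spreading starts from the ball centred one unit beyond the foot point of x, which lies in U even
    when the foot point is the origin; the extra unit is absorbed by a larger speed. The maximum
    with 0 admits negative [c]. *)
Lemma solution_growth c lam : c < 2 -> lam < 1 -> exists2 T : R, 1 <= T &
  forall t x, T <= t -> ray_dist x <= c * t -> lam <= u t x.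
Proof.
move=> c2 lam1; pose c1 := (Num.max c 0 + 2) / 2.
have [cm c0 cm2] : [/\ c <= Num.max c 0, 0 <= Num.max c 0 & Num.max c 0 < 2].
  by rewrite !le_max !lexx orbT gt_max c2 ltr0n.
have c1i : 0 <= c1 < 2 by rewrite /c1; apply/andP; split; lra.
have [T T1 HT] := solution_spreading hu (indic01 U) c1i lam1.
have cc : 0 < 2 - Num.max c 0 by lra.
exists (T + 2 / (2 - Num.max c 0)) => [|t x tT xc].
  by rewrite (le_trans T1)// lerDl ltW// divr_gt0.
have d0 : 0 < 2 / (2 - Num.max c 0) by rewrite divr_gt0.
have p1 : 1 <= Num.max 0 (x ord0 ord0) + 1 by rewrite lerDr le_max lexx.
apply: (HT t ((Num.max 0 (x ord0 ord0) + 1) *: ax) x); [lra|exact: unit_ball_U12|].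
have : 2 / (2 - Num.max c 0) <= t by lra.
rewrite ler_pdivrMr// => H.
have -> : x - (Num.max 0 (x ord0 ord0) + 1) *: ax = (x - ray_proj x) - ax.
  by rewrite scalerDl scale1r opprD addrA.
apply: (le_trans (ler_enormD _ _)); rewrite enormN enorm_axis -/(ray_dist x).
have : c * t <= Num.max c 0 * t by rewrite ler_wpM2r//; lra.
rewrite /c1; lra.
Qed.

Lemma speed_lt e c : enorm e = 1 -> 0 <= c -> (c%:E < speed U e)%E -> c * ray_dist e < 2.
Proof.
move=> e1 c0; have [->|ea] := pselect (e = ax).
  by rewrite /ray_dist /ray_proj !mxE !eqxx max_r// scale1r subrr enorm0 mulr0.
have /andP[d0 _] := ray_dist_unit e1 ea.
by rewrite speed_U12// lte_fin ltr_pdivlMr.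
Qed.

Lemma speed_gt e c : enorm e = 1 -> (speed U e < c%:E)%E -> 2 < c * ray_dist e /\ 0 < c.
Proof.
move=> e1; have [->|ea] := pselect (e = ax); first by rewrite speed_axis ltNge leey.
have /andP[d0 _] := ray_dist_unit e1 ea.
rewrite speed_U12// lte_fin ltr_pdivrMr// => ce; split=> //.
by rewrite -(pmulr_lgt0 _ d0); lra.
Qed.

Lemma prop_i_U12 : prop_i U u.
Proof.
move=> e e1; split=> [c c0 /(speed_lt e1 c0) ce|c /(speed_gt e1)[ce c0]].
  apply: cvg_pinftyP => eps eps0.
  have [T T1 HT] := solution_growth ce (lam := 1 - eps) ltac:(lra).
  exists T => t tT; rewrite HT//; last first.
    by rewrite ray_distZ ?mulr_ge0//; [rewrite mulrAC|lra].
  by apply: (le_trans (u_le1 _ _)); lra.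
apply: cvg_pinftyP => eps eps0.
have [T T1 HT] := solution_decay hu ce eps0.
exists T => t tT; have t0 : 0 < t by lra.
rewrite !add0r HT//; last first.
  by rewrite ray_distZ 1?mulrAC// mulr_ge0// ltW.
by rewrite (le_trans _ (u_ge0 _ t0))//; lra.
Qed.

Lemma prop_ii_U12 : prop_ii U u.
Proof.
move=> e e1; split=> [c c0 /(speed_lt e1 c0) ce|c /(speed_gt e1)[ce c0]].
  apply: cvge_pinftyP => eps eps0.
  have [T T1 HT] := solution_growth ce (lam := 1 - eps) ltac:(lra).
  exists T => t tT; have t0 : 0 < t by lra.
  apply/andP; split.
    apply: le_ereal_inf_tmp => _ [s /= + <-]; rewrite in_itv /= => /andP[s0 sc].
    rewrite lee_fin; apply: HT => //; rewrite ray_distZ ?mulr_ge0 ?(ltW t0)//.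
    by rewrite mulrAC ler_pM2r// ler_wpM2r ?ray_dist_ge0.
  apply: (@le_trans _ _ (u t ((0 * t) *: e))%:E).
    by apply: ereal_inf_lbound; exists 0 => //=; rewrite in_itv /= lexx.
  by rewrite lee_fin (le_trans (u_le1 _ t0))//; lra.
apply: cvge_pinftyP => eps eps0.
have [T T1 HT] := solution_decay hu ce eps0.
exists T => t tT; have t0 : 0 < t by lra.
apply/andP; split.
  apply: (@le_trans _ _ (u t ((c * t) *: e))%:E).
    by rewrite lee_fin (le_trans _ (u_ge0 _ t0))//; lra.
  by apply: ereal_sup_ubound; exists c => //=; rewrite in_itv /= lexx.
apply: ge_ereal_sup => _ [s /= + <-]; rewrite in_itv /= andbT => cs.
rewrite lee_fin add0r; apply: HT => //.
have s0 : 0 <= s by lra.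
rewrite ray_distZ ?mulr_ge0 ?(ltW t0)// [s * t * _]mulrAC ler_pM2r//.
by rewrite ler_wpM2r ?ray_dist_ge0.
Qed.

Lemma prop_iii_U12 : prop_iii U u.
Proof.
move=> C cC [x0 Cx0].
have wc : {within C, continuous (@ray_dist R m)}.
  by apply: continuous_subspaceT; exact: continuous_ray_dist.
split=> CW.
  have [z + zmax] := compact_EVT_max (ex_intro _ _ Cx0) cC wc.
  rewrite inE => Cz; have z2 : ray_dist z < 2 by apply/wulff_U12; exact: CW.
  apply: cvge_pinftyP => eps eps0.
  have [T T1 HT] := solution_growth z2 (lam := 1 - eps) ltac:(lra).
  exists T => t tT; have t0 : 0 < t by lra.
  apply/andP; split.
    apply: le_ereal_inf_tmp => _ [x Cx <-].
    rewrite lee_fin; apply: HT => //; rewrite ray_distZ ?(ltW t0)// mulrC ler_pM2r//.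
    by apply: zmax; rewrite inE.
  apply: (@le_trans _ _ (u t (t *: x0))%:E).
    by apply: ereal_inf_lbound; exists x0.
  by rewrite lee_fin (le_trans (u_le1 _ t0))//; lra.
have [z + zmin] := compact_EVT_min (ex_intro _ _ Cx0) cC wc.
rewrite inE => Cz; have z2 : 2 < ray_dist z.
  by rewrite ltNge; apply/negP => /closure_wulff; exact: CW.
apply: cvge_pinftyP => eps eps0.
have [T T1 HT] := solution_decay hu z2 eps0.
exists T => t tT; have t0 : 0 < t by lra.
apply/andP; split.
  apply: (@le_trans _ _ (u t (t *: x0))%:E).
    by rewrite lee_fin (le_trans _ (u_ge0 _ t0))//; lra.
  by apply: ereal_sup_ubound; exists x0.
apply: ge_ereal_sup => _ [x Cx <-].
rewrite lee_fin add0r; apply: HT => //.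
rewrite ray_distZ ?(ltW t0)// mulrC ler_pM2l//.
by apply: zmin; rewrite inE.
Qed.

(** The rescaled level set lies between the tubes of radii 2 (1 - th) and 2 / (1 - th); [shrink]
    maps the larger into W and W into the smaller. Taking [K] a closed ball gives (iv), [K] the
    whole space the unrestricted limit. *)
Lemma hausdorff_superlevel (K : set 'rV[R]_m.+2) lam : 0 < lam < 1 ->
  (forall theta x, 0 <= theta <= 1 -> K x -> K (shrink theta x)) ->
  hausdorff (K `&` scale t^-1 (superlevel u lam t)) (K `&` wulff U) @[t --> +oo] --> 0%E.
Proof.
move=> /andP[lam0 lam1] Ks; apply: cvge_pinftyP => eps eps0.
(* th <= 1/2 bounds the larger radius by 4, so points move by at most 4 th <= eps. *)
pose th := Num.min (1 / 2) (eps / 4).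
have th0 : 0 < th by rewrite lt_min !divr_gt0.
have th1 : th <= 1 / 2 by rewrite ge_min lexx.
have the : th <= eps / 4 by rewrite ge_min lexx orbT.
have th01 : 0 <= th <= 1 by apply/andP; split; lra.
have c2 : 2 < 2 / (1 - th) by rewrite ltr_pdivlMr; lra.
have c2' : 2 * (1 - th) < 2 by lra.
have [T1 T11 HT1] := solution_decay hu c2 lam0.
(* A value above [lam], because superlevel sets are strict. *)
have l1 : (1 + lam) / 2 < 1 by lra.
have [T2 T21 HT2] := solution_growth c2' l1.
exists (T1 + T2) => t tT; have t0 : 0 < t by lra.
rewrite !add0r; apply/andP; split.
  apply: le_trans (hausdorff_ge0 _ _); rewrite lee_fin; lra.
apply: hausdorff_le; first exact: ltW.
  move=> x [Kx [y /= ylam yx]].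
  have yt : y = t *: x by rewrite -yx scalerA divff ?scale1r// gt_eqF.
  have xd : ray_dist x < 2 / (1 - th).
    rewrite ltNge; apply/negP => xd.
    have : u t y <= lam.
      apply: HT1; first by lra.
      by rewrite yt ray_distZ ?(ltW t0)// mulrC ler_pM2l.
    by rewrite leNgt ylam.
  exists (shrink th x); first split.
  - exact: Ks.
  - apply/wulff_U12; rewrite ray_dist_shrink//.
    by rewrite ltr_pdivlMr in xd; lra.
  - rewrite enorm_shrinkB ?(ltW th0)//.
    have x4 : ray_dist x <= 4.
      by rewrite ltr_pdivlMr in xd; have := ray_dist_ge0 x; nra.
    by have := ray_dist_ge0 x; nra.
move=> y [Ky /wulff_U12 y2].
exists (shrink th y); first split.
- exact: Ks.
- exists (t *: shrink th y); last by rewrite scalerA mulVf ?scale1r// gt_eqF.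
  rewrite /superlevel /=; apply: (@lt_le_trans _ _ ((1 + lam) / 2)); first by lra.
  apply: HT2; first by lra.
  rewrite ray_distZ ?(ltW t0)// ray_dist_shrink// mulrC ler_pM2r//.
  by rewrite mulrC ler_wpM2r//; lra.
- rewrite enorm_shrinkB ?(ltW th0)//.
  by have := ray_dist_ge0 y; nra.
Qed.

Lemma prop_iv_U12 : prop_iv U u.
Proof.
move=> Rad lam Rad0 lam01; rewrite closure_eball//.
apply: hausdorff_superlevel => // theta x th01 /= xR.
exact: (le_trans (enorm_shrink _ th01)).
Qed.

Lemma far_curve (K : R) : exists s : R, 0 <= s /\ K <= Num.sqrt s.
Proof.
exists (K ^+ 2); split; first exact: sqr_ge0.
by rewrite sqrtr_sqr ler_norm.
Qed.

(** At each large time the curve has points at distance at least 4t from the half-line, whereas the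
    level set stays within 3t, so the quotient is at least 1. *)
Lemma not_prop_v_U12 : ~ prop_v U u.
Proof.
have h0 : (0 : R) < 1 / 2 by rewrite divr_gt0.
have h1 : (1 : R) / 2 < 1 by rewrite ltr_pdivrMr// mul1r ltr1n.
move=> /(_ _ (introT andP (conj h0 h1))) H.
have : \forall t \near +oo, (hausdorff (superlevel u (1 / 2) t)
    (sumset U (eball (cstar * t))) * (t^-1)%:E < 1)%E.
  apply: (H [set y | (y < 1)%E]).
  by apply: open_nbhs_nbhs; split; [exact: open_ereal_lt_ereal|rewrite /= lte_fin].
move=> {}H; have c3 : (2 : R) < 3 by rewrite ltr_nat.
have [T T1 HT] := solution_decay hu c3 (divr_gt0 ltr01 (ltr0n _ 2)).
have [t [tT]] : exists t : R, T <= t /\ (hausdorff (superlevel u (1 / 2) t)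
    (sumset U (eball (cstar * t))) * (t^-1)%:E < 1)%E.
  near (pinfty_nbhs R) => t; exists t; split; last by near: t.
  by near: t; apply: nbhs_pinfty_ge; exact: num_real.
apply/negP; rewrite -leNgt; have t0 : 0 < t by lra.
have [s [s0 sK]] := far_curve (4 * t).
pose p := s *: ax + Num.sqrt s *: ax2.
have Sp : sumset U (eball (cstar * t)) p.
  exists p, 0; split; [exact: curve_U12| |by rewrite addr0].
  by rewrite /eball /= enorm0 mulr_gt0.
apply: (@le_trans _ _ (t%:E * (t^-1)%:E)%E); first by rewrite -EFinM divff ?gt_eqF.
rewrite lee_pmul2r ?lte_fin ?invr_gt0//.
apply: (le_trans _ (dist_le_hausdorffr _ Sp)).
apply: dist_ge => y /= yl.
have y3 : ray_dist y < 3 * t.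
  by rewrite ltNge; apply/negP => /(HT _ _ tT); rewrite leNgt yl.
by have := ray_dist_lip p y; rewrite curve_ray_dist// enormBC; lra.
Unshelve. all: by end_near. Qed.

End asymptotics.

(** * Nonconvergence of the rescaled neighbourhoods of U *)

Section nonconvergence.
Context {R : realType} {m : nat}.
Implicit Types (s t T : R).

Local Notation U := (@U12 R m.+2).
Local Notation ax := (@axis R m).
Local Notation ax2 := (@axis2 R m).

(* At times T and 4T the rescaled curves x_2 = sqrt(x_1 / t) drift infinitely far apart. *)
Lemma no_limit_set : ~ (exists W' : set 'rV[R]_m.+2,
  hausdorff (sumset (scale t^-1 U) (eball cstar)) W' @[t --> +oo] --> 0%E).
Proof.
move=> [W' H].
have : \forall t \near +oo,
    (hausdorff (sumset (scale t^-1 U) (eball cstar)) W' < 1)%E.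
  apply: (H [set y | (y < 1)%E]).
  by apply: open_nbhs_nbhs; split; [exact: open_ereal_lt_ereal|rewrite /= lte_fin].
move=> {}H.
have [T [T1 HT]] : exists T : R, 1 <= T /\ forall t, T <= t ->
    (hausdorff (sumset (scale t^-1 U) (eball cstar)) W' < 1)%E.
  have [M [_ HM]] := H; exists (`|M| + 1); split; first by rewrite lerDr.
  by move=> t tM; apply: HM; have := ler_norm M; lra.
have T0 : 0 < T by lra.
(* If U has a point within 16 T of 4 p, then 4 sqrt s, the distance of 4 p from the half-line, is at
   most 16 T + 1 + (2 sqrt s + 4 T); this [s] violates that. *)
pose s := (16 * T + 10) ^+ 2.
have ss : Num.sqrt s = 16 * T + 10 by rewrite /s sqrtr_sqr ger0_norm//; lra.
have s0 : 0 <= s by exact: sqr_ge0.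
pose p := s *: ax + Num.sqrt s *: ax2.
have Sp : sumset (scale T^-1 U) (eball cstar) (T^-1 *: p).
  exists (T^-1 *: p), 0; split; [by exists p => //; exact: curve_U12| |by rewrite addr0].
  by rewrite /eball /= enorm0.
have [w Ww wp] := dist_ltP (le_lt_trans (dist_le_hausdorff W' Sp) (HT T (lexx T))).
have T4 : T <= 4 * T by lra.
have [q [_ [b [[y Uy <-] b2 ->]]] qw] :=
  dist_ltP (le_lt_trans (dist_le_hausdorffr _ Ww) (HT (4 * T) T4)).
have y0 := U12_coord0 Uy.
(* 4 = 1 + 1 + 2: two Hausdorff distances and the radius of the ball. *)
have close : enorm ((4 * T)^-1 *: y - T^-1 *: p) < 4.
  have -> : (4 * T)^-1 *: y - T^-1 *: p =
      ((4 * T)^-1 *: y + b - w) + (w - T^-1 *: p) - b.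
    by apply/rowP => i; rewrite !mxE; ring.
  apply: (le_lt_trans (ler_enormD _ _)); rewrite enormN.
  have := ler_enormD ((4 * T)^-1 *: y + b - w) (w - T^-1 *: p).
  by rewrite /eball /cstar /= in b2; lra.
have far : enorm (y - 4 *: p) < 16 * T.
  have -> : y - 4 *: p = (4 * T) *: ((4 * T)^-1 *: y - T^-1 *: p).
    rewrite scalerBr !scalerA divff ?scale1r; last by rewrite gt_eqF// mulr_gt0.
    by rewrite -mulrA divff ?mulr1// gt_eqF.
  rewrite enormZ ger0_norm; last by lra.
  by rewrite (_ : 16 * T = 4 * T * 4) ?ltr_pM2l ?mulr_gt0//; ring.
have pc : p ord0 ord0 = s by rewrite !mxE /= mulr1 mulr0 addr0.
have yc : y ord0 ord0 <= 4 * s + 16 * T.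
  have := ler_coord_enorm (y - 4 *: p) ord0.
  have -> : (y - 4 *: p) ord0 ord0 = y ord0 ord0 - 4 * s by rewrite -pc !mxE.
  by have := ler_norm (y ord0 ord0 - 4 * s); lra.
have sy : Num.sqrt (y ord0 ord0) <= 2 * (16 * T + 10) + 4 * T.
  have r0 : 0 <= 2 * (16 * T + 10) + 4 * T by lra.
  rewrite -[leRHS]ger0_norm// -sqrtr_sqr ler_wsqrtr//; apply: (le_trans yc).
  by rewrite /s; nra.
have := ray_dist_lip (4 *: p) y; rewrite ray_distZ// curve_ray_dist// enormBC ss.
by have := U12_ray_dist Uy; lra.
Qed.

End nonconvergence.

Theorem proposition6p2 (R : realType) (N : nat) (hN : (2 <= N)%N)
  (u : R -> 'rV[R]_N -> R)
  (hu : bounded_classical_solution logistic (\1_(@U12 R N)) u) :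
  let U := @U12 R N in
  (U° !=set0) /\
  (forall rho : R, 0 < rho -> ~ condD rho U) /\
  (forall rho : R, 0 < rho <= 1 -> condG rho U) /\
  (prop_i U u /\ prop_ii U u /\ prop_iii U u /\ prop_iv U u) /\
  ~ prop_v U u /\
  (forall lam : R, 0 < lam < 1 ->
     hausdorff (scale t^-1 (superlevel u lam t)) (wulff U)
       @[t --> +oo] --> 0%E) /\
  ~ (exists W' : set 'rV[R]_N,
       hausdorff (sumset (scale t^-1 U) (eball cstar)) W'
         @[t --> +oo] --> 0%E).
Proof.
move=> U; rewrite {}/U.
case: N hN u hu => [|[|m]] // _ u hu.
split.
  exists (1 *: axis); apply: (@ball_U12_interior _ _ 1) => //.
  by rewrite subrr enorm0.
split; first exact: not_condD.
split; first exact: condG_U12.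
split.
  split; first exact: prop_i_U12.
  split; first exact: prop_ii_U12.
  by split; [exact: prop_iii_U12|exact: prop_iv_U12].
split; first exact: not_prop_v_U12.
split; last exact: no_limit_set.
move=> lam lam01.
(* The whole space is trivially stable under [shrink]. *)
have := @hausdorff_superlevel _ _ u hu setT lam lam01 (fun _ _ _ _ => I).
by under eq_fun do rewrite !setTI.
Qed.
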